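(* Let $\gamma$ be a nonnegative random variable whose moment generating function is \[ \mathcal{M}_{\gamma}(s)=\mathbb{E}[e^{s\gamma}]=\prod_{i=1}^n\left(1-\frac{s}{a_i}\right)^{-b_i}, \] where $a_1,\dots,a_n,b_1,\dots,b_n$ are complex numbers with $\operatorname{Re}[a_i]>0$ for $i=1,\dots,n$ and $\sum_{i=1}^n b_i>0$. Write $B=\sum_{i=1}^n b_i$. Then: (i) The cumulative distribution function of $\gamma$ is, for $\gamma\ge 0$, \[ F_\gamma(\gamma)=\frac{\prod_{i=1}^n (a_i)^{b_i}}{\Gamma(1+B)}\,\gamma^{B}\,\Phi_2^{(n)}\!\left(b_1,\dots,b_n;1+B;-a_1\gamma,\dots,-a_n\gamma\right). \] (ii) For every $p>0$, \[ \mathbb{E}\big[Q(\sqrt{p\gamma})\big]=\frac{1}{2\sqrt{\pi}}\left\{\prod_{i=1}^n (a_i)^{b_i}\right\}\frac{\Gamma\left(\tfrac12+B\right)}{\Gamma(1+B)}\left(\frac{2}{p}\right)^{B} F_D^{(n)}\!\left(\tfrac12+B,b_1,\dots,b_n;1+B;-\frac{2a_1}{p},\dots,-\frac{2a_n}{p}\right). \]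
   Context: $Q(x)=\frac{1}{\sqrt{2\pi}}\int_x^\infty e^{-t^2/2}\,dt$ is the Gaussian $Q$-function and $\Gamma$ is the gamma function. The moment generating function of a nonnegative random variable $\gamma$ with density $f_\gamma$ is $\mathcal{M}_\gamma(s)=\mathbb{E}[e^{s\gamma}]$, i.e. the Laplace transform of $f_\gamma$ evaluated at $-s$; powers of complex numbers use the principal branch. With $(x)_m$ the Pochhammer symbol, the confluent Lauricella function is $\Phi_2^{(n)}(b_1,\dots,b_n;c;x_1,\dots,x_n)=\sum_{m_1,\dots,m_n\ge0}\frac{(b_1)_{m_1}\cdots(b_n)_{m_n}}{(c)_{m_1+\cdots+m_n}}\frac{x_1^{m_1}\cdots x_n^{m_n}}{m_1!\cdots m_n!}$, and the Lauricella function $F_D^{(n)}(a,b_1,\dots,b_n;c;x_1,\dots,x_n)=\sum_{m_1,\dots,m_n\ge0}\frac{(a)_{m_1+\cdots+m_n}(b_1)_{m_1}\cdots(b_n)_{m_n}}{(c)_{m_1+\cdots+m_n}}\frac{x_1^{m_1}\cdots x_n^{m_n}}{m_1!\cdots m_n!}$ for $|x_i|<1$, extended elsewhere by analytic continuation. *)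

(* Defs.v *)
From HB Require Import structures.
From mathcomp Require Import all_boot all_order all_algebra.
From mathcomp Require Import all_classical all_reals all_analysis.
From mathcomp Require Import complex.

Set Implicit Arguments.
Unset Strict Implicit.
Unset Printing Implicit Defensive.

Import Order.TTheory GRing.Theory Num.Theory.
Import numFieldNormedType.Exports.
Local Open Scope ring_scope.
Local Open Scope classical_set_scope.
Local Open Scope complex_scope.

Section Defs.
Variable R : realType.
Local Notation C := R[i].

Definition cmod (z : C) : R := Num.sqrt (complex.Re z ^+ 2 + complex.Im z ^+ 2).

Definition cexp (z : C) : C :=
  (expR (complex.Re z))%:C * ((cos (complex.Im z))%:C + 'i * (sin (complex.Im z))%:C).

(* principal argument, in (-pi, pi] (arg 0 := 0) *)
Definition carg (z : C) : R :=
  if 0 < complex.Re z then atan (complex.Im z / complex.Re z)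
  else if complex.Re z < 0 then
    (if 0 <= complex.Im z then atan (complex.Im z / complex.Re z) + pi else atan (complex.Im z / complex.Re z) - pi)
  else if 0 < complex.Im z then pi / 2
  else if complex.Im z < 0 then - (pi / 2) else 0.

Definition clog (z : C) : C := (ln (cmod z))%:C + 'i * (carg z)%:C.

Definition cpow (z w : C) : C :=
  if z == 0 then (if w == 0 then 1 else 0) else cexp (w * clog z).

Definition Gamma (x : R) : R :=
  fine (\int[lebesgue_measure]_(t in `]0%R, +oo[) (t `^ (x - 1) * expR (- t))%:E)%E.

Definition Qfun (x : R) : R :=
  (Num.sqrt (2 * pi))^-1 *
  fine (\int[lebesgue_measure]_(t in `[x, +oo[) (expR (- (t ^+ 2) / 2))%:E)%E.

Definition poch (z : C) (m : nat) : C := \prod_(k < m) (z + k%:R).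

Definition ccvg (u : nat -> C) (l : C) : Prop :=
  ((fun N => complex.Re (u N)) @ \oo --> complex.Re l) /\ ((fun N => complex.Im (u N)) @ \oo --> complex.Im l).

Definition climn (u : nat -> C) : C :=
  (limn (fun N => complex.Re (u N)))%:C + 'i * (limn (fun N => complex.Im (u N)))%:C.

Variable n : nat.

Definition box_partial (t : ('I_n -> nat) -> C) (N : nat) : C :=
  \sum_(m : {ffun 'I_n -> 'I_N}) t (fun i => nat_of_ord (m i)).

Definition Phi2_term (b : 'I_n -> C) (c : C) (x : 'I_n -> C)
  (m : 'I_n -> nat) : C :=
  (\prod_(i < n) poch (b i) (m i)) / poch c (\sum_(i < n) m i) *
  \prod_(i < n) (x i ^+ m i / (m i)`!%:R).

(* Phi_2^(n)(b; c; x): sum of the (everywhere absolutely convergent) series *)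
Definition Phi2 (b : 'I_n -> C) (c : C) (x : 'I_n -> C) : C :=
  climn (box_partial (Phi2_term b c x)).

Definition FD_term (a : C) (b : 'I_n -> C) (c : C) (x : 'I_n -> C)
  (m : 'I_n -> nat) : C :=
  poch a (\sum_(i < n) m i) * (\prod_(i < n) poch (b i) (m i)) /
  poch c (\sum_(i < n) m i) *
  \prod_(i < n) (x i ^+ m i / (m i)`!%:R).

Definition FD_domain (x : 'I_n -> C) : Prop :=
  forall i, ~ (complex.Im (x i) = 0 /\ 1 <= complex.Re (x i)).

Definition upd (x : 'I_n -> C) (i : 'I_n) (h : C) : 'I_n -> C :=
  fun j => if j == i then x j + h else x j.

(* holomorphy on a set D of C^n: continuity and complex differentiability
   in each variable separately (equivalent to holomorphy by Osgood's lemma) *)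
Definition holomorphic_on (D : ('I_n -> C) -> Prop) (g : ('I_n -> C) -> C) :=
  (forall x, D x -> forall e : R, 0 < e -> exists2 d : R, 0 < d &
     forall y, D y -> (forall i, cmod (y i - x i) < d) -> cmod (g y - g x) < e)
  /\
  (forall x, D x -> forall i, exists dv : C, forall e : R, 0 < e ->
     exists2 d : R, 0 < d & forall h : C, h != 0 -> cmod h < d ->
       cmod ((g (upd x i h) - g x) / h - dv) < e).

Definition FD_continuation (a : C) (b : 'I_n -> C) (c : C)
  (g : ('I_n -> C) -> C) : Prop :=
  holomorphic_on FD_domain g /\
  (forall x, (forall i, cmod (x i) < 1) ->
     ccvg (box_partial (FD_term a b c x)) (g x)).

End Defs.

(* Main.v *)
(* (i) Expanding (1 + a_i / l)^(-b_i) in binomial series and integrating x^(B + m) exp(-l x) term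
   by term shows that, for large l, the Laplace transform of the right-hand side agrees with that
   of the cdf, which is M(-l) / l.  Uniqueness of Laplace transforms (for functions that are
   right continuous) concludes.

   (ii) Craig's formula pi Q(x) = int_0^oo exp(-(1 + s^2) x^2 / 2) / (1 + s^2) ds and Tonelli
   turn the mean of Q(sqrt(p gamma)) into the integral of M(-p (1 + s^2) / 2) / (1 + s^2).  With
   u = 1 / (1 + s^2) the integrand becomes a multiple of
   (1 + s^2)^(-(B + 1)) prod_i (1 - u x_i)^(-b_i) with x_i = -2 a_i / p.
   Up to a normalising constant this is the one-variable Euler integral of F_D, which defines its
   analytic continuation to the set where no x_i lies in [1, +oo[. *)
Require Import Defs.
From HB Require Import structures.
From mathcomp Require Import all_boot all_order all_algebra.
From mathcomp Require Import all_classical all_reals all_analysis.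
From mathcomp Require Import measurable_realfun complex ring lra.
Import Order.TTheory GRing.Theory Num.Theory.
Import numFieldNormedType.Exports.
Local Open Scope ring_scope.
Local Open Scope complex_scope.
Local Open Scope classical_set_scope.

Set Implicit Arguments.
Unset Strict Implicit.
Unset Printing Implicit Defensive.
Set SsrOldRewriteGoalsOrder.

Local Notation Re := complex.Re.
Local Notation Im := complex.Im.

(** * Complex modulus, exponential and principal powers *)

(** All integrals are of real functions, whereas both right-hand sides are complex expressions whose
    reality is part of the claim; complex identities are therefore integrated one component at a
    time. The moment generating function is given at real s <= 0 only, so uniqueness has to work
    from the values of a transform along an arithmetic progression of large real l. Large l is
    needed twice: the binomial series require |a_i| < l, and the bound used for Phi_2 grows like
    exp(2 x sum |a_i|). Summing over boxes fits this plan: a box sum of products is a product of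
    one-variable partial sums, and once integration has cancelled (1 + B)_|m|, every finite box sum
    is exactly such a product. Since Re a_i > 0, the arguments of l / a_i and of 1 + a_i / l stay
    below pi / 2, so principal logarithms add and M(-l) factors for every l > 0, not only for large
    l. Hence (ii) uses no series at the point of evaluation, where |x_i| may exceed 1; series serve
    there only to identify the Euler integral on the unit polydisc. Its holomorphy on the slit
    domain rests on estimates of (1 - u x)^(-b) that are uniform in u. *)

Section ComplexBasics.
Variable R : realType.
Implicit Types (z w : R[i]) (x y t : R).

Lemma cReD z w : Re (z + w) = Re z + Re w. Proof. by case: z w => ? ? []. Qed.
Lemma cImD z w : Im (z + w) = Im z + Im w. Proof. by case: z w => ? ? []. Qed.
Lemma cReN z : Re (- z) = - Re z. Proof. by case: z. Qed.
Lemma cImN z : Im (- z) = - Im z. Proof. by case: z. Qed.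
Lemma cReB z w : Re (z - w) = Re z - Re w. Proof. by rewrite cReD cReN. Qed.
Lemma cImB z w : Im (z - w) = Im z - Im w. Proof. by rewrite cImD cImN. Qed.
Lemma cReM z w : Re (z * w) = Re z * Re w - Im z * Im w.
Proof. by case: z w => ? ? []. Qed.
Lemma cImM z w : Im (z * w) = Re z * Im w + Im z * Re w.
Proof. by case: z w => ? ? []. Qed.
Lemma cRe_sum (I : Type) (r : seq I) (P : pred I) (F : I -> R[i]) :
  Re (\sum_(i <- r | P i) F i) = \sum_(i <- r | P i) Re (F i).
Proof. by apply: (big_morph _ cReD). Qed.
Lemma cIm_sum (I : Type) (r : seq I) (P : pred I) (F : I -> R[i]) :
  Im (\sum_(i <- r | P i) F i) = \sum_(i <- r | P i) Im (F i).
Proof. by apply: (big_morph _ cImD). Qed.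
Lemma cReZ x z : Re (x%:C * z) = x * Re z.
Proof. by rewrite cReM/= mul0r subr0. Qed.
Lemma cImZ x z : Im (x%:C * z) = x * Im z.
Proof. by rewrite cImM/= mul0r addr0. Qed.
Lemma complex_ext z w : Re z = Re w -> Im z = Im w -> z = w.
Proof. by case: z w => ? ? [? ?] /= -> ->. Qed.

Lemma cmodE z : cmod z = Normc.normc z. Proof. by case: z. Qed.
Lemma cmodM z w : cmod (z * w) = cmod z * cmod w.
Proof. by rewrite !cmodE Normc.normcM. Qed.
Lemma cmodV z : cmod z^-1 = (cmod z)^-1.
Proof. by rewrite !cmodE Normc.normcV. Qed.
Lemma cmod_div z w : cmod (z / w) = cmod z / cmod w.
Proof. by rewrite cmodM cmodV. Qed.
Lemma cmodD z w : cmod (z + w) <= cmod z + cmod w.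
Proof. by rewrite !cmodE; exact: le_normcD. Qed.
Lemma cmodN z : cmod (- z) = cmod z.
Proof. by rewrite /cmod cReN cImN !sqrrN. Qed.
Lemma cmodB z w : cmod (z - w) <= cmod z + cmod w.
Proof. by rewrite -(cmodN w); exact: cmodD. Qed.
Lemma cmodBC z w : cmod (z - w) = cmod (w - z).
Proof. by rewrite -cmodN opprB. Qed.
Lemma cmod_ge0 z : 0 <= cmod z. Proof. exact: sqrtr_ge0. Qed.
Lemma cmod0 : cmod (0 : R[i]) = 0.
Proof. by rewrite cmodE Normc.normc0. Qed.
Lemma cmod1 : cmod (1 : R[i]) = 1.
Proof. by rewrite cmodE Normc.normc1. Qed.
Lemma cmodr x : cmod x%:C = `|x|.
Proof. by rewrite /cmod/= expr0n addr0 sqrtr_sqr. Qed.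
Lemma cmod_nat (k : nat) : cmod (k%:R : R[i]) = k%:R.
Proof. by rewrite -(rmorph_nat (real_complex R)) cmodr ger0_norm. Qed.
Lemma cmod_eq0 z : (cmod z == 0) = (z == 0).
Proof.
apply/eqP/eqP => [|->]; last exact: cmod0.
by rewrite cmodE => /Normc.eq0_normc.
Qed.
Lemma cmod_gt0 z : (0 < cmod z) = (z != 0).
Proof. by rewrite lt_def cmod_ge0 andbT cmod_eq0. Qed.
Lemma cmodX z (k : nat) : cmod (z ^+ k) = cmod z ^+ k.
Proof. by elim: k => [|k IH]; rewrite ?expr0 ?cmod1// !exprS cmodM IH. Qed.
Lemma cmod_prod (I : Type) (r : seq I) (P : pred I) (F : I -> R[i]) :
  cmod (\prod_(i <- r | P i) F i) = \prod_(i <- r | P i) cmod (F i).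
Proof. by apply: (big_morph _ cmodM cmod1). Qed.
Lemma cmod_sum (I : Type) (r : seq I) (P : pred I) (F : I -> R[i]) :
  cmod (\sum_(i <- r | P i) F i) <= \sum_(i <- r | P i) cmod (F i).
Proof.
elim/big_rec2 : _ => [|i y1 y2 _ IH]; first by rewrite cmod0.
by rewrite (le_trans (cmodD _ _))// lerD2l.
Qed.
Lemma cmod_sqr z : cmod z ^+ 2 = Re z ^+ 2 + Im z ^+ 2.
Proof. by rewrite /cmod sqr_sqrtr// addr_ge0 ?sqr_ge0. Qed.
Lemma norm_Re_le z : `|Re z| <= cmod z.
Proof.
by rewrite -sqrtr_sqr ler_sqrt ?lerDl ?sqr_ge0// addr_ge0 ?sqr_ge0.
Qed.
Lemma norm_Im_le z : `|Im z| <= cmod z.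
Proof.
by rewrite -sqrtr_sqr ler_sqrt ?lerDr ?sqr_ge0// addr_ge0 ?sqr_ge0.
Qed.
Lemma cmod_leD z : cmod z <= `|Re z| + `|Im z|.
Proof.
rewrite -ler_sqr ?nnegrE ?cmod_ge0 ?addr_ge0// cmod_sqr sqrrD !real_normK ?num_real//.
by rewrite addrAC lerDl mulrn_wge0// mulr_ge0.
Qed.

Lemma real_complexB x y : (x - y)%:C = x%:C - y%:C :> R[i].
Proof. by rewrite rmorphB. Qed.
Lemma real_complexM x y : (x * y)%:C = x%:C * y%:C :> R[i].
Proof. by rewrite rmorphM. Qed.
Lemma real_complexV x : (x^-1)%:C = (x%:C)^-1 :> R[i].
Proof. by rewrite fmorphV. Qed.
Lemma real_complex_eq0 x : (x%:C == 0 :> R[i]) = (x == 0).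
Proof. by rewrite eq_complex/= eqxx andbT. Qed.

Lemma cexpE z :
  cexp z = (expR (Re z) * cos (Im z)) +i* (expR (Re z) * sin (Im z)).
Proof. by apply: complex_ext; rewrite ?cReZ ?cImZ/= ; congr (_ * _); ring. Qed.
Lemma cexpD z w : cexp (z + w) = cexp z * cexp w.
Proof.
rewrite !cexpE; apply: complex_ext; rewrite ?cReM ?cImM/= ?cReD ?cImD expRD ?cosD ?sinD; ring.
Qed.
Lemma cexp0 : cexp (0 : R[i]) = 1.
Proof. by rewrite cexpE/= expR0 cos0 sin0; apply: complex_ext => /=; rewrite mul1r. Qed.
Lemma cexpN z : cexp (- z) = (cexp z)^-1.
Proof.
have h : cexp z * cexp (- z) = 1 by rewrite -cexpD subrr cexp0.
have z0 : cexp z != 0.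
  by apply: contra_eq_neq h => ->; rewrite mul0r eq_sym oner_eq0.
by apply: (mulfI z0); rewrite h divff.
Qed.
Lemma cexp_neq0 z : cexp z != 0.
Proof.
have h : cexp z * cexp (- z) = 1 by rewrite -cexpD subrr cexp0.
by apply: contra_eq_neq h => ->; rewrite mul0r eq_sym oner_eq0.
Qed.
Lemma cmod_cexp z : cmod (cexp z) = expR (Re z).
Proof.
rewrite cexpE /cmod/= !exprMn -mulrDr cos2Dsin2 mulr1 sqrtr_sqr.
by rewrite gtr0_norm// expR_gt0.
Qed.
Lemma cexpr x : cexp x%:C = (expR x)%:C.
Proof. by rewrite cexpE/= cos0 sin0 mulr1 mulr0. Qed.
Lemma cexp_sum (I : Type) (r : seq I) (P : pred I) (F : I -> R[i]) :
  cexp (\sum_(i <- r | P i) F i) = \prod_(i <- r | P i) cexp (F i).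
Proof. by apply: (big_morph _ cexpD cexp0). Qed.

Lemma cos_gt0_le_pi (t : R) : - pi < t < pi -> (0 < cos t) = (`|t| < pi / 2).
Proof.
move=> /andP[t1 t2]; rewrite -(cos_pihalf R) -[in LHS](cos_norm t) ltr_cos//.
- by rewrite in_itv/= normr_ge0 ler_norml; apply/andP; split; lra.
- by rewrite in_itv/=; have := pi_gt0 R; lra.
Qed.

Lemma carg_polar (r t : R) : 0 < r -> - pi < t < pi ->
  carg ((r * cos t) +i* (r * sin t)) = t.
Proof.
move=> r0 tpi; have /andP[t1 t2] := tpi; rewrite /carg/= pmulr_rgt0// pmulr_rlt0//.
have tanE : r * sin t / (r * cos t) = tan t.
  by rewrite /tan -mulf_div divff ?mul1r// gt_eqF.
rewrite tanE cos_gt0_le_pi//.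
case: ifPn => [|th]; first by rewrite ltr_norml => ?; rewrite tanK// in_itv.
have [c0|c0|c0] := ltgtP (cos t) 0.
- rewrite pmulr_rge0//; case: ifPn => s0.
    have tp : pi / 2 < t.
      rewrite ltNge; apply/negP => tp; have : 0 <= t.
        rewrite leNgt; apply/negP => t0; have : 0 < sin (- t).
          by apply: sin_gt0_pi; lra.
        by rewrite sinN; lra.
      move=> t0; have : 0 <= cos t by apply: cos_ge0_pihalf; lra.
      lra.
    (* A negative cosine and a nonnegative sine put t beyond pi / 2, so t - pi lies in the interval
       on which [atan] inverts [tan]; the case below is symmetric. *)
    have -> : tan t = tan (t - pi) by rewrite -(tanDpi (t - pi)) subrK.
    by rewrite tanK ?in_itv/=; lra.
  have tp : t < - (pi / 2).
    rewrite ltNge; apply/negP => tp; have : t <= 0.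
      rewrite leNgt; apply/negP => t0; have : 0 < sin t.
        by apply: sin_gt0_pi; lra.
      by lra.
    move=> t0; have : 0 <= cos t by apply: cos_ge0_pihalf; lra.
    lra.
  have -> : tan t = tan (t + pi) by rewrite tanDpi.
  by rewrite tanK ?in_itv/=; lra.
- by move: th; rewrite -cos_gt0_le_pi// c0.
- have : `|t| = pi / 2.
    apply: (@cos_inj R); rewrite ?in_itv/= ?normr_ge0 ?ler_norml ?cos_norm ?c0 ?cos_pihalf//; have := pi_gt0 R; lra.
  rewrite pmulr_rgt0// pmulr_rlt0//.
  have [t0|t0] := leP 0 t.
    by rewrite ger0_norm// => ->; rewrite sin_pihalf ltr01.
  by rewrite ltr0_norm// => /(congr1 -%R); rewrite opprK => ->; rewrite sinN sin_pihalf oppr_gt0 ltr10 oppr_lt0 ltr01.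
Qed.

(** The plane cut along ]-oo, 0], written as a boolean test. There the argument is strictly between
    -pi and pi, which makes [clog] and [cexp] mutually inverse. *)
Definition slit z := (0 < Re z) || (Im z != 0).

Lemma slit_gt0 z : slit z -> 0 < cmod z + Re z.
Proof.
move=> /orP[z0|z0]; first by rewrite ltr_wpDl// cmod_ge0.
have : `|Re z| < cmod z.
  rewrite -ltr_sqr ?nnegrE ?cmod_ge0// cmod_sqr real_normK ?num_real//.
  by rewrite ltrDl lt_def sqr_ge0 sqrf_eq0 z0.
by rewrite ltr_norml; lra.
Qed.

Lemma slit_neq0 z : slit z -> z != 0.
Proof. by apply: contraTneq => ->; rewrite /slit/= ltxx eqxx. Qed.

Lemma atan_lt_pihalf t : `|2 * atan t| < pi.
Proof.
by rewrite ltr_norml; have := atan_gtNpi2 t; have := atan_ltpi2 t; lra.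
Qed.

(* tan (arg z / 2) = Im z / (|z| + Re z): a single formula for the argument on the whole slit
   plane, where the definition by quadrants needs several cases. *)
Lemma slit_polar z (t := 2 * atan (Im z / (cmod z + Re z))) : slit z ->
  z = (cmod z * cos t) +i* (cmod z * sin t).
Proof.
move=> sz; have D0 := slit_gt0 sz; have r0 : 0 < cmod z by rewrite cmod_gt0 slit_neq0.
have := cmod_sqr z; move: D0 r0 @t; set r := cmod z; case: z {sz} @r => x y r /=.
move=> D0 r0 rE; set u := y / (r + x); set t := 2 * atan u.
have u1 : 0 < 1 + u ^+ 2 by rewrite ltr_pwDl ?ltr01 ?sqr_ge0.
have ue : 1 + u ^+ 2 = 2 * r / (r + x).
  rewrite /u; apply/eqP; rewrite -subr_eq0; apply/eqP.
  have -> : 1 + (y / (r + x)) ^+ 2 - 2 * r / (r + x) =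
     ((x ^+ 2 + y ^+ 2) - r ^+ 2) / (r + x) ^+ 2 by field; lra.
  by rewrite -rE subrr mul0r.
have ca : cos (atan u) ^+ 2 = (r + x) / (2 * r).
  by rewrite cos_atan exprVn sqr_sqrtr ?ltW// ue invf_div.
have sa : sin (atan u) = u * cos (atan u).
  rewrite -{2}(atanK u) /tan divfK// gt_eqF// cos_gt0_pihalf//.
  by rewrite atan_gtNpi2 atan_ltpi2.
have ce : cos t = x / r.
  rewrite /t mulrC mulr_natr cos_mulr2n ca; field; lra.
have se : sin t = y / r.
  rewrite /t mulrC mulr_natr sin_mulr2n sa mulrCA -expr2 ca /u; field; lra.
by apply: complex_ext => /=; rewrite ?ce ?se; field; lra.
Qed.

Lemma carg_slit z : slit z -> carg z = 2 * atan (Im z / (cmod z + Re z)).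
Proof.
move=> sz; rewrite {1}(slit_polar sz) carg_polar//; first by rewrite cmod_gt0 slit_neq0.
by rewrite -ltr_norml atan_lt_pihalf.
Qed.

Lemma carg_slit_lt z : slit z -> `|carg z| < pi.
Proof. by move=> sz; rewrite carg_slit// atan_lt_pihalf. Qed.

Lemma clogE z : clog z = (ln (cmod z)) +i* carg z.
Proof. by apply: complex_ext; rewrite /clog ?cReD ?cImD ?cReM ?cImM/=; ring. Qed.

Lemma cexp_clog z : slit z -> cexp (clog z) = z.
Proof.
move=> sz; rewrite clogE cexpE/= lnK ?posrE ?cmod_gt0 ?slit_neq0//.
by rewrite [RHS](slit_polar sz) carg_slit.
Qed.

Lemma clog_cexp z : `|Im z| < pi -> clog (cexp z) = z.
Proof.
move=> zpi; rewrite clogE cmod_cexp expRK cexpE carg_polar ?expR_gt0 -?ltr_norml//.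
by case: z {zpi}.
Qed.

(** Both sides have the same exponential, and the bound on the sum of the arguments keeps the
    right-hand side in the strip where [clog_cexp] applies. *)
Lemma clogM z w : slit z -> slit w -> `|carg z + carg w| < pi ->
  clog (z * w) = clog z + clog w.
Proof.
move=> sz sw h; rewrite -{1}(cexp_clog sz) -{1}(cexp_clog sw) -cexpD clog_cexp//.
by rewrite cImD !clogE.
Qed.

Lemma cpowE z w : z != 0 -> cpow z w = cexp (w * clog z).
Proof. by rewrite /cpow => /negPf ->. Qed.

Lemma cpowM z w b : slit z -> slit w -> `|carg z + carg w| < pi ->
  cpow (z * w) b = cpow z b * cpow w b.
Proof.
move=> sz sw h; rewrite !cpowE ?mulf_neq0 ?slit_neq0// clogM// mulrDr.
by rewrite cexpD.
Qed.

Lemma cpow_neq0 z b : z != 0 -> cpow z b != 0.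
Proof. by move=> z0; rewrite cpowE// cexp_neq0. Qed.

Lemma cpowN z b : z != 0 -> cpow z (- b) = (cpow z b)^-1.
Proof. by move=> z0; rewrite !cpowE// mulNr cexpN. Qed.

Lemma carg_Re_gt0 z : 0 < Re z -> carg z = atan (Im z / Re z).
Proof. by rewrite /carg => ->. Qed.

Lemma carg_Re_gt0_lt z : 0 < Re z -> `|carg z| < pi / 2.
Proof.
by move=> z0; rewrite carg_Re_gt0// ltr_norml atan_gtNpi2 atan_ltpi2.
Qed.

Lemma slit_Re z : 0 < Re z -> slit z. Proof. by rewrite /slit => ->. Qed.

Lemma clog_real x : 0 < x -> clog x%:C = (ln x)%:C.
Proof.
by move=> x0; rewrite clogE cmodr gtr0_norm// carg_Re_gt0//= mul0r atan0.
Qed.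

Lemma clogV z : slit z -> clog z^-1 = - clog z.
Proof.
move=> sz; rewrite -{1}(cexp_clog sz) -cexpN clog_cexp// cImN normrN clogE/=.
exact: carg_slit_lt.
Qed.

End ComplexBasics.

(** * Complex-valued functions of a real variable *)

Section ComplexDerivative.
Variable R : realType.
Implicit Types (f g : R -> R[i]) (t : R).

Definition cderive f t (l : R[i]) :=
  is_derive t (1 : R) (fun x => Re (f x)) (Re l) /\
  is_derive t (1 : R) (fun x => Im (f x)) (Im l).

Lemma cderive_eq f t l l' : cderive f t l -> l = l' -> cderive f t l'.
Proof. by move=> ? <-. Qed.

Lemma cderive_cst (c : R[i]) t : cderive (fun=> c) t 0.
Proof. by split => /=; exact: is_derive_cst. Qed.

Lemma cderiveD f g t l m : cderive f t l -> cderive g t m ->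
  cderive (fun x => f x + g x) t (l + m).
Proof.
move=> [f1 f2] [g1 g2]; rewrite /cderive cReD cImD; split.
  under eq_fun do rewrite cReD; exact: is_deriveD.
under eq_fun do rewrite cImD; exact: is_deriveD.
Qed.

Lemma cderiveM f g t l m : cderive f t l -> cderive g t m ->
  cderive (fun x => f x * g x) t (l * g t + f t * m).
Proof.
move=> [f1 f2] [g1 g2]; rewrite /cderive; split.
  under eq_fun do rewrite cReM; rewrite cReD !cReM.
  apply: (@is_derive_eq _ _ _ _ _ _ _ _ (is_deriveB (is_deriveM f1 g1) (is_deriveM f2 g2))).
  by rewrite /GRing.scale/=; ring.
under eq_fun do rewrite cImM; rewrite cImD !cImM.
apply: (@is_derive_eq _ _ _ _ _ _ _ _ (is_deriveD (is_deriveM f1 g2) (is_deriveM f2 g1))).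
by rewrite /GRing.scale/=; ring.
Qed.

Lemma cderive_sum (n : nat) (F : 'I_n -> R -> R[i]) (L : 'I_n -> R[i]) t :
  (forall i, cderive (F i) t (L i)) ->
  cderive (fun x => \sum_(i < n) F i x) t (\sum_(i < n) L i).
Proof.
elim: n F L => [|n IH] F L h.
  under eq_fun do rewrite big_ord0; rewrite big_ord0; exact: cderive_cst.
under eq_fun do rewrite big_ord_recr/=; rewrite big_ord_recr/=.
by apply: cderiveD => //; exact: IH.
Qed.

Lemma cderive_lin (c : R[i]) t : cderive (fun x => x%:C * c) t c.
Proof.
split.
  under eq_fun do rewrite cReZ.
  apply: (@is_derive_eq _ _ _ _ _ _ _ _ (is_deriveM (is_derive_id t 1) (is_derive_cst (Re c) t 1))).
  by rewrite /GRing.scale/=; ring.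
under eq_fun do rewrite cImZ.
apply: (@is_derive_eq _ _ _ _ _ _ _ _ (is_deriveM (is_derive_id t 1) (is_derive_cst (Im c) t 1))).
by rewrite /GRing.scale/=; ring.
Qed.

Lemma cderiveX f t l (n : nat) : cderive f t l ->
  cderive (fun x => f x ^+ n) t (n%:R * f t ^+ n.-1 * l).
Proof.
move=> fl; elim: n => [|n IH].
  by under eq_fun do rewrite expr0; rewrite !mul0r; exact: cderive_cst.
under eq_fun do rewrite exprS.
apply: cderive_eq (cderiveM fl IH) _ => /=.
case: n {IH} => [|n]; first by rewrite expr0; ring.
by rewrite /= exprS -[n.+2]addn1 natrD; ring.
Qed.

Lemma cderive_cexp f t l : cderive f t l ->
  cderive (fun x => cexp (f x)) t (l * cexp (f t)).
Proof.
move=> [f1 f2]; rewrite /cderive; split.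
  under eq_fun do rewrite cexpE/=.
  have h := is_deriveM (is_derive1_comp (is_derive_expR _) f1)
    (is_derive1_comp (is_derive_cos _) f2).
  apply: (@is_derive_eq _ _ _ _ _ _ _ _ h).
  by rewrite cReM cexpE/= /GRing.scale/=; ring.
under eq_fun do rewrite cexpE/=.
have h := is_deriveM (is_derive1_comp (is_derive_expR _) f1)
    (is_derive1_comp (is_derive_sin _) f2).
apply: (@is_derive_eq _ _ _ _ _ _ _ _ h).
by rewrite cImM cexpE/= /GRing.scale/=; ring.
Qed.

Lemma is_derive_bounded_diff (f df : R -> R) (M : R) :
  (forall t, 0 <= t <= 1 -> is_derive t (1 : R) f (df t)) ->
  (forall t, 0 <= t <= 1 -> `|df t| <= M) -> `|f 1 - f 0| <= M.
Proof.
move=> fd dM; have [||t] := @MVT _ f df 0 1 ltr01.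
- move=> x; rewrite in_itv/= => /andP[x0 x1]; apply: fd; lra.
- apply: derivable_within_continuous => x; rewrite in_itv/= => x01.
  by have [] := fd _ x01.
rewrite in_itv/= => /andP[t0 t1] ->; rewrite subr0 mulr1; apply: dM; lra.
Qed.

(** The factor 2 comes from applying the mean value theorem to the real and imaginary parts
    separately: the intermediate points may differ. *)
Lemma cderive_bounded_diff f (df : R -> R[i]) (M : R) :
  (forall t, 0 <= t <= 1 -> cderive f t (df t)) ->
  (forall t, 0 <= t <= 1 -> cmod (df t) <= M) -> cmod (f 1 - f 0) <= 2 * M.
Proof.
move=> fd dM; rewrite (le_trans (cmod_leD _))// cReB cImB mulr_natl mulr2n lerD//.
  apply: (@is_derive_bounded_diff (fun x => Re (f x)) (fun x => Re (df x))).
    by move=> t /fd[].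
  by move=> t /dM; apply: le_trans; exact: norm_Re_le.
apply: (@is_derive_bounded_diff (fun x => Im (f x)) (fun x => Im (df x))).
  by move=> t /fd[].
by move=> t /dM; apply: le_trans; exact: norm_Im_le.
Qed.

(** [L] is the closed formula ln(q) / 2 + i atan(Im / Re), free of the case distinction in [carg].
    Differentiating it avoids having to show that [clog] keeps this form in a whole neighbourhood of
    s. *)
Lemma cderive_clog (e : R[i]) :
  exists2 L : R -> R[i],
    (forall s, 0 < Re (1 - s%:C * e) -> L s = clog (1 - s%:C * e)) &
    (forall s, 0 < Re (1 - s%:C * e) -> cderive L s (- e / (1 - s%:C * e))).
Proof.
case: e => x y.
have ReE s : Re (1 - s%:C * (x +i* y)) = 1 - s * x by rewrite cReB cReZ.
have ImE s : Im (1 - s%:C * (x +i* y)) = - (s * y) by rewrite cImB cImZ/= sub0r.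
pose q s := (1 - s * x) ^+ 2 + (s * y) ^+ 2.
exists (fun s => (2^-1 * ln (q s)) +i* atan (- (s * y) / (1 - s * x))) => s.
  move=> s0; rewrite clogE carg_Re_gt0// ReE ImE; congr (_ +i* _).
  rewrite /cmod ReE ImE sqrrN -/(q s) -powR12_sqrt; last by rewrite addr_ge0 ?sqr_ge0.
  by rewrite ln_powR.
move=> s0; have := s0; rewrite ReE => r0.
have q0 : 0 < q s by rewrite /q ltr_pwDl ?sqr_ge0// exprn_gt0.
have d1 : is_derive s (1 : R) (fun s => 1 - s * x) (- x).
  have h := is_deriveB (is_derive_cst (1:R) s 1) (is_deriveM (is_derive_id s 1) (is_derive_cst x s 1)).
  apply: (@is_derive_eq _ _ _ _ _ _ _ _ h); rewrite /GRing.scale/=; ring.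
have d2 : is_derive s (1 : R) (fun s => s * y) y.
  have h := (is_deriveM (is_derive_id s 1) (is_derive_cst y s 1)).
  apply: (@is_derive_eq _ _ _ _ _ _ _ _ h); rewrite /GRing.scale/=; ring.
have -> : - (x +i* y) / (1 - s%:C * (x +i* y)) =
  ((- x * (1 - s * x) + s * y ^+ 2) / q s) +i* (- y / q s).
  have z0 : 1 - s%:C * (x +i* y) != 0.
    by apply: contraTneq s0 => ->; rewrite /= ltxx.
  apply: (mulIf z0); rewrite divfK//; apply: complex_ext; rewrite ?cReM ?cImM ReE ImE ?cReN ?cImN/= /q;
    field; rewrite -/(q s) gt_eqF//.
split => /=.
  have h1 := is_deriveD (is_deriveM d1 d1) (is_deriveM d2 d2).
  have h2 := is_deriveZ (2^-1) (is_derive1_comp (is_derive1_ln (x := q s) q0) h1).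
  have -> : (fun s => 2^-1 * ln (q s)) =
    (2^-1 \*: (@ln R \o ((fun s => 1 - s * x) * (fun s => 1 - s * x) +
                  (fun s => s * y) * (fun s => s * y)))).
    by apply/funext => u; rewrite /q !expr2.
  apply: (@is_derive_eq _ _ _ _ _ _ _ _ h2).
  by rewrite /GRing.scale/=; field; rewrite gt_eqF.
have h1 := is_deriveM (is_deriveN d2) (is_deriveV (f := (fun s => 1 - s * x)) (lt0r_neq0 r0) d1).
have h0 u : is_derive u (1:R) (@atan R) (1 + u ^+ 2)^-1.
  by apply: DeriveDef; rewrite ?derivable_atan// -derive1E derive1_atan.
have h2 := is_derive1_comp (h0 _) h1.
apply: (@is_derive_eq _ _ _ _ _ _ _ _ h2).
rewrite -[LHS]/((1 + (- (s * y) / (1 - s * x)) ^+ 2)^-1 *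
  (- (s * y) * (- (1 - s * x) ^- 2 * - x) + (1 - s * x)^-1 * - y)) /q; field.
rewrite -/(q s) (gt_eqF r0)/= gt_eqF//=.
Qed.

End ComplexDerivative.

(** * Binomial and Lauricella series *)

Section BinomialSeries.
Variable R : realType.
Implicit Types (b z : R[i]).

(** Partial sums of the binomial series of (1 - z)^(-b). *)
Definition bin_sum b z (N : nat) : R[i] :=
  \sum_(m < N) poch b m * (z ^+ m / m`!%:R).

Lemma pochS b m : poch b m.+1 = poch b m * (b + m%:R).
Proof. by rewrite /poch big_ord_recr. Qed.

Lemma poch0 b : poch b 0 = 1. Proof. by rewrite /poch big_ord0. Qed.

Lemma pochSl b m : poch b m.+1 = b * poch (b + 1) m.
Proof.
rewrite /poch big_ord_recl addr0; congr (_ * _); apply: eq_bigr => i _.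
by rewrite /= /bump/= natrD; ring.
Qed.

Lemma cmod_poch_le b m : cmod (poch b m) <= \prod_(k < m) (cmod b + k%:R).
Proof.
rewrite /poch cmod_prod; apply: ler_prod => i _; rewrite cmod_ge0/=.
by rewrite (le_trans (cmodD _ _))// cmod_nat.
Qed.

(** The ratio (beta + k) / (k + 1) tends to 1, so it is at most rho from some index [m0] on; the
    first [m0] factors are absorbed in the constant (beta + 1)^m0. *)
Lemma prod_shift_le (beta rho : R) : 0 <= beta -> 1 < rho -> exists2 c, 0 <= c &
  forall m : nat, \prod_(k < m) (beta + k%:R) <= c * rho ^+ m * m`!%:R.
Proof.
move=> b0 r1; pose m0 := Num.bound (beta / (rho - 1)).
have m0P k : (m0 <= k)%N -> beta <= (rho - 1) * k%:R.
  move=> k0; rewrite mulrC -ler_pdivrMr ?subr_gt0//.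
  rewrite (@le_trans _ _ m0%:R) ?ler_nat// ltW// archi_boundP//.
  by rewrite divr_ge0// subr_ge0 ltW.
have P m : \prod_(k < m) (beta + k%:R) <= (beta + 1) ^+ m * m`!%:R.
  elim: m => [|m IH]; first by rewrite big_ord0 expr0 fact0 mul1r.
  rewrite big_ord_recr/= factS mulnC exprSr natrM mulrACA ler_pM//.
  - by apply: prodr_ge0 => i _; rewrite addr_ge0.
  - by rewrite addr_ge0.
  - by rewrite mulrDl mul1r lerD ?ler_nat// ler_peMr// ler1n.
have b1 : 1 <= beta + 1 by rewrite lerDr.
exists ((beta + 1) ^+ m0); first by rewrite exprn_ge0// addr_ge0.
elim=> [|m IH]; first by rewrite big_ord0 expr0 fact0 !mulr1 exprn_ege1.
have [mm0|mm0] := leqP m0 m.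
  rewrite big_ord_recr/= factS exprSr natrM.
  rewrite (_ : _ * _ * _ = ((beta + 1) ^+ m0 * rho ^+ m * m`!%:R) * (rho * m.+1%:R)); last by ring.
  rewrite ler_pM//.
  - by apply: prodr_ge0 => i _; rewrite addr_ge0.
  - by rewrite addr_ge0.
  - by rewrite -natr1; have := m0P _ mm0; lra.
rewrite (le_trans (P _))// ler_pM2r ?ltr0n ?fact_gt0//.
rewrite -[leLHS]mulr1 ler_pM ?ler01//; last by rewrite exprn_ege1// ltW.
  by rewrite exprn_ge0// addr_ge0.
by rewrite ler_weXn2l// ltW.
Qed.

(** The mismatched indices are those of the coefficient (b)_(N+1) / N! in the remainder of the
    binomial series. Pulling out the first factor b leaves (b + 1)_m, which has as many factors as
    m!. *)
Lemma cmod_pochS_le b (rho : R) : 1 < rho -> exists2 c, 0 <= c &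
  forall m : nat, cmod (poch b m.+1) / m`!%:R <= c * rho ^+ m.
Proof.
move=> r1; have [c c0 cP] := prod_shift_le (cmod_ge0 (b + 1)) r1.
exists (cmod b * c); first by rewrite mulr_ge0 ?cmod_ge0.
move=> m; rewrite ler_pdivrMr ?ltr0n ?fact_gt0// pochSl cmodM -!mulrA.
rewrite ler_wpM2l ?cmod_ge0//.
by rewrite (le_trans (cmod_poch_le _ _))// mulrA.
Qed.

Lemma cmod_poch_fact_le b (rho : R) : 1 < rho -> exists2 c, 0 <= c &
  forall m : nat, cmod (poch b m) / m`!%:R <= c * rho ^+ m.
Proof.
move=> r1; have [c c0 cP] := prod_shift_le (cmod_ge0 b) r1.
exists c => // m; rewrite ler_pdivrMr ?ltr0n ?fact_gt0//.
by rewrite (le_trans (cmod_poch_le _ _)).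
Qed.

(* The derivative of bin_sum in z; at m = 0 the junk exponent 0.-1 = 0 is killed by the factor m. *)
Definition bin_sum' b z (N : nat) : R[i] :=
  \sum_(m < N) poch b m / m`!%:R * (m%:R * z ^+ m.-1).

(** The function y = (1 - z)^(-b) solves (1 - z) y' = b y; a partial sum solves it up to a single
    term of top degree. *)
Lemma bin_sum'_eq b z N :
  (1 - z) * bin_sum' b z N.+1 =
  b * bin_sum b z N.+1 - poch b N.+1 / N`!%:R * z ^+ N.
Proof.
elim: N => [|N IH].
  rewrite /bin_sum' /bin_sum !big_ord1 pochS poch0 fact0 !expr0 /= !mul0r !addr0; field.
  by rewrite ?oner_eq0.
rewrite /bin_sum' /bin_sum big_ord_recr [in RHS]big_ord_recr/=.
rewrite -/(bin_sum' b z N.+1) -/(bin_sum b z N.+1) mulrDr IH mulrDr.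
rewrite (pochS b N.+1) factS natrM exprS; field.
by rewrite nat1r !pnatr_eq0 -lt0n fact_gt0.
Qed.

(** A crude bound, uniform on an annulus cut along the negative axis: the real part of the logarithm
    is between ln d and ln M and its imaginary part is at most pi in absolute value. *)
Lemma cmod_cpow_le (d M : R) b z : slit z -> 0 < d -> d <= cmod z <= M ->
  cmod (cpow z b) <= expR (cmod b * (`|ln d| + `|ln M| + pi)).
Proof.
move=> sz d0 /andP[dz zM]; rewrite cpowE ?slit_neq0// cmod_cexp ler_expR.
rewrite (le_trans (ler_norm _))// (le_trans (norm_Re_le _))// cmodM.
rewrite ler_wpM2l ?cmod_ge0// (le_trans (cmod_leD _))// clogE/=.
rewrite lerD//; last by rewrite ltW// carg_slit_lt.
have z0 : 0 < cmod z by exact: lt_le_trans dz.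
rewrite ler_norml; apply/andP; split.
  have : ln d <= ln (cmod z) by rewrite ler_ln.
  have := ler_norm (- ln d); rewrite normrN; have := normr_ge0 (ln M); lra.
have : ln (cmod z) <= ln M by rewrite ler_ln// posrE (lt_le_trans z0).
have := ler_norm (ln M); have := normr_ge0 (ln d); lra.
Qed.

Lemma ball1_bounds (q t : R) z : cmod z <= q -> 0 <= t <= 1 ->
  Re (1 - t%:C * z) >= 1 - q /\ 1 - q <= cmod (1 - t%:C * z) <= 1 + q.
Proof.
move=> zq /andP[t0 t1].
have tz : cmod (t%:C * z) <= q.
  rewrite cmodM cmodr ger0_norm//; apply: le_trans zq.
  by rewrite ler_piMl ?cmod_ge0.
split.
  rewrite cReB/= lerD2l lerN2 (le_trans (ler_norm _))//.
  by rewrite (le_trans (norm_Re_le _)).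
apply/andP; split; last by rewrite (le_trans (cmodB _ _))// cmod1 lerD2l.
have := cmodD (1 - t%:C * z) (t%:C * z); rewrite subrK cmod1; lra.
Qed.

(** Along the segment from 0 to z, the product of the partial sum and (1 - t z)^b starts at 1. By
    [bin_sum'_eq] its derivative contains only the defect term, so the mean value bound controls its
    distance to 1 at t = 1; dividing by (1 - z)^b gives the remainder. *)
Lemma bin_sum_rem b (q : R) : q < 1 -> exists2 c, 0 <= c &
  forall N z, cmod z <= q ->
  cmod (bin_sum b z N.+1 - cpow (1 - z) (- b)) <=
  c * (cmod (poch b N.+1) / N`!%:R) * cmod z ^+ N.+1.
Proof.
move=> q1.
have [q0|q0] := ltP q 0.
  by exists 0 => // N z; have := cmod_ge0 z; lra.
pose K b := expR (cmod b * (`|ln (1 - q)| + `|ln (1 + q)| + pi)).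
have K0 c : 0 <= K c by exact: expR_ge0.
exists (2 * (K b / (1 - q)) * K (- b)).
  by rewrite !mulr_ge0// invr_ge0 subr_ge0 ltW.
move=> N z zq; have [L LE Ld] := cderive_clog z.
have tpos t : 0 <= t <= 1 -> 0 < Re (1 - t%:C * z).
  move=> t01; have [+ _] := ball1_bounds zq t01; lra.
have tK c t : 0 <= t <= 1 -> cmod (cexp (c * L t)) <= K c.
  move=> t01; have t1 := tpos _ t01; rewrite LE// -cpowE; last by rewrite slit_neq0// slit_Re.
  have [_ ?] := ball1_bounds zq t01; apply: cmod_cpow_le => //; last lra.
  exact: slit_Re.
pose D t := bin_sum b (t%:C * z) N.+1 * cexp (b * L t).
pose D' t := - z * cexp (b * L t) / (1 - t%:C * z) * (poch b N.+1 / N`!%:R * (t%:C * z) ^+ N).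
have dD t : 0 <= t <= 1 -> cderive D t (D' t).
  move=> t01; have t1 := tpos _ t01.
  have d1 : cderive (fun t => bin_sum b (t%:C * z) N.+1) t (bin_sum' b (t%:C * z) N.+1 * z).
    rewrite /bin_sum /bin_sum' mulr_suml; apply: cderive_sum => i.
    apply: cderive_eq (cderiveM (cderive_cst _ _) (cderiveM (cderiveX i (cderive_lin z t)) (cderive_cst _ _))) _.
    by rewrite mul0r add0r mulr0 addr0; ring.
  have d2 := cderive_cexp (cderiveM (cderive_cst b t) (Ld _ t1)).
  apply: cderive_eq (cderiveM d1 d2) _.
  have z0 : 1 - t%:C * z != 0 by apply: contraTneq t1 => ->; rewrite /= ltxx.
  have e1 := bin_sum'_eq b (t%:C * z) N.
  apply: (mulIf z0); rewrite /D' mul0r add0r mulrDl.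
  have -> : bin_sum' b (t%:C * z) N.+1 * z * cexp (b * L t) * (1 - t%:C * z) =
     z * cexp (b * L t) * ((1 - t%:C * z) * bin_sum' b (t%:C * z) N.+1) by ring.
  by rewrite e1; field; rewrite ?z0 pnatr_eq0 -lt0n fact_gt0.
have bD t : 0 <= t <= 1 -> cmod (D' t) <=
    K b / (1 - q) * (cmod (poch b N.+1) / N`!%:R) * cmod z ^+ N.+1.
  move=> t01; have /andP[t0 t1] := t01; have [_ /andP[lb _]] := ball1_bounds zq t01.
  have e1 : cmod (cexp (b * L t)) / cmod (1 - t%:C * z) <= K b / (1 - q).
    rewrite ler_pM ?cmod_ge0 ?invr_ge0 ?cmod_ge0 ?tK//.
    rewrite lef_pV2 ?posrE; lra.
  rewrite /D'; move: (cexp _) e1 => E e1.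
  rewrite !cmodM !cmodV cmodN !cmodX cmodM cmodr (ger0_norm t0) cmod_nat.
  have e2 : (t * cmod z) ^+ N <= cmod z ^+ N.
    by rewrite lerXn2r ?nnegrE ?mulr_ge0 ?cmod_ge0// ler_piMl ?cmod_ge0.
  set p := cmod (poch b N.+1) / N`!%:R.
  have p0 : 0 <= p by rewrite mulr_ge0 ?cmod_ge0.
  rewrite (_ : _ * _ = (cmod E / cmod (1 - t%:C * z)) * p * (cmod z * (t * cmod z) ^+ N)); last by rewrite /p; ring.
  have tz0 : 0 <= t * cmod z by rewrite mulr_ge0 ?cmod_ge0.
  rewrite exprS ler_pM ?mulr_ge0 ?exprn_ge0 ?invr_ge0 ?cmod_ge0 ?ler_wpM2r//.
  by rewrite ler_wpM2l ?cmod_ge0.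
have := cderive_bounded_diff dD bD.
have h01 : 0 <= (1:R) <= 1 by rewrite ler01 lexx.
have h00 : 0 <= (0:R) <= 1 by rewrite ler01 lexx.
have D1 : D 1 = bin_sum b z N.+1 * cpow (1 - z) b.
  rewrite /D mul1r LE ?tpos// mul1r -cpowE//.
  by have := slit_neq0 (slit_Re (tpos _ h01)); rewrite mul1r.
have D0 : D 0 = 1.
  rewrite /D LE ?tpos// mul0r subr0 clog_real// ln1 mulr0 cexp0 mulr1.
  rewrite /bin_sum big_ord_recl poch0 expr0 fact0 mul1r divr1 big1 ?addr0// => i _.
  by rewrite expr0n/= mul0r mulr0.
have zn : 1 - z != 0 by have := slit_neq0 (slit_Re (tpos _ h01)); rewrite mul1r.
rewrite D1 D0 => h.
have -> : bin_sum b z N.+1 - cpow (1 - z) (- b) =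
   (bin_sum b z N.+1 * cpow (1 - z) b - 1) * cpow (1 - z) (- b).
  by rewrite mulrBl mul1r cpowN// mulfK// cpow_neq0.
rewrite cmodM.
have e3 : cmod (cpow (1 - z) (- b)) <= K (- b).
  by have := tK (- b) _ h01; rewrite LE ?tpos// mul1r -cpowE.
rewrite (_ : _ * K _ * _ * _ = 2 * (K b / (1 - q) * (cmod (poch b N.+1) / N`!%:R) * cmod z ^+ N.+1) * K (- b)); last by ring.
by rewrite ler_pM ?cmod_ge0.
Qed.

Lemma bin_sum_le (b : R[i]) (q : R) : 0 <= q < 1 -> exists2 c, 0 <= c &
  forall (N : nat) z, cmod z <= q -> cmod (bin_sum b z N) <= c.
Proof.
(* This r exceeds 1, as the growth bound on Pochhammer symbols requires, and still satisfies r q <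
   1, so that a geometric series dominates. *)
move=> /andP[q0 q1]; pose r := 2 / (1 + q).
have r1 : 1 < r by rewrite /r ltr_pdivlMr; lra.
have rq0 : 0 <= r * q by rewrite mulr_ge0// (le_trans ler01)// ltW.
have rq1 : r * q < 1 by rewrite /r mulrAC ltr_pdivrMr; lra.
have [c c0 cP] := cmod_poch_fact_le b r1.
exists (c / (1 - r * q)); first by rewrite divr_ge0//; lra.
move=> N z zq; rewrite /bin_sum (le_trans (cmod_sum _ _ _))//.
rewrite (@le_trans _ _ (\sum_(m < N) c * (r * q) ^+ m))//.
  apply: ler_sum => m _; rewrite !cmodM cmodV cmod_nat cmodX mulrCA mulrC exprMn mulrA.
  by rewrite ler_pM ?mulr_ge0 ?exprn_ge0 ?invr_ge0 ?cmod_ge0// lerXn2r ?nnegrE ?cmod_ge0.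
rewrite -mulr_sumr ler_wpM2l// -[leRHS]div1r ler_pdivlMr ?subr_gt0//.
have := subrX1 (r * q) N => h.
have : (\sum_(i < N) (r * q) ^+ i) * (1 - r * q) = 1 - (r * q) ^+ N by rewrite -opprB mulrN mulrC -h opprB.
by move=> ->; rewrite gerBl exprn_ge0.
Qed.

Lemma bin_sum_cvg b z : cmod z < 1 ->
  (fun N => cmod (bin_sum b z N - cpow (1 - z) (- b))) @ \oo --> 0.
Proof.
move=> z1; pose q := cmod z; have q0 : 0 <= q := cmod_ge0 z; have q1 : q < 1 := z1.
pose r := 2 / (1 + q).
have r1 : 1 < r by rewrite /r ltr_pdivlMr; lra.
have rq0 : 0 <= r * q by rewrite mulr_ge0// (le_trans ler01)// ltW.
have rq1 : r * q < 1 by rewrite /r mulrAC ltr_pdivrMr; lra.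
have [c c0 cP] := bin_sum_rem b z1.
have [d d0 dP] := cmod_pochS_le b r1.
rewrite -(cvg_shiftn 1); apply: (@squeeze_cvgr _ _ _ _ (cst 0) (fun N => c * d * q * (r * q) ^+ N)).
- near=> N; rewrite cmod_ge0/= addn1 (le_trans (cP _ _ (lexx _)))//.
  rewrite exprS -/q exprMn (_ : c * d * q * _ = c * (d * r ^+ N) * (q * q ^+ N)); last by ring.
  by rewrite ler_wpM2r ?mulr_ge0 ?exprn_ge0// ler_wpM2l.
- exact: cvg_cst.
- rewrite -[X in _ --> X](mulr0 (c * d * q)); apply: cvgMl_tmp.
  by apply: cvg_expr; rewrite ger0_norm.
Unshelve. all: by end_near. Qed.

End BinomialSeries.

(** * Multiple series summed over boxes *)

Section BoxSums.
Variables (R : realType) (n : nat).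
Implicit Types (t : ('I_n -> nat) -> R[i]) (b x : 'I_n -> R[i]).

(** Distributivity over a box is exact at every finite stage; it is what reduces the n-fold series
    to one-variable ones. *)
Lemma box_prod (A : comPzRingType) (f : 'I_n -> nat -> A) (N : nat) :
  \sum_(m : {ffun 'I_n -> 'I_N}) \prod_i f i (m i) = \prod_i \sum_(k < N) f i k.
Proof. by rewrite (bigA_distr_bigA (fun i (k : 'I_N) => f i k)). Qed.

Definition box_sum (u : ('I_n -> nat) -> R) (N : nat) : R :=
  \sum_(m : {ffun 'I_n -> 'I_N}) u (fun i => m i : nat).

Lemma box_sum_nondecreasing (u : ('I_n -> nat) -> R) : (forall m, 0 <= u m) ->
  nondecreasing_seq (box_sum u).
Proof.
move=> u0; apply/nondecreasing_seqP => N; rewrite /box_sum.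
(* The smaller box is embedded injectively in the larger one; the indices outside its image
   contribute nonnegative terms. *)
pose h (m : {ffun 'I_n -> 'I_N}) : {ffun 'I_n -> 'I_N.+1} :=
  [ffun i => widen_ord (leqnSn N) (m i)].
have hinj : injective h.
  move=> m1 m2 /ffunP h12; apply/ffunP => i.
  by have := h12 i; rewrite !ffunE => /(congr1 val)/= /val_inj.
rewrite (bigID (mem [set h m | m in [set: {ffun 'I_n -> 'I_N}]%SET]%SET))/=.
rewrite big_imset/=; last by move=> ? ? _ _; exact: hinj.
rewrite -[leLHS]addr0 lerD ?sumr_ge0// le_eqVlt; apply/orP; left; apply/eqP.
apply: eq_big => [m|m _]; first by rewrite inE.
by congr u; apply/funext => i; rewrite ffunE.
Qed.

Lemma box_sum_le (u : ('I_n -> nat) -> R) (g : 'I_n -> nat -> R) (G : 'I_n -> R) N :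
  (forall m, u m <= \prod_i g i (m i)) -> (forall i k, 0 <= g i k) ->
  (forall i, \sum_(k < N) g i k <= G i) -> box_sum u N <= \prod_i G i.
Proof.
move=> ug g0 gG; rewrite (@le_trans _ _ (\sum_(m : {ffun 'I_n -> 'I_N}) \prod_i g i (m i)))//.
  by apply: ler_sum => m _; exact: ug.
by rewrite box_prod; apply: ler_prod => i _; rewrite gG sumr_ge0.
Qed.

Lemma cmod_box_le t N :
  cmod (box_partial t N) <= box_sum (fun m => cmod (t m)) N.
Proof. exact: cmod_sum. Qed.

Lemma Re_box t N : Re (box_partial t N) = box_sum (fun m => Re (t m)) N.
Proof. exact: cRe_sum. Qed.

Lemma Im_box t N : Im (box_partial t N) = box_sum (fun m => Im (t m)) N.
Proof. exact: cIm_sum. Qed.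

(** Absolute convergence through monotonicity: both v and u + v are nonnegative with bounded box
    sums, and u is their difference. *)
Lemma box_sum_cvg (u v : ('I_n -> nat) -> R) (M : R) :
  (forall m, `|u m| <= v m) -> (forall N, box_sum v N <= M) -> cvgn (box_sum u).
Proof.
move=> uv vM.
have v0 m : 0 <= v m by rewrite (le_trans _ (uv m)).
have cv : cvgn (box_sum v).
  apply: nondecreasing_is_cvgn; first exact: box_sum_nondecreasing.
  by exists M => _ [N _ <-].
have cuv : cvgn (box_sum (fun m => u m + v m)).
  apply: nondecreasing_is_cvgn.
    apply: box_sum_nondecreasing => m.
    by have := uv m; rewrite ler_norml => /andP[]; lra.
  exists (M + M) => _ [N _ <-]; rewrite /box_sum big_split/=.
  apply: lerD; last exact: vM.
  apply: le_trans (vM N); apply: ler_sum => m _.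
  by rewrite (le_trans (ler_norm _)).
have e : box_sum (fun m => u m + v m) \- box_sum v = box_sum u.
  by apply/funext => N; rewrite /= /box_sum -sumrB; apply: eq_bigr => m _; ring.
by rewrite -e; exact: is_cvgB.
Qed.

Lemma climnE (u : nat -> R[i]) :
  climn u = (limn (fun N => Re (u N))) +i* (limn (fun N => Im (u N))).
Proof.
by apply: complex_ext; rewrite /climn ?(cReD, cReM, cImD, cImM)/=; ring.
Qed.

(** This turns [climn], which has a default value for divergent sequences, into an actual limit. *)
Lemma ccvg_climn t (M : R) : (forall N, box_sum (fun m => cmod (t m)) N <= M) ->
  ccvg (box_partial t) (climn (box_partial t)).
Proof.
move=> tM; rewrite /ccvg climnE; split => /=.
  have -> : (fun N => Re (box_partial t N)) = box_sum (fun m => Re (t m)).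
    by apply/funext => N; exact: Re_box.
  by apply: (box_sum_cvg _ tM) => m; exact: norm_Re_le.
have -> : (fun N => Im (box_partial t N)) = box_sum (fun m => Im (t m)).
  by apply/funext => N; exact: Im_box.
by apply: (box_sum_cvg _ tM) => m; exact: norm_Im_le.
Qed.

End BoxSums.

(** * Convergence and continuity of the confluent series *)

Section Phi2Series.
Variables (R : realType) (n : nat).
Implicit Types (b x : 'I_n -> R[i]).

(** Multinomial coefficients are at least 1; here each factor is absorbed through a binomial
    coefficient. *)
Lemma prod_fact_le (m : 'I_n -> nat) : (\prod_i (m i)`! <= (\sum_i m i)`!)%N.
Proof.
elim/big_rec2 : _ => // i s p _ h; apply: leq_trans (leq_mul (leqnn _) h) _.
by rewrite -(bin_fact (leq_addr s (m i))) addKn leq_pmull// bin_gt0 leq_addr.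
Qed.

Lemma poch_real (c : R) m : poch c%:C m = (\prod_(k < m) (c + k%:R))%:C.
Proof.
rewrite /poch rmorph_prod; apply: eq_bigr => k _.
by rewrite rmorphD rmorph_nat.
Qed.

Lemma fact_le_poch (B : R) m : 0 <= B -> m`!%:R <= cmod (poch (1 + B)%:C m).
Proof.
move=> B0; rewrite poch_real cmodr ger0_norm; last first.
  by apply: prodr_ge0 => k _; rewrite !addr_ge0.
rewrite fact_prod big_add1 big_mkord natr_prod; apply: ler_prod => k _.
by rewrite ler0n -natr1; lra.
Qed.

Lemma sum_expR_le (y : R) N : 0 <= y -> \sum_(k < N) y ^+ k / k`!%:R <= expR y.
Proof.
move=> y0; rewrite -(big_mkord xpredT (fun k => y ^+ k / k`!%:R)).
apply: (nondecreasing_cvgn_le (u_ := series (exp_coeff y))).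
  apply: nondecreasing_series => k _ _; exact: exp_coeff_ge0.
exact: is_cvg_series_exp_coeff.
Qed.

(** The denominator (1 + B)_|m| is at least |m|!, hence at least the product of the m_i!, and this
    compensates (b_i)_(m_i) up to c_i 2^(m_i). What remains is a product of exponential series in 2
    |x_i|. The explicit exponential growth later fixes the half-line on which the Laplace transform
    is taken. *)
Lemma Phi2_box_le b (B : R) : 0 <= B -> exists2 C, 0 <= C & forall x N,
  box_sum (fun m => cmod (Phi2_term b (1 + B)%:C x m)) N <=
  C * expR (2 * \sum_i cmod (x i)).
Proof.
move=> B0; have /choice[c cP] : forall i, exists c, 0 <= c /\
    forall m : nat, cmod (poch (b i) m) / m`!%:R <= c * 2 ^+ m.
  by move=> i; have [c] := @cmod_poch_fact_le R (b i) 2 (ltr1n _ 2); exists c.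
exists (\prod_i c i); first by apply: prodr_ge0 => i _; exact: (cP i).1.
move=> x N; rewrite mulr_sumr expR_sum -big_split/=.
apply: (@box_sum_le _ _ _ (fun i k => c i * ((2 * cmod (x i)) ^+ k / k`!%:R))).
- move=> m; rewrite /Phi2_term.
  have f0 : 0 < \prod_i (m i)`!%:R :> R by apply: prodr_gt0 => i _; rewrite ltr0n fact_gt0.
  have : \prod_i (m i)`!%:R <= cmod (poch (1 + B)%:C (\sum_i m i)).
    by rewrite (le_trans _ (fact_le_poch _ B0))// -natr_prod ler_nat prod_fact_le.
  move: (poch (1 + B)%:C _) => c1 h.
  rewrite !cmodM cmodV !cmod_prod.
  rewrite (@le_trans _ _ ((\prod_i cmod (poch (b i) (m i))) / (\prod_i (m i)`!%:R) *
      \prod_i cmod (x i ^+ m i / (m i)`!%:R)))//.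
    rewrite ler_wpM2r ?prodr_ge0//; first by move=> *; exact: cmod_ge0.
    rewrite ler_wpM2l ?prodr_ge0//; first by move=> *; exact: cmod_ge0.
    by rewrite lef_pV2 ?posrE// (lt_le_trans f0).
  rewrite -prodfV -!big_split/=; apply: ler_prod => i _.
  rewrite cmodM cmodV cmod_nat cmodX exprMn.
  rewrite !mulr_ge0 ?exprn_ge0 ?invr_ge0 ?cmod_ge0//=.
  rewrite -mulrA (mulrA (c i)) (mulrA (c i)) -(mulrA (c i * _)).
  rewrite mulrA ler_wpM2r ?mulr_ge0 ?exprn_ge0 ?invr_ge0 ?cmod_ge0//.
  exact: (cP i).2.
- move=> i k; rewrite !mulr_ge0 ?invr_ge0// ?exprn_ge0 ?mulr_ge0 ?cmod_ge0//.
  exact: (cP i).1.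
- move=> i; rewrite -mulr_sumr ler_wpM2l ?(cP i).1// sum_expR_le//.
  by rewrite mulr_ge0 ?cmod_ge0.
Qed.

Lemma Phi2_termZ b (c : R[i]) x (t : R) m :
  Phi2_term b c (fun i => x i * t%:C) m =
  (t ^+ (\sum_i m i))%:C * Phi2_term b c x m.
Proof.
rewrite /Phi2_term [RHS]mulrCA; congr (_ * _).
rewrite -prodrXr rmorph_prod -big_split/=; apply: eq_bigr => i _.
by rewrite exprMn rmorphXn/=; ring.
Qed.

(** The derivative factor m is at most 2^m and is hidden in the base 2 L, so a Lipschitz constant of
    the series is just a bound of the series at dilated arguments. *)
Lemma norm_subXX_le (L s t : R) m : 1 <= L -> 0 <= s <= L -> 0 <= t <= L ->
  `|t ^+ m - s ^+ m| <= (2 * L) ^+ m * `|t - s|.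
Proof.
move=> L1 /andP[s0 sL] /andP[t0 tL]; have L0 : 0 <= L by lra.
rewrite subrXX normrM mulrC ler_wpM2r//.
rewrite (le_trans (ler_norm_sum _ _ _))//.
rewrite (@le_trans _ _ (\sum_(i < m) L ^+ m))//.
  apply: ler_sum => i _; rewrite normrM !normrX !ger0_norm//.
  rewrite (@le_trans _ _ (L ^+ (m.-1 - i) * L ^+ i))//.
    by rewrite ler_pM ?exprn_ge0// lerXn2r.
  have im := ltn_ord i; have m0 : (0 < m)%N by exact: leq_ltn_trans im.
  by rewrite -exprD ler_weXn2l// subnK ?leq_pred// -ltnS prednK.
rewrite sumr_const card_ord -[leLHS]mulr_natl exprMn.
rewrite ler_wpM2r ?exprn_ge0//.
by rewrite -natrX ler_nat ltnW// ltn_expl.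
Qed.

Lemma Phi2_box_lip b x (B L : R) : 0 <= B -> 1 <= L -> exists2 K, 0 <= K &
  forall s t N, 0 <= s <= L -> 0 <= t <= L ->
  cmod (box_partial (Phi2_term b (1 + B)%:C (fun i => x i * t%:C)) N -
        box_partial (Phi2_term b (1 + B)%:C (fun i => x i * s%:C)) N) <=
  K * `|t - s|.
Proof.
move=> B0 L1; have [C C0 CP] := Phi2_box_le b B0.
exists (C * expR (2 * \sum_i cmod (x i * (2 * L)%:C))).
  by rewrite mulr_ge0 ?expR_ge0.
move=> s t N sL tL; rewrite /box_partial -sumrB (le_trans (cmod_sum _ _ _))//.
rewrite (le_trans _ (ler_wpM2r (normr_ge0 _) (CP (fun i => x i * (2 * L)%:C) N)))//.
rewrite mulr_suml; apply: ler_sum => m _; rewrite !Phi2_termZ -mulrBl.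
move: (Phi2_term _ _ _ _) => z; rewrite !cmodM [leRHS]mulrAC ler_wpM2r ?cmod_ge0// -real_complexB !cmodr.
rewrite [X in _ <= X * _]ger0_norm ?exprn_ge0//; last lra.
exact: norm_subXX_le.
Qed.

Lemma Phi2_cvg b x (B : R) : 0 <= B ->
  ccvg (box_partial (Phi2_term b (1 + B)%:C x)) (Phi2 b (1 + B)%:C x).
Proof.
move=> B0; have [C _ CP] := Phi2_box_le b B0.
by apply: ccvg_climn => N; exact: CP.
Qed.

Lemma Phi2_continuous b x (B : R) : 0 <= B -> forall t, 0 <= t -> forall e, 0 < e ->
  exists2 d : R, 0 < d & forall s, 0 <= s -> `|s - t| < d ->
    cmod (Phi2 b (1 + B)%:C (fun i => x i * s%:C) -
          Phi2 b (1 + B)%:C (fun i => x i * t%:C)) < e.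
Proof.
move=> B0 t t0 e e0; have L1 : 1 <= t + 1 by lra.
have [K K0 KP] := Phi2_box_lip b x B0 L1.
have d0 : 0 < e / (2 * (K + 1)) by rewrite divr_gt0//; lra.
(* The bound 1 keeps s in [0, t + 1], where K is a Lipschitz constant; the 2 accounts for the two
   components, and K + 1 is positive even if K = 0. *)
exists (Num.min 1 (e / (2 * (K + 1)))); first by rewrite lt_min ltr01 d0.
move=> s s0; rewrite lt_min => /andP[s1]; rewrite ltr_pdivlMr; last lra.
move=> sd.
have sL : 0 <= s <= t + 1 by move: s1; rewrite ltr_norml; lra.
have tL : 0 <= t <= t + 1 by lra.
have [Res Ims] := Phi2_cvg b (fun i => x i * s%:C) B0.
have [Ret Imt] := Phi2_cvg b (fun i => x i * t%:C) B0.
have h (u v : R^nat) (lu lv : R) : u @ \oo --> lu -> v @ \oo --> lv ->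
    (forall N, `|u N - v N| <= K * `|s - t|) -> `|lu - lv| <= K * `|s - t|.
  move=> ulu vlv uv; have cuv : `|(u - v) N| @[N --> \oo] --> `|lu - lv| by exact: cvg_norm (cvgB ulu vlv).
  by rewrite -(cvg_lim _ cuv)//; apply: limr_le; [exact: cvgP cuv|exact: nearW].
rewrite (le_lt_trans (cmod_leD _))// cReB cImB.
have hr : `|Re (Phi2 b (1 + B)%:C (fun i => x i * s%:C)) -
    Re (Phi2 b (1 + B)%:C (fun i => x i * t%:C))| <= K * `|s - t|.
  apply: h Res Ret _ => N; rewrite (le_trans _ (KP _ _ N tL sL))// -cReB.
  exact: norm_Re_le.
have hi : `|Im (Phi2 b (1 + B)%:C (fun i => x i * s%:C)) -
    Im (Phi2 b (1 + B)%:C (fun i => x i * t%:C))| <= K * `|s - t|.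
  apply: h Ims Imt _ => N; rewrite (le_trans _ (KP _ _ N tL sL))// -cImB.
  exact: norm_Im_le.
have := normr_ge0 (s - t); nra.
Qed.

End Phi2Series.

(** * Gaussian, Gamma and Craig integrals *)

Section IntegrationTools.
Local Open Scope ereal_scope.

Lemma Rintegral_dominated_cvg d (T : measurableType d) (R : realType)
    (mu : {measure set T -> \bar R}) (D : set T) (f_ : (T -> R)^nat) (f g : T -> R) :
  measurable D -> (forall n, measurable_fun D (f_ n)) ->
  (forall x, D x -> f_ ^~ x @ \oo --> f x) -> mu.-integrable D (EFin \o g) ->
  (forall n x, D x -> `|f_ n x| <= g x)%R ->
  mu.-integrable D (EFin \o f) /\
  (\int[mu]_(x in D) f_ n x)%R @[n --> \oo] --> (\int[mu]_(x in D) f x)%R.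
Proof.
move=> mD mf_ ff ig fg.
have mf : measurable_fun D f by exact: measurable_fun_cvg ff.
have [| | | |i1 _ i2] := @dominated_convergence _ _ _ mu D mD
    (fun n => EFin \o f_ n) (EFin \o f) (EFin \o g) _ _ _ ig.
- by move=> n; exact/measurable_EFinP.
- exact/measurable_EFinP.
- by apply: aeW => x Dx; apply: cvg_EFin; [exact: nearW|exact: ff].
- by apply: aeW => x n Dx; rewrite lee_fin; exact: fg.
split=> //; apply: fine_cvg; rewrite /Rintegral fineK//.
exact: integrable_fin_num.
Qed.

(** Extending f by 0 off the rectangle reduces this to the whole product, so the sign of f matters
    on the rectangle only. *)
Lemma tonelli_on d1 d2 (T1 : measurableType d1) (T2 : measurableType d2)
    (R : realType) (m1 : {sigma_finite_measure set T1 -> \bar R})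
    (m2 : {sigma_finite_measure set T2 -> \bar R}) (D1 : set T1) (D2 : set T2)
    (f : T1 * T2 -> R) :
  measurable D1 -> measurable D2 -> measurable_fun [set: T1 * T2] f ->
  (forall x y, D1 x -> D2 y -> (0 <= f (x, y))%R) ->
  \int[m1]_(x in D1) \int[m2]_(y in D2) (f (x, y))%:E =
  \int[m2]_(y in D2) \int[m1]_(x in D1) (f (x, y))%:E.
Proof.
move=> mD1 mD2 mf f0.
pose g := (EFin \o f) \_ (D1 `*` D2).
have gE x y : g (x, y) = if (x \in D1) && (y \in D2) then (f (x, y))%:E else 0.
  by rewrite /g patchE in_setX.
have mg : measurable_fun setT g.
  by apply/(measurable_restrictT _ (measurableX mD1 mD2)); apply/measurable_EFinP; exact: measurable_funTS.
have g0 z : 0 <= g z.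
  case: z => x y; rewrite gE; case: ifPn => // /andP[/set_mem Dx /set_mem Dy].
  by rewrite lee_fin f0.
have := @fubini_tonelli _ _ _ _ _ m1 m2 g mg g0.
rewrite [X in X = _ -> _](_ : _ = \int[m1]_(x in D1) \int[m2]_(y in D2) (f (x, y))%:E); last first.
  rewrite [RHS]integral_mkcond; apply: eq_integral => x _; rewrite patchE.
  case: ifPn => xD1.
    rewrite [RHS]integral_mkcond; apply: eq_integral => y _.
    by rewrite gE patchE xD1.
  by apply: integral0_eq => y _; rewrite gE (negPf xD1).
move=> ->; rewrite [RHS]integral_mkcond; apply: eq_integral => y _; rewrite patchE.
case: ifPn => yD2.
  rewrite [RHS]integral_mkcond; apply: eq_integral => x _.
  by rewrite gE patchE yD2 andbT.
by apply: integral0_eq => x _; rewrite gE (negPf yD2) andbF.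
Qed.

End IntegrationTools.

Section RealIntegrals.
Variable R : realType.
Implicit Types (b x y l s t : R).
Local Notation mu := (@lebesgue_measure R).
Local Open Scope ereal_scope.

Lemma integral_scale (G : R -> R) (c : R) : (0 < c)%R ->
  {within `[0%R, +oo[, continuous G} -> (forall x, (0 < x)%R -> (0 <= G x)%R) ->
  \int[mu]_(x in `[0%R, +oo[) (G x)%:E =
  \int[mu]_(x in `[0%R, +oo[) (G (c * x) * c)%:E.
Proof.
move=> c0 cG G0; pose F x : R := (c * x)%R.
have dF x : is_derive x 1%R F c.
  have h := is_deriveZ c (is_derive_id x 1%R).
  by apply: (@is_derive_eq _ _ _ _ _ _ _ _ h); rewrite /GRing.scale/= mulr1.
have F' : F^`() = cst c.
  by apply/funext => x; rewrite derive1E derive_val.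
have F0 : F 0%R = 0%R by rewrite /F mulr0.
have := @increasing_ge0_integration_by_substitutiony R F G 0%R.
rewrite F' F0 => ->//.
- by move=> x y _ _ xy; rewrite /F ltr_pM2l.
- by move=> x _; exact: cvg_cst.
- exact: is_cvg_cst.
- exact: is_cvg_cst.
- split; first by move=> x _; have [] := dF x.
  apply: cvg_at_right_filter; apply: differentiable_continuous.
  by apply/derivable1_diffP; have [] := dF 0%R.
- exact: gt0_cvgMry.
- by move=> x; rewrite in_itv/= andbT => x0; exact: G0.
Qed.

Lemma integral_gauss_scaled t : (0 < t)%R ->
  \int[mu]_(s in `[0%R, +oo[) (expR (- (t * s ^+ 2)))%:E =
  (Num.sqrt pi / 2 / Num.sqrt t)%:E.
Proof.
move=> t0; have st0 : (0 < Num.sqrt t)%R by rewrite sqrtr_gt0.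
have := @integral_scale (@gauss_fun R) _ st0.
rewrite integral0y_gauss => /(_ _ _)/esym h.
have -> : (Num.sqrt pi / 2 / Num.sqrt t)%:E = (Num.sqrt t)^-1%:E * (Num.sqrt pi / 2)%:E :> \bar R.
  by rewrite -EFinM mulrC.
rewrite -h.
- rewrite -ge0_integralZl//=.
  + apply: eq_integral => s _; rewrite -EFinM /gauss_fun exprMn sqr_sqrtr ?ltW//.
    by congr EFin; field; rewrite gt_eqF.
  + apply/measurable_EFinP; apply: measurable_funM => //; apply: measurable_funTS.
    apply: measurableT_comp; first exact: measurable_gauss_fun.
    exact: measurable_funM.
  + by move=> x _; rewrite lee_fin mulr_ge0 ?expR_ge0 ?ltW.
- exact/continuous_subspaceT/continuous_gauss_fun.
- by move=> x _; exact: expR_ge0.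
Qed.

(** The Gamma integral before [fine] is applied. The functional equation holds for these extended
    values, and finiteness is then deduced from it. *)
Definition eGamma x : \bar R :=
  \int[mu]_(t in `]0%R, +oo[) (t `^ (x - 1) * expR (- t))%:E.

Lemma eGamma_ge0 x : 0 <= eGamma x.
Proof. by apply: integral_ge0 => t _; rewrite lee_fin mulr_ge0 ?powR_ge0 ?expR_ge0. Qed.

Lemma measurable_powR_expR b l (D : set R) :
  measurable_fun D (fun t => (t `^ b * expR (- (l * t)))%R).
Proof.
apply: measurable_funTS; apply: measurable_funM => //.
by apply: measurableT_comp => //; apply: measurableT_comp => //; exact: measurable_funM.
Qed.

Lemma continuous_powR_expR b : (0 < b)%R ->
  {within `[0%R, +oo[, continuous (fun t => (t `^ b * expR (- t))%R)}.
Proof.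
move=> b0; apply/continuous_within_itvcyP; split.
  move=> t; rewrite in_itv/= andbT => t0; apply: cvgM; last first.
    by apply: continuous_comp; [exact: continuousN|exact: continuous_expR].
  suff : {for t, continuous (@powR R ^~ b)} by [].
  apply: differentiable_continuous; apply/derivable1_diffP.
  by apply: derivable_powR; rewrite in_itv/= andbT.
rewrite powR0 ?gt_eqF// mul0r -[X in _ --> X](mul0r (expR (- 0))).
apply: cvgM; first exact: powR_cvg0.
apply: cvg_at_right_filter.
by apply: continuous_comp; [exact: continuousN|exact: continuous_expR].
Qed.

Lemma integral_powR_expR b l : (0 < b)%R -> (0 < l)%R ->
  \int[mu]_(t in `[0%R, +oo[) (t `^ b * expR (- (l * t)))%:E =
  (l `^ (- (b + 1)))%:E * eGamma (b + 1).
Proof.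
move=> b0 l0; rewrite /eGamma addrK.
rewrite integral_itv_obnd_cbnd; last first.
  apply/measurable_EFinP; apply: measurable_funTS; apply: measurable_funM => //.
  exact: measurableT_comp.
rewrite (integral_scale l0 (continuous_powR_expR b0)); last first.
  by move=> x _; rewrite mulr_ge0 ?powR_ge0 ?expR_ge0.
rewrite -ge0_integralZl//=.
- apply: eq_integral => t; rewrite inE/= in_itv/= andbT => t0.
  rewrite -EFinM powRM ?(ltW l0)// powRN powRD; last by rewrite (gt_eqF l0) implybT.
  rewrite powRr1 ?ltW//; congr EFin; field.
  by rewrite (gt_eqF l0) gt_eqF ?powR_gt0.
- apply/measurable_EFinP; apply: measurable_funM => //.
  apply: measurable_funTS; apply: measurable_funM => /=.
    by apply: (measurableT_comp (measurable_powR b)); exact: measurable_funM.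
  by apply: measurableT_comp => //; apply: measurableT_comp => //; exact: measurable_funM.
- by move=> x _; rewrite lee_fin !mulr_ge0 ?powR_ge0 ?expR_ge0 ?ltW.
- by rewrite lee_fin powR_ge0.
Qed.

Lemma integral_expR_tail a l : (0 < l)%R ->
  \int[mu]_(t in `[a, +oo[) (expR (- (l * t)))%:E = (expR (- (l * a)) / l)%:E.
Proof.
move=> l0; pose F t := (- (expR (- (l * t)) / l))%R.
have dF t : is_derive t 1%R F (expR (- (l * t))).
  have h1 := is_deriveN (is_deriveZ l (is_derive_id t 1%R)).
  have h2 := is_derive1_comp (is_derive_expR _) h1.
  have h3 := is_deriveN (is_deriveM h2 (is_derive_cst (l^-1)%R t 1%R)).
  apply: (@is_derive_eq _ _ _ _ _ _ _ _ h3); rewrite /GRing.scale/=.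
  rewrite mulr0 add0r mulr1 mulrN mulrN opprK mulrC mulrK ?unitfE ?gt_eqF//.
have cF : continuous F.
  by move=> t; apply: differentiable_continuous; apply/derivable1_diffP; have [] := dF t.
rewrite (@ge0_continuous_FTC2y R _ F a 0%R).
- by rewrite /F sub0e -EFinN opprK.
- by move=> *; exact: expR_ge0.
- apply: continuous_subspaceT => t; apply: continuous_comp; last exact: continuous_expR.
  by apply: cvgN; apply: cvgMl_tmp; exact: cvg_id.
- rewrite /F -oppr0 -(mul0r (l^-1)%R); apply: cvgN; apply: cvgMr_tmp.
  apply: (cvg_comp (fun t => l * t)%R (fun t => expR (- t))%R); last exact: cvgr_expR.
  exact: gt0_cvgMry.
- by move=> t _; have [] := dF t.
- by apply: cvg_at_right_filter; exact: cF.
- by move=> t _; rewrite derive1E derive_val.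
Qed.

End RealIntegrals.

Section GammaAndCraig.
Variable R : realType.
Implicit Types (b x y l s t : R).
Local Notation mu := (@lebesgue_measure R).
Local Open Scope ereal_scope.

Lemma ge0_integralZl_real (D : set R) (f : R -> R) (k : R) :
  measurable D -> measurable_fun D f -> (forall x, D x -> (0 <= f x)%R) -> (0 <= k)%R ->
  \int[mu]_(x in D) (k * f x)%:E = k%:E * \int[mu]_(x in D) (f x)%:E.
Proof.
move=> mD mf f0 k0; under eq_integral do rewrite EFinM.
by rewrite ge0_integralZl//; exact/measurable_EFinP.
Qed.

Lemma measurable_expRN c (D : set R) : measurable_fun D (fun t => expR (- (c * t)))%R.
Proof.
by apply: measurable_funTS; apply: measurableT_comp => //; exact: measurableT_comp.
Qed.

Lemma measurable_expRN_sqr c (D : set R) : measurable_fun D (fun t => expR (- (c * t ^+ 2)))%R.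
Proof.
apply: measurable_funTS; apply: measurableT_comp => //; apply: measurableT_comp => //.
exact: measurable_funM.
Qed.

Lemma cvg_powRN_pinfty x : (0 < x)%R -> (t `^ (- x))%R @[t --> +oo%R] --> (0 : R)%R.
Proof.
move=> x0; have : (fun t => expR (- (x * ln t)))%R @ +oo%R --> (0 : R)%R.
  apply: (cvg_comp (fun t => x * ln t)%R (fun t => expR (- t))%R); last exact: cvgr_expR.
  apply: gt0_cvgMry => //; apply/cvgryPge => A.
  near=> t; have t0 : (0 < t)%R.
    by near: t; exact: nbhs_pinfty_gt (num_real _).
  rewrite -(expRK A) ler_ln ?posrE ?expR_gt0//.
apply: cvg_trans; apply: near_eq_cvg; near=> t.
by rewrite /powR gt_eqF ?mulNr//; near: t; exact: nbhs_pinfty_gt (num_real _).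
Unshelve. all: by end_near. Qed.

Lemma integral_powRN x : (0 < x)%R ->
  \int[mu]_(t in `[1%R, +oo[) (t `^ (- (x + 1)))%:E = (x^-1)%:E.
Proof.
move=> x0; pose F t := (- x^-1 * t `^ (- x))%R.
have dF t : (0 < t)%R -> is_derive t (1%R:R) F (t `^ (- (x + 1)))%R.
  move=> t0; have h := is_deriveZ (- x^-1)%R (is_derive1_powR (- x) t0).
  apply: (@is_derive_eq _ _ _ _ _ _ _ _ h); rewrite /GRing.scale/= mulrA mulrNN mulVf ?gt_eqF// mul1r.
  by congr (_ `^ _)%R; ring.
rewrite (@ge0_continuous_FTC2y R _ F 1%R 0%R).
- by rewrite sub0e -EFinN /F powR1 mulr1 opprK.
- by move=> *; exact: powR_ge0.
- apply: derivable_within_continuous => t; rewrite in_itv/= andbT => t1.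
  by apply: derivable_powR; rewrite in_itv/= andbT (lt_le_trans _ t1).
- by rewrite /F -[X in _ --> X](mulr0 (- x^-1)%R); apply: cvgMl_tmp; exact: cvg_powRN_pinfty.
- by move=> t t1; have [] := dF t (lt_trans ltr01 t1).
- apply: cvg_at_right_filter; apply: differentiable_continuous; apply/derivable1_diffP.
  by have [] := dF 1%R ltr01.
- move=> t; rewrite in_itv/= andbT => t1.
  by rewrite derive1E; have [_ ->] := dF t (lt_trans ltr01 t1).
Qed.

(** Tonelli for t^x exp(-t s) on t > 0, s >= 1, instead of an integration by parts. Integrating in s
    first gives t^(x-1) exp(-t); integrating in t first gives s^(-(x+1)) Gamma(x + 1), and the
    integral of s^(-(x+1)) over s >= 1 is 1 / x. *)
Lemma eGammaS x : (0 < x)%R -> eGamma (x + 1) = x%:E * eGamma x.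
Proof.
move=> x0.
pose f (z : R * R) := (z.1 `^ x * expR (- (z.1 * z.2)))%R.
have mf : measurable_fun setT f.
  apply: measurable_funM; first exact: (measurableT_comp (measurable_powR x)).
  apply: measurableT_comp => //; apply: measurableT_comp => //.
  exact: measurable_funM.
have f0 t s : `]0%R, +oo[%classic t -> `[1%R, +oo[%classic s -> (0 <= f (t, s))%R.
  by move=> _ _; rewrite mulr_ge0 ?powR_ge0 ?expR_ge0.
have := @tonelli_on _ _ _ _ R mu mu _ _ f (measurable_itv _) (measurable_itv _) mf f0.
rewrite [X in X = _ -> _](_ : _ = eGamma x); last first.
  apply: eq_integral => t; rewrite inE/= in_itv/= andbT => t0.
  rewrite /f/= ge0_integralZl_real ?powR_ge0//; last exact: measurable_expRN.
  rewrite integral_expR_tail// mulr1 -EFinM powRB; last by rewrite (gt_eqF t0) implybT.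
  by rewrite powRr1 ?ltW//; congr EFin; ring.
rewrite [X in _ = X -> _](_ : _ = x^-1%:E * eGamma (x + 1)).
  move=> ->; rewrite muleA -EFinM mulfV ?mul1e// gt_eqF//.
rewrite -integral_powRN// -ge0_integralZr//=.
- apply: eq_integral => l; rewrite inE/= in_itv/= andbT => l1.
  have l0 : (0 < l)%R by exact: lt_le_trans l1.
  rewrite -integral_powR_expR// integral_itv_obnd_cbnd.
    by apply: eq_integral => t _; rewrite /f/= (mulrC t).
  apply/measurable_EFinP; apply: measurable_funTS.
  exact: (measurableT_comp mf (pair2_measurable l)).
- by apply/measurable_EFinP; apply: measurable_funTS; exact: measurable_powR.
- by move=> t _; rewrite lee_fin powR_ge0.
- exact: eGamma_ge0.
Qed.

Lemma powR_expR_le b : (0 < b)%R -> exists C : R, forall t, (0 < t)%R ->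
  (t `^ b * expR (- t) <= C * expR (- (2^-1 * t)))%R.
Proof.
(* The constant comes from ln y <= y at y = t / (2 b): multiplied by b, it costs only half of the
   exponent t. *)
move=> b0; exists (expR (b * ln (2 * b)))%R => t t0.
rewrite /powR (gt_eqF t0) -!expRD ler_expR.
have b2 : (0 < 2 * b)%R by rewrite mulr_gt0.
have h : (ln (t / (2 * b)) <= t / (2 * b))%R by rewrite ltW// ln_sublinear// divr_gt0.
rewrite ln_div ?posrE// in h.
have {}h : (ln t <= ln (2 * b) + t / (2 * b))%R by lra.
have := ler_wpM2l (ltW b0) h; rewrite mulrDr.
have -> : (b * (t / (2 * b)) = t / 2)%R by field; rewrite gt_eqF.
lra.
Qed.

(** At arguments above 1 the integrand is dominated by a decaying exponential. The singularity at 0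
    for small x is never estimated: the functional equation carries finiteness down from x + 1. *)
Lemma eGamma_lty x : (0 < x)%R -> eGamma x < +oo.
Proof.
move=> x0.
have h b : (0 < b)%R -> eGamma (b + 1) < +oo.
  move=> b0; have [C CP] := powR_expR_le b0.
  have C0 : (0 <= C)%R.
    have := CP 1%R ltr01; rewrite powR1 mul1r => /(le_trans (expR_ge0 _)).
    by rewrite pmulr_lge0// expR_gt0.
  rewrite /eGamma addrK; apply: (@le_lt_trans _ _
     (\int[mu]_(t in `]0%R, +oo[) (C * expR (- (2^-1 * t)))%:E)).
    apply: ge0_le_integral => //=.
    - by move=> t _; rewrite lee_fin mulr_ge0 ?powR_ge0 ?expR_ge0.
    - apply/measurable_EFinP; apply: measurable_funTS; apply: measurable_funM => //.
      exact: measurableT_comp.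
    - apply/measurable_EFinP; apply: measurable_funTS; apply: measurable_funM => //.
      exact: measurable_expRN.
    - by move=> t; rewrite in_itv/= andbT lee_fin; exact: CP.
  have mh : measurable_fun (`]0%R, +oo[%classic : set R) (fun t => (expR (- (2^-1 * t)))%:E).
    by apply/measurable_EFinP; exact: measurable_expRN.
  rewrite ge0_integralZl_real//; last exact: measurable_expRN.
  rewrite (integral_itv_obnd_cbnd mh) integral_expR_tail// -EFinM ltry//.
have := h x x0; rewrite eGammaS//.
have := eGamma_ge0 x; case: (eGamma x) => //= [r _ _|_]; first by rewrite ltry.
by rewrite gt0_muley ?lte_fin.
Qed.

Lemma eGamma_gt0 x : (0 < x)%R -> 0 < eGamma x.
Proof.
move=> x0.
suff : 0 < eGamma (x + 1) by rewrite eGammaS// pmule_rgt0// lte_fin.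
(* On [1, 2] one has t^x >= 1 and exp(-t) >= exp(-2), which already gives positive mass. *)
apply: (@lt_le_trans _ _ (\int[mu]_(t in `[1%R, 2%R]) (expR (- 2))%:E)).
  rewrite integral_cst//= lebesgue_measure_itv/= lte_fin ltr1n/= -EFinD -EFinM lte_fin.
  by rewrite mulr_gt0 ?expR_gt0//; lra.
have mh : measurable_fun (`]0%R, +oo[%classic : set R) (fun t => (t `^ x * expR (- t))%:E).
  apply/measurable_EFinP; apply: measurable_funTS; apply: measurable_funM => //.
  exact: measurableT_comp.
have s12 : (`[1%R, 2%R]%classic : set R) `<=` `]0%R, +oo[%classic.
  by move=> t /=; rewrite !in_itv/= andbT => /andP[t1 _]; exact: lt_le_trans t1.
rewrite /eGamma addrK.
apply: (@le_trans _ _ (\int[mu]_(t in `[1%R, 2%R]) (t `^ x * expR (- t))%:E)).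
  apply: ge0_le_integral => //=.
  - by apply: measurable_funS mh.
  - move=> t; rewrite in_itv/= => /andP[t1 t2]; rewrite lee_fin -[leLHS]mul1r ler_pM ?expR_ge0//.
      have := @ge0_ler_powR R x (ltW x0) 1%R t; rewrite powR1 !nnegrE ler01.
      by apply=> //; exact: le_trans t1.
    by rewrite ler_expR lerN2.
apply: ge0_subset_integral => //= t _.
by rewrite lee_fin mulr_ge0 ?powR_ge0 ?expR_ge0.
Qed.

Lemma eGammaE x : (0 < x)%R -> eGamma x = (Gamma x)%:E.
Proof.
move=> x0; rewrite /Gamma -/(eGamma x) fineK//.
by rewrite ge0_fin_numE ?eGamma_ge0 ?eGamma_lty.
Qed.

Lemma GammaS x : (0 < x)%R -> (Gamma (x + 1) = x * Gamma x)%R.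
Proof.
move=> x0; apply: EFin_inj; rewrite EFinM -!eGammaE ?eGammaS//.
by rewrite addr_gt0.
Qed.

Lemma Gamma_gt0 x : (0 < x)%R -> (0 < Gamma x)%R.
Proof. by move=> x0; rewrite -lte_fin -eGammaE ?eGamma_gt0. Qed.

Lemma oneDsqr_gt0' s : (0 < 1 + s ^+ 2)%R.
Proof. by rewrite ltr_pwDl ?ltr01 ?sqr_ge0. Qed.

Lemma measurable_oneDsqr_powR b (D : set R) :
  measurable_fun D (fun s => ((1 + s ^+ 2) `^ b)%R).
Proof.
apply: measurable_funTS; apply: (measurableT_comp (measurable_powR b)).
exact: measurable_funD.
Qed.

(** A Beta integral obtained by Tonelli from t^b exp(-(1 + s^2) t). In t it is a Gamma integral with
    rate 1 + s^2; in s it is Gaussian and leaves sqrt(pi) / 2 times t^(b - 1/2) exp(-t), which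
    integrates to Gamma(b + 1/2). *)
Lemma integral_oneDsqr_powR b : (0 < b)%R ->
  \int[mu]_(s in `[0%R, +oo[) ((1 + s ^+ 2) `^ (- (b + 1)))%:E =
  (Num.sqrt pi / 2 * Gamma (b + 2^-1) / Gamma (b + 1))%:E.
Proof.
move=> b0.
pose f (z : R * R) := (z.2 `^ b * expR (- ((1 + z.1 ^+ 2) * z.2)))%R.
have mf : measurable_fun setT f.
  apply: measurable_funM; first exact: (measurableT_comp (measurable_powR b)).
  apply: measurableT_comp => //; apply: measurableT_comp => //.
  apply: measurable_funM => //; apply: measurable_funD => //.
  exact: measurable_funX.
have f0 s t : `[0%R, +oo[%classic s -> `]0%R, +oo[%classic t -> (0 <= f (s, t))%R.
  by move=> _ _; rewrite mulr_ge0 ?powR_ge0 ?expR_ge0.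
have := @tonelli_on _ _ _ _ R mu mu _ _ f (measurable_itv _) (measurable_itv _) mf f0.
have b10 : (0 < b + 1)%R by rewrite addr_gt0.
have b20 : (0 < b + 2^-1)%R by rewrite addr_gt0.
rewrite [X in X = _ -> _](_ : _ = (\int[mu]_(s in `[0%R, +oo[) ((1 + s ^+ 2) `^ (- (b + 1)))%:E) * eGamma (b + 1)); last first.
  rewrite -ge0_integralZr//=.
  - apply: eq_integral => s _; rewrite -integral_powR_expR ?oneDsqr_gt0'//.
    rewrite -integral_itv_obnd_cbnd//.
    by apply/measurable_EFinP; exact: measurable_powR_expR.
  - by apply/measurable_EFinP; exact: measurable_oneDsqr_powR.
  - by move=> s _; rewrite lee_fin powR_ge0.
  - exact: eGamma_ge0.
rewrite [X in _ = X -> _](_ : _ = (Num.sqrt pi / 2)%:E * eGamma (b + 2^-1)); last first.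
  rewrite -ge0_integralZl_real ?divr_ge0 ?sqrtr_ge0//; last 2 first.
  - apply: measurable_funTS; apply: measurable_funM => //.
    exact: measurableT_comp.
  - by move=> t _; rewrite mulr_ge0 ?powR_ge0 ?expR_ge0.
  apply: eq_integral => t; rewrite inE/= in_itv/= andbT => t0.
  transitivity (\int[mu]_(s in `[0%R, +oo[) (t `^ b * expR (- t) * expR (- (t * s ^+ 2)))%:E).
    apply: eq_integral => s _; rewrite /f/= -mulrA -expRD; congr (_ * expR _)%:E.
    ring.
  rewrite ge0_integralZl_real ?mulr_ge0 ?powR_ge0 ?expR_ge0//; last exact: measurable_expRN_sqr.
  rewrite integral_gauss_scaled// -!EFinM.
  have -> : (b + 2^-1 - 1 = b - 2^-1)%R by field.
  rewrite powRB; last by rewrite (gt_eqF t0) implybT.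
  by rewrite powR12_sqrt ?ltW//; congr EFin; field; rewrite gt_eqF// sqrtr_gt0.
rewrite !eGammaE//; set I := integral _ _ _ => h.
have G0 := Gamma_gt0 b10.
have -> : I = I * (Gamma (b + 1))%:E * (Gamma (b + 1))^-1%:E.
  by rewrite -muleA -EFinM divff ?mule1// gt_eqF.
by rewrite h -!EFinM.
Qed.

Lemma integral_gauss_tail x : (0 <= x)%R ->
  \int[mu]_(t in `[x, +oo[) (expR (- (t ^+ 2) / 2))%:E \is a fin_num.
Proof.
move=> x0; rewrite ge0_fin_numE; last by apply: integral_ge0 => t _; rewrite lee_fin expR_ge0.
have h2 : (0 < 2^-1 :> R)%R by [].
apply: (@le_lt_trans _ _ (\int[mu]_(t in `[0%R, +oo[) (expR (- (2^-1 * t ^+ 2)))%:E)); last first.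
  by rewrite integral_gauss_scaled// ltry.
under [leLHS]eq_integral do rewrite mulrC mulrN.
apply: ge0_subset_integral => //=.
- by apply/measurable_EFinP; exact: measurable_expRN_sqr.
- by move=> t /=; rewrite !in_itv/= !andbT; exact: le_trans.
Qed.

Lemma integral_id_gauss x c : (0 <= x)%R -> (0 < c)%R ->
  \int[mu]_(t in `[x, +oo[) (t * expR (- (c * t ^+ 2)))%:E =
  (expR (- (c * x ^+ 2)) / (2 * c))%:E.
Proof.
move=> x0 c0; pose F t := (- (expR (- (c * t ^+ 2)) / (2 * c)))%R.
have dF t : is_derive t 1%R F (t * expR (- (c * t ^+ 2)))%R.
  have h1 := is_deriveN (is_deriveZ c (is_deriveX 2 (is_derive_id t 1%R))).
  have h2 := is_derive1_comp (is_derive_expR _) h1.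
  have h3 := is_deriveN (is_deriveM h2 (is_derive_cst ((2 * c)^-1)%R t 1%R)).
  apply: (@is_derive_eq _ _ _ _ _ _ _ _ h3); rewrite /GRing.scale/=.
  rewrite fctE/=; field; rewrite gt_eqF//.
have cf : continuous (fun t => expR (- (c * t ^+ 2)))%R.
  move=> t; apply: continuous_comp; last exact: continuous_expR.
  by apply: cvgN; apply: cvgMl_tmp; exact: exprn_continuous.
rewrite (@ge0_continuous_FTC2y R _ F x 0%R).
- by rewrite /F sub0e -EFinN opprK.
- by move=> t xt; rewrite mulr_ge0 ?expR_ge0// (le_trans x0).
- by apply: continuous_subspaceT => t; apply: cvgM; [exact: cvg_id|exact: cf].
- rewrite /F -oppr0 -(mul0r ((2 * c)^-1)%R); apply: cvgN; apply: cvgMr_tmp.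
  apply: (cvg_comp (fun t => c * t ^+ 2)%R (fun t => expR (- t))%R); last exact: cvgr_expR.
  by apply: gt0_cvgMry => //; exact: cvgr_expr2.
- by move=> t _; have [] := dF t.
- apply: cvg_at_right_filter; apply: differentiable_continuous; apply/derivable1_diffP.
  by have [] := dF x.
- by move=> t _; rewrite derive1E derive_val.
Qed.

(** Craig's formula after the substitution s = cot theta. Tonelli is applied to t exp(-(1 + s^2) t^2
    / 2) on s >= 0, t > x: the t-integral has an elementary antiderivative, and in the Gaussian
    s-integral the factor t cancels, leaving the tail of exp(-t^2 / 2). *)
Lemma Qfun_craig x : (0 <= x)%R ->
  \int[mu]_(s in `[0%R, +oo[) ((1 + s ^+ 2) `^ (- 1) * expR (- ((1 + s ^+ 2) / 2 * x ^+ 2)))%:E =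
  (pi * Qfun x)%:E.
Proof.
move=> x0.
pose f (z : R * R) := (z.2 * expR (- ((1 + z.1 ^+ 2) / 2 * z.2 ^+ 2)))%R.
have mf : measurable_fun setT f.
  apply: measurable_funM => //.
  apply: measurableT_comp => //; apply: measurableT_comp => //.
  apply: measurable_funM => //; last exact: measurable_funX.
  apply: measurable_funM => //; apply: measurable_funD => //.
  exact: measurable_funX.
have f0 s t : `[0%R, +oo[%classic s -> `]x, +oo[%classic t -> (0 <= f (s, t))%R.
  move=> _; rewrite /= in_itv/= andbT => xt; rewrite mulr_ge0 ?expR_ge0//=.
  by rewrite (le_trans x0)// ltW.
have := @tonelli_on _ _ _ _ R mu mu _ _ f (measurable_itv _) (measurable_itv _) mf f0.
rewrite [X in X = _ -> _](_ : _ = \int[mu]_(s in `[0%R, +oo[) ((1 + s ^+ 2) `^ (- 1) * expR (- ((1 + s ^+ 2) / 2 * x ^+ 2)))%:E); last first.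
  apply: eq_integral => s _; have s0 := oneDsqr_gt0' s.
  rewrite integral_itv_obnd_cbnd; last first.
    by apply/measurable_EFinP; apply: measurable_funTS; apply: (measurableT_comp mf); exact: pair1_measurable.
  rewrite /f/= integral_id_gauss ?divr_gt0// powR_inv1 ?ltW//; congr EFin; field.
  by rewrite gt_eqF.
move=> ->; rewrite /Qfun.
have mg : measurable_fun (`]x, +oo[%classic : set R) (fun t => (expR (- (t ^+ 2) / 2))%:E).
  apply/measurable_EFinP; apply: measurable_funTS; apply: measurableT_comp => //.
  by apply: measurable_funM => //; exact: measurableT_comp.
transitivity (\int[mu]_(t in `]x, +oo[) (Num.sqrt pi / Num.sqrt 2 * expR (- (t ^+ 2) / 2))%:E).
  apply: eq_integral => t; rewrite inE/= in_itv/= andbT => xt.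
  have t0 : (0 < t)%R by exact: le_lt_trans xt.
  transitivity (\int[mu]_(s in `[0%R, +oo[) (t * expR (- t ^+ 2 / 2) * expR (- (t ^+ 2 / 2 * s ^+ 2)))%:E).
    apply: eq_integral => s _; rewrite /f/= -[(t * _ * _)%R]mulrA -expRD; congr (_ * expR _)%:E.
    by field.
  rewrite ge0_integralZl_real ?mulr_ge0 ?expR_ge0 ?(ltW t0)//; last exact: measurable_expRN_sqr.
  rewrite integral_gauss_scaled ?divr_gt0 ?exprn_gt0// -!EFinM.
  have s20 : (0 < Num.sqrt 2 :> R)%R by rewrite sqrtr_gt0.
  rewrite sqrtrM ?sqr_ge0// sqrtr_sqr gtr0_norm// sqrtrV//.
  have e2 : (2 = Num.sqrt 2 ^+ 2 :> R)%R by rewrite sqr_sqrtr.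
  congr EFin; rewrite [X in (_ * (_ / X / _))%R]e2; field.
  by rewrite !gt_eqF.
rewrite ge0_integralZl_real ?divr_ge0 ?sqrtr_ge0//; last exact/measurable_EFinP.
rewrite integral_itv_obnd_cbnd// -[X in _ * X]fineK ?integral_gauss_tail// -EFinM.
have sp : (0 < Num.sqrt pi :> R)%R by rewrite sqrtr_gt0 pi_gt0.
have s2 : (0 < Num.sqrt 2 :> R)%R by rewrite sqrtr_gt0.
congr EFin; rewrite mulrA; congr (_ * _)%R.
rewrite sqrtrM// -[X in (_ = X / _)%R](sqr_sqrtr (pi_ge0 R)); field.
by rewrite !gt_eqF.
Qed.

(** The cdf is the mean of the indicator of X <= x; exchanging the integrals leaves the exponential
    tail exp(-l X) / l. *)
Lemma integral_expR_cdf d (T : measurableType d) (P : probability T R)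
    (X : {RV P >-> R}) l : (0 < l)%R -> (forall w, (0 <= X w)%R) ->
  \int[mu]_(x in `[0%R, +oo[) ((expR (- (l * x)))%:E * cdf X x) =
  l^-1%:E * 'M_P X (- l).
Proof.
move=> l0 X0.
pose f (z : R * T) := (if X z.2 <= z.1 then expR (- (l * z.1)) else 0)%R.
have mf : measurable_fun setT f.
  apply: measurable_fun_ifT => //; last first.
    apply: measurableT_comp => //; apply: measurableT_comp => //.
    exact: measurable_funM.
  apply: measurable_fun_ler => //; exact: measurableT_comp.
have f0 x w : `[0%R, +oo[%classic x -> [set: T] w -> (0 <= f (x, w))%R.
  by move=> _ _; rewrite /f; case: ifP => // _; exact: expR_ge0.
have := @tonelli_on _ _ _ _ R mu P _ _ f (measurable_itv _) measurableT mf f0.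
rewrite [X in X = _ -> _](_ : _ = \int[mu]_(x in `[0%R, +oo[) ((expR (- (l * x)))%:E * cdf X x)); last first.
  apply: eq_integral => x _; rewrite /cdf /distribution/= /pushforward.
  have mA : measurable (X @^-1` `]-oo, x]) by exact: measurable_funPTI.
  transitivity (\int[P]_w ((expR (- (l * x)))%:E * (\1_(X @^-1` `]-oo, x]) w)%:E)).
    apply: eq_integral => w _; rewrite /f/= indicE -EFinM.
    have -> : (w \in X @^-1` `]-oo, x]) = (X w <= x)%R.
      by apply/idP/idP; rewrite inE/= in_itv.
    by case: ifP; rewrite ?mulr1 ?mulr0.
  rewrite ge0_integralZl//=; last exact/measurable_EFinP/measurable_indic.
  by rewrite integral_indic// setIT.
move=> ->; rewrite /mmt_gen_fun unlock -ge0_integralZl//=.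
- apply: eq_integral => w _; rewrite -EFinM.
  transitivity (\int[mu]_(x in `[X w, +oo[) (expR (- (l * x)))%:E).
    rewrite integral_mkcond [RHS]integral_mkcond; apply: eq_integral => x _.
    rewrite !patchE /f/= !mem_setE !in_itv/= !andbT; case: ifPn => [x0|].
      by case: ifP.
    by rewrite -ltNge => x0; rewrite leNgt (lt_le_trans x0).
  by rewrite integral_expR_tail//; congr EFin; rewrite /= mulrC; congr (_ * expR _)%R; ring.
- apply/measurable_EFinP; apply: measurableT_comp => //; exact: measurable_funM.
- by rewrite lee_fin invr_ge0 ltW.
Qed.
End GammaAndCraig.

(** * Uniqueness of Laplace transforms *)

Section RealIntegrability.
Context d (T : measurableType d) (R : realType) (m : {measure set T -> \bar R}).
Variables (A : set T) (mA : measurable A).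
Implicit Types (f g : T -> R).

Lemma integrableZl_real f (k : R) : m.-integrable A (EFin \o f) ->
  m.-integrable A (EFin \o (fun x => k * f x)).
Proof. by move=> fi; have := integrableZl mA k fi; apply: eq_integrable. Qed.

Lemma integrableD_real f g : m.-integrable A (EFin \o f) ->
  m.-integrable A (EFin \o g) -> m.-integrable A (EFin \o (fun x => f x + g x)).
Proof. by move=> fi gi; have := integrableD mA fi gi; apply: eq_integrable. Qed.

Lemma integrableB_real f g : m.-integrable A (EFin \o f) ->
  m.-integrable A (EFin \o g) -> m.-integrable A (EFin \o (fun x => f x - g x)).
Proof. by move=> fi gi; have := integrableB mA fi gi; apply: eq_integrable. Qed.

Lemma measurable_integrable f : m.-integrable A (EFin \o f) -> measurable_fun A f.
Proof. by move=> fi; apply/measurable_EFinP; exact: measurable_int fi. Qed.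

Lemma integrable_mul_bounded f (h : T -> R) (M : R) :
  m.-integrable A (EFin \o f) -> measurable_fun A h ->
  (forall x, A x -> `|h x| <= M) -> m.-integrable A (EFin \o (fun x => f x * h x)).
Proof.
move=> fi mh hM; have mf := measurable_integrable fi.
apply: (le_integrable mA _ _ (integrableZl_real M fi)).
- by apply/measurable_EFinP; exact: measurable_funM.
- move=> x Ax; rewrite /= lee_fin !normrM mulrC ler_wpM2r//.
  by rewrite (le_trans (hM _ Ax))// ler_norm.
Qed.

Lemma Rintegral_sum (I : Type) (s : seq I) (f : I -> T -> R) :
  (forall i, m.-integrable A (EFin \o f i)) ->
  m.-integrable A (EFin \o (fun x => \sum_(i <- s) f i x)) /\
  \int[m]_(x in A) (\sum_(i <- s) f i x) = \sum_(i <- s) \int[m]_(x in A) f i x.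
Proof.
move=> fi; elim: s => [|i s [IH1 IH2]].
  rewrite big_nil (_ : (fun x => _) = cst 0); last by apply/funext => x; rewrite big_nil.
  by split; [exact: integrable0|rewrite /Rintegral integral0].
rewrite big_cons (_ : (fun x => \sum_(j <- i :: s) f j x) =
    (fun x => f i x + \sum_(j <- s) f j x)); last by apply/funext => x; rewrite big_cons.
by split; [exact: integrableD_real|rewrite RintegralD// IH2].
Qed.

End RealIntegrability.

Section LaplaceUniqueness.
Variable R : realType.
Implicit Types (q : R -> R) (x l : R).
Local Notation mu := (@lebesgue_measure R).
Let D : set R := `[0%R, +oo[%classic.
Let mD : measurable D. Proof. exact: measurable_itv. Qed.

Lemma Rintegral_kernel_sum q (c : nat -> R) (k : nat -> nat) (M : nat) :
  mu.-integrable D (EFin \o q) ->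
  (forall k : nat, \int[mu]_(x in D) (q x * expR (- (k%:R * x))) = 0) ->
  \int[mu]_(x in D) (q x * \sum_(j < M) c j * expR (- ((k j)%:R * x))) = 0.
Proof.
move=> qi q0; have bnd j x : D x -> `|expR (- (j%:R * x))| <= 1.
  rewrite /D/= in_itv/= andbT => x0; rewrite ger0_norm ?expR_ge0//.
  by rewrite expR_le1 oppr_le0 mulr_ge0.
have qji j : mu.-integrable D (EFin \o (fun x => q x * expR (- (j%:R * x)))).
  apply: (@integrable_mul_bounded _ _ R mu D mD _ _ 1 qi); last exact: bnd.
  exact: measurable_expRN.
have e x : q x * (\sum_(j < M) c j * expR (- ((k j)%:R * x))) =
    \sum_(j < M) c j * (q x * expR (- ((k j)%:R * x))).
  by rewrite mulr_sumr; apply: eq_bigr => j _; ring.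
under eq_Rintegral do rewrite e.
have ci (j : 'I_M) : mu.-integrable D (EFin \o (fun x => c j * (q x * expR (- ((k j)%:R * x))))).
  exact: integrableZl_real.
have [_ ->] := @Rintegral_sum _ _ R mu D mD _ (index_enum 'I_M) _ ci.
by rewrite big1// => j _; rewrite RintegralZl// q0 mulr0.
Qed.

(** The pointwise limit of exp(-e^(N(x0-x))): the exponent is constantly -1 at x0, whence the value
    exp(-1) there. *)
Definition step_fun (x0 x : R) : R :=
  if x < x0 then 0 else if x == x0 then expR (- 1) else 1.

(* The kernels exp(-e^(N(x0-x))) are limits of polynomials in e^-x and tend to a step at x0 as N grows. *)
Lemma step_integral0 q x0 : mu.-integrable D (EFin \o q) ->
  (forall k : nat, \int[mu]_(x in D) (q x * expR (- (k%:R * x))) = 0) ->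
  mu.-integrable D (EFin \o (fun x => q x * step_fun x0 x)) /\
  \int[mu]_(x in D) (q x * step_fun x0 x) = 0.
Proof.
move=> qi q0.
have mq : measurable_fun D q by apply/measurable_EFinP; exact: measurable_int qi.
have qi' : mu.-integrable D (EFin \o (fun x => `|q x|)) by exact: integrable_norm.
pose y (N : nat) x := expR (N%:R * (x0 - x)).
have K0 N : \int[mu]_(x in D) (q x * expR (- y N x)) = 0.
  (* The exponential series in -e^(N(x0-x)), truncated, is a polynomial in exp(-N x) and thus has
     integral 0 against q. All truncations are bounded on the half-line by exp(e^(N x0)), so the
     limit in M may be taken. *)
  pose s M x := \sum_(j < M) ((- expR (N%:R * x0)) ^+ j / j`!%:R) * expR (- ((N * j)%:R * x)).
  have sE M x : s M x = series (exp_coeff (- y N x)) M.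
    rewrite /s /series/= big_mkord; apply: eq_bigr => j _.
    have -> : - y N x = - expR (N%:R * x0) * expR (- (N%:R * x)).
      by rewrite /y mulrBr expRD mulNr.
    rewrite /exp_coeff/= exprMn -[expR (- (N%:R * x)) ^+ j]expRM_natl [RHS]mulrAC.
    by congr (_ * expR _); rewrite natrM; ring.
  have yB x : D x -> 0 <= y N x <= expR (N%:R * x0).
    rewrite /D/= in_itv/= andbT => xx; rewrite expR_ge0/= ler_expR ler_wpM2l//; lra.
  have := @Rintegral_dominated_cvg _ _ R mu D (fun M x => q x * s M x)
    (fun x => q x * expR (- y N x)) (fun x => `|q x| * expR (expR (N%:R * x0))) mD.
  case.
  - move=> M; apply: measurable_funM => //; apply: measurable_sum => j.
    by apply: measurable_funM => //; exact: measurable_expRN.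
  - move=> x Dx; apply: cvgMl_tmp.
    under [X in X @ _]funext do rewrite sE.
    exact: is_cvg_series_exp_coeff.
  - apply: (@integrable_mul_bounded _ _ R mu D mD _ _ (expR (expR (N%:R * x0))) qi') => // x _.
    by rewrite ger0_norm ?expR_ge0.
  - move=> M x Dx; rewrite normrM ler_wpM2l// sE.
    have /andP[y0 yM] := yB x Dx.
    apply: (@le_trans _ _ (expR (y N x))); last by rewrite ler_expR.
    rewrite (le_trans _ (sum_expR_le M y0))// /series/= big_mkord.
    rewrite (le_trans (ler_norm_sum _ _ _))//; apply: ler_sum => j _.
    by rewrite /exp_coeff/= normrM normrX normrN (ger0_norm y0) ger0_norm// invr_ge0.
  move=> _ h.
  have s0 M : \int[mu]_(x in D) (q x * s M x) = 0.
    exact: (Rintegral_kernel_sum (fun j => (- expR (N%:R * x0)) ^+ j / j`!%:R)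
      (fun j => N * j)%N M qi q0).
  rewrite -(cvg_lim (@Rhausdorff R) h); under eq_fun do rewrite s0.
  exact: lim_cst.
have [|||i l] := @Rintegral_dominated_cvg _ _ R mu D (fun N x => q x * expR (- y N x))
    (fun x => q x * step_fun x0 x) (fun x => `|q x|) mD _ _ qi'.
- move=> N; apply: measurable_funM => //; apply: measurable_funTS.
  apply: measurableT_comp => //; apply: measurableT_comp => //.
  apply: measurableT_comp => //; apply: measurable_funM => //.
  exact: measurable_funB.
- move=> x _; apply: cvgMl_tmp; rewrite /step_fun /y.
  have [xx0|xx0] := ltP x x0.
    apply: (cvg_comp (fun N : nat => expR (N%:R * (x0 - x))) (fun t => expR (- t))); last exact: cvgr_expR.
    apply/cvgryPge => A; near=> N.
    rewrite (le_trans _ (expR_ge1Dx _))//.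
    have xx1 : 0 < x0 - x by rewrite subr_gt0.
    have : A / (x0 - x) <= N%:R.
      by near: N; exact: nbhs_infty_ger.
    by rewrite ler_pdivrMr//; lra.
  have [->|xx1] := eqVneq x x0.
    by under eq_fun do rewrite subrr mulr0 expR0; exact: cvg_cst.
  rewrite -[X in _ --> X]expR0 -oppr0.
  apply: (cvg_comp (fun N : nat => - expR (N%:R * (x0 - x))) expR); last exact: continuous_expR.
  apply: cvgN.
  have xx2 : 0 < x - x0 by rewrite subr_gt0 lt_neqAle eq_sym xx1.
  have -> : (fun N : nat => expR (N%:R * (x0 - x))) =
      (fun t => expR (- t)) \o (fun N : nat => N%:R * (x - x0)).
    by apply/funext => N /=; rewrite -mulrN opprB.
  apply: cvg_comp; last exact: cvgr_expR.
  apply/cvgryPge => A; near=> N.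
  rewrite -ler_pdivrMr//.
  by near: N; exact: nbhs_infty_ger.
- move=> N x _; rewrite normrM ler_piMr// ger0_norm ?expR_ge0//.
  by rewrite expR_le1 oppr_le0 expR_ge0.
split=> //; rewrite -(cvg_lim (@Rhausdorff R) l); under eq_fun do rewrite K0.
exact: lim_cst.
Unshelve. all: by end_near. Qed.

(** If q x0 were positive, right continuity would keep q above q x0 / 2 on some [x0, x1]. The
    difference of the steps at x0 and x1 is nonnegative, vanishes off this interval and equals 1
    inside, so its integral against q would be positive, yet it is a difference of two zeros. *)
Lemma laplace_eq0 q x0 : mu.-integrable D (EFin \o q) ->
  (forall k : nat, \int[mu]_(x in D) (q x * expR (- (k%:R * x))) = 0) ->
  0 <= x0 ->
  (forall e, 0 < e -> exists2 d, 0 < d & forall x, x0 <= x < x0 + d -> `|q x - q x0| < e) ->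
  q x0 <= 0.
Proof.
move=> qi q0 x00 qc; rewrite leNgt; apply/negP => qx0.
have [d d0 dP] := qc (q x0 / 2) (divr_gt0 qx0 (ltr0n _ 2)).
pose x1 := x0 + d / 2.
have [i0 e0] := step_integral0 x0 qi q0.
have [i1 e1] := step_integral0 x1 qi q0.
pose h x := q x * step_fun x0 x - q x * step_fun x1 x.
have qpos x : x0 <= x <= x1 -> q x0 / 2 <= q x.
  move=> xx; have := dP x; rewrite /x1 in xx; move=> /(_ _)/ltr_normlP[]; lra.
have x01 : x0 < x1 by rewrite /x1; lra.
have e1_ge0 : 0 <= expR (- 1) :> R by exact: expR_ge0.
have e1_le1 : expR (- 1) <= 1 :> R by rewrite expR_le1; lra.
have h_ge0 x : (0%:E <= (h x)%:E)%E.
  rewrite lee_fin /h -mulrBr /step_fun; case: (ltgtP x x0) => [xx0|xx0|->].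
  - by rewrite (lt_trans xx0 x01) subrr mulr0.
  - case: (ltgtP x x1) => [xx1|xx1|xx1].
    + by rewrite subr0 mulr1; have := qpos x; lra.
    + by rewrite subrr mulr0.
    + by apply: mulr_ge0; [have := qpos x; lra|lra].
  - by rewrite x01; apply: mulr_ge0; [lra|lra].
have hi : mu.-integrable D (EFin \o h) by exact: integrableB_real.
have hI : (\int[mu]_(x in D) (h x)%:E = 0)%E.
  have hfin : (\int[mu]_(x in D) (h x)%:E)%E \is a fin_num by exact: integrable_fin_num.
  rewrite -(fineK hfin).
  by congr EFin; rewrite -/(Rintegral mu D h) RintegralB// e0 e1 subrr.
have JD : (`]x0, x1[%classic : set R) `<=` D.
  by move=> x; rewrite /D/= !in_itv/= andbT => /andP[/ltW /(le_trans x00)].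
have : (\int[mu]_(x in `]x0, x1[) (q x0 / 2)%:E <= \int[mu]_(x in D) (h x)%:E)%E.
  apply: (@le_trans _ _ (\int[mu]_(x in `]x0, x1[) (h x)%:E)%E); last first.
    apply: ge0_subset_integral => //.
    exact: measurable_int hi.
  apply: ge0_le_integral => //=.
  - by move=> x _; rewrite lee_fin; lra.
  - by apply: measurable_funS JD _ => //; exact: measurable_int hi.
  - move=> x; rewrite in_itv/= => /andP[xx0 xx1].
    rewrite lee_fin /h /step_fun xx1 (ltNge x x0) (ltW xx0)/= gt_eqF// mulr1 mulr0 subr0.
    by apply: qpos; rewrite !ltW.
rewrite hI integral_cst//= lebesgue_measure_itv/= lte_fin x01 -EFinD -EFinM lee_fin.
by rewrite leNgt mulr_gt0//; lra.
Qed.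

Lemma at_right_cvg_dist q x0 : q x @[x --> x0^'+] --> q x0 ->
  forall e, 0 < e -> exists2 d, 0 < d & forall x, x0 <= x < x0 + d -> `|q x - q x0| < e.
Proof.
move=> /cvgrPdist_lt qc e e0; have [d /= d0 dP] := qc e e0.
exists d => // x /andP[]; rewrite le_eqVlt => /predU1P[<- _|xx0 xd].
  by rewrite subrr normr0.
rewrite distrC; apply: dP => //=; rewrite distrC ger0_norm; last by rewrite subr_ge0 ltW.
by rewrite ltrBlDl.
Qed.

(** The weight exp(-l0 x) is moved into the function to make it integrable, and the remaining
    kernels are the powers of exp(-x). Since [laplace_eq0] gives one sign only, it is used for this
    function and for its opposite. *)
Lemma laplace_uniqueness (f : R -> R) (l0 x0 : R) :
  mu.-integrable D (EFin \o (fun x => expR (- (l0 * x)) * f x)) ->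
  (forall k : nat, \int[mu]_(x in D) (expR (- ((l0 + k%:R) * x)) * f x) = 0) ->
  0 <= x0 -> f x @[x --> x0^'+] --> f x0 -> f x0 = 0.
Proof.
move=> fi f0 x00 fc.
pose q x := expR (- (l0 * x)) * f x.
have qc : q x @[x --> x0^'+] --> q x0.
  apply: cvgM => //; apply: cvg_at_right_filter.
  apply: continuous_comp; last exact: continuous_expR.
  by apply: cvgN; apply: cvgMl_tmp; exact: cvg_id.
have q0 k : \int[mu]_(x in D) (q x * expR (- (k%:R * x))) = 0.
  rewrite -(f0 k); apply: eq_Rintegral => x _.
  by rewrite /q mulrAC -expRD; congr (expR _ * _); ring.
have Nqi : mu.-integrable D (EFin \o (fun x => - 1 * q x)) by exact: integrableZl_real.
have Nq0 k : \int[mu]_(x in D) (- 1 * q x * expR (- (k%:R * x))) = 0.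
  have : mu.-integrable D (EFin \o (fun x => q x * expR (- (k%:R * x)))).
    apply: (@integrable_mul_bounded _ _ R mu D mD _ _ 1 fi); first exact: measurable_expRN.
    move=> x; rewrite /D/= in_itv/= andbT => xx; rewrite ger0_norm ?expR_ge0//.
    by rewrite expR_le1 oppr_le0 mulr_ge0.
  move=> qki; under eq_Rintegral do rewrite -mulrA.
  by rewrite RintegralZl// q0 mulr0.
have le1 : q x0 <= 0 := laplace_eq0 fi q0 x00 (at_right_cvg_dist qc).
have Nqc : - 1 * q x @[x --> x0^'+] --> - 1 * q x0 by exact: cvgMl_tmp.
have le2 := laplace_eq0 Nqi Nq0 x00 (at_right_cvg_dist Nqc).
have /eqP : q x0 = 0 by lra.
by rewrite mulf_eq0 gt_eqF ?expR_gt0//= => /eqP.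
Qed.

End LaplaceUniqueness.

(** * Laplace transform of the confluent Lauricella function *)

Section ComplexConvergence.
Variable R : realType.
Implicit Types (u v : nat -> R[i]) (l m k : R[i]).

Definition cvgC u l := (fun N => cmod (u N - l)) @ \oo --> (0 : R).

Lemma cvgC_ccvg u l : cvgC u l -> ccvg u l.
Proof.
move=> ul; split; apply/subr_cvg0; apply/norm_cvg0P.
  apply: (squeeze_cvgr _ (cvg_cst 0) ul); near=> N.
  by rewrite normr_ge0/= -cReB norm_Re_le.
apply: (squeeze_cvgr _ (cvg_cst 0) ul); near=> N.
by rewrite normr_ge0/= -cImB norm_Im_le.
Unshelve. all: by end_near. Qed.

Lemma ccvgZ k u l : ccvg u l -> ccvg (fun N => k * u N) (k * l).
Proof.
move=> [ur ui]; split.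
  under eq_fun do rewrite cReM; rewrite cReM.
  by apply: cvgB; apply: cvgMl_tmp.
under eq_fun do rewrite cImM; rewrite cImM.
by apply: cvgD; apply: cvgMl_tmp.
Qed.

Lemma cvgCM u v l m : cvgC u l -> cvgC v m -> cvgC (fun N => u N * v N) (l * m).
Proof.
move=> ul vm; have h : (fun N => cmod (u N - l) * cmod (v N - m) +
   cmod (u N - l) * cmod m + cmod l * cmod (v N - m)) @ \oo --> (0 : R).
  rewrite [X in _ --> X](_ : _ = 0 * 0 + 0 * cmod m + cmod l * 0); last by ring.
  by apply: cvgD; [apply: cvgD; [exact: cvgM|exact: cvgMr_tmp]|exact: cvgMl_tmp].
apply: (squeeze_cvgr _ (cvg_cst 0) h); near=> N.
rewrite cmod_ge0/= (_ : _ - _ = (u N - l) * (v N - m) + (u N - l) * m + l * (v N - m)); last by ring.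
by rewrite (le_trans (cmodD _ _))// cmodM lerD2r (le_trans (cmodD _ _))// !cmodM.
Unshelve. all: by end_near. Qed.

Lemma cvgC_prod (I : Type) (s : seq I) (u : I -> nat -> R[i]) (l : I -> R[i]) :
  (forall i, cvgC (u i) (l i)) ->
  cvgC (fun N => \prod_(i <- s) u i N) (\prod_(i <- s) l i).
Proof.
move=> ul; elim: s => [|i s IH].
  rewrite big_nil /cvgC; under eq_fun do rewrite big_nil subrr cmod0; exact: cvg_cst.
rewrite big_cons; under eq_fun do rewrite big_cons; exact: cvgCM.
Qed.

End ComplexConvergence.

Section MgfFactor.
Variable R : realType.
Implicit Types (a b z : R[i]) (l : R).

Lemma Re_inv_gt0 z : 0 < Re z -> 0 < Re z^-1.
Proof.
case: z => x y /= x0; rewrite divr_gt0// ltr_pwDl ?sqr_ge0// exprn_gt0//.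
Qed.

(** Here 1 + l / a = (l / a) (1 + a / l). Both factors lie in the right half-plane, so their
    arguments add up to less than pi and the principal logarithm splits. The last factor is a
    binomial in 1 / l. *)
Lemma cpow_1D_inv a b l : 0 < Re a -> 0 < l ->
  cpow (1 - (- l)%:C / a) (- b) =
  cpow a b * cexp (- (b * (ln l)%:C)) * cpow (1 - (- a * (l^-1)%:C)) (- b).
Proof.
move=> a0 l0; have az : a != 0 by rewrite slit_neq0// slit_Re.
have lz : l%:C != 0 :> R[i] by rewrite real_complex_eq0 gt_eqF.
have w0 : 0 < Re (1 - (- a * (l^-1)%:C)).
  rewrite cReB mulrC cReZ cReN/=; have : 0 < l^-1 * Re a by rewrite mulr_gt0 ?invr_gt0.
  lra.
set w := 1 - _ in w0 *.
have ia := Re_inv_gt0 a0.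
have pa : `|carg a| < pi / 2 by exact: carg_Re_gt0_lt.
have cl : clog (l%:C * a^-1) = (ln l)%:C - clog a.
  rewrite clogM ?slit_Re//=; last first.
    have -> : carg l%:C = 0 by rewrite carg_Re_gt0//= mul0r atan0.
    by rewrite add0r carg_slit_lt// slit_Re.
  by rewrite clog_real// clogV// slit_Re.
have e1 : 1 - (- l)%:C / a = (l%:C * a^-1) * w.
  rewrite /w rmorphN mulNr opprK real_complexV; field.
  by rewrite az lz.
have la0 : 0 < Re (l%:C * a^-1) by rewrite cReZ mulr_gt0.
have cw : clog (1 - (- l)%:C / a) = (ln l)%:C - clog a + clog w.
  rewrite e1 clogM ?slit_Re// ?cl//.
  rewrite (le_lt_trans (ler_normD _ _))//.
  by have := carg_Re_gt0_lt la0; have := carg_Re_gt0_lt w0; lra.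
have nz : 1 - (- l)%:C / a != 0.
  by rewrite e1 !mulf_neq0// ?invr_eq0// slit_neq0// slit_Re.
rewrite !cpowE// ?cw; last by rewrite slit_neq0// slit_Re.
by rewrite -!cexpD; congr cexp; ring.
Qed.

(** The powers l^(-b_i) may be complex one by one; their product is a real power because the sum of
    the b_i is real. *)
Lemma mgf_factor (n : nat) (a b : 'I_n -> R[i]) l :
  (forall i, 0 < Re (a i)) -> Im (\sum_i b i) = 0 -> 0 < l ->
  \prod_i cpow (1 - (- l)%:C / a i) (- b i) =
  \prod_i cpow (a i) (b i) * (l `^ (- Re (\sum_i b i)))%:C *
  \prod_i cpow (1 - (- a i * (l^-1)%:C)) (- b i).
Proof.
move=> a0 b0 l0.
under eq_bigr do rewrite cpow_1D_inv//.
rewrite 2!big_split/= -cexp_sum; congr (_ * _ * _).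
rewrite sumrN -mulr_suml.
have -> : \sum_i b i = (Re (\sum_i b i))%:C by apply: complex_ext.
by rewrite -rmorphM -rmorphN cexpr /powR/= (gt_eqF l0) mulNr.
Qed.

End MgfFactor.

(** * Termwise Laplace transform *)

Section LaplacePhi2.
Variables (R : realType) (n : nat) (a b : 'I_n -> R[i]) (B : R).
Hypotheses (B0 : 0 < B).
Local Notation mu := (@lebesgue_measure R).
Local Notation D := (`[0%R, +oo[%classic : set R).
Local Notation tau := (Phi2_term b (1 + B)%:C (fun i => - a i)).
Local Notation Phi x := (Phi2 b (1 + B)%:C (fun i => - a i * x%:C)).

Lemma Gamma_prod (x : R) m : 0 < x ->
  Gamma (x + m%:R) = (\prod_(k < m) (x + k%:R)) * Gamma x.
Proof.
move=> x0; elim: m => [|m IH]; first by rewrite addr0 big_ord0 mul1r.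
have xm : 0 < x + m%:R by rewrite ltr_wpDr.
by rewrite -natr1 addrA (GammaS xm) IH big_ord_recr/= mulrCA mulrA.
Qed.

Lemma integrable_powR_expR (c l : R) : 0 < c -> 0 < l ->
  mu.-integrable D (EFin \o (fun x => x `^ c * expR (- (l * x)))).
Proof.
move=> c0 l0; apply/integrableP; split.
  by apply/measurable_EFinP; exact: measurable_powR_expR.
under eq_integral do rewrite /= ger0_norm ?mulr_ge0 ?powR_ge0 ?expR_ge0//.
by rewrite integral_powR_expR// eGammaE ?addr_gt0// -EFinM ltry.
Qed.

Lemma Rintegral_powR_expR (c l : R) : 0 < c -> 0 < l ->
  \int[mu]_(x in D) (x `^ c * expR (- (l * x))) = l `^ (- (c + 1)) * Gamma (c + 1).
Proof.
by move=> c0 l0; rewrite /Rintegral integral_powR_expR// eGammaE ?addr_gt0.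
Qed.

(** Each monomial of degree k gives Gamma(B + 1 + k) l^(-(B + 1 + k)). It is written relative to the
    value at k = 0, so that (B + 1)_k appears, ready to cancel the denominator of the series. *)
Lemma integral_box_real (r : ('I_n -> nat) -> R) (l : R) (N : nat) : 0 < l ->
  mu.-integrable D (EFin \o (fun x => x `^ B * expR (- (l * x)) *
      box_sum (fun m => x ^+ (\sum_i m i) * r m) N)) /\
  \int[mu]_(x in D) (x `^ B * expR (- (l * x)) *
      box_sum (fun m => x ^+ (\sum_i m i) * r m) N) =
  box_sum (fun m => r m * (l `^ (- (B + 1)) * Gamma (B + 1) *
    ((\prod_(k < \sum_i m i) (B + 1 + k%:R)) * (l^-1) ^+ (\sum_i m i)))) N.
Proof.
move=> l0.
have mono m : mu.-integrable D (EFin \o (fun x => r m * (x `^ (B + (\sum_i m i)%:R) * expR (- (l * x))))) /\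
  \int[mu]_(x in D) (r m * (x `^ (B + (\sum_i m i)%:R) * expR (- (l * x)))) =
  r m * (l `^ (- (B + 1)) * Gamma (B + 1) *
    ((\prod_(k < \sum_i m i) (B + 1 + k%:R)) * (l^-1) ^+ (\sum_i m i))).
  have Bm : 0 < B + (\sum_i m i)%:R by rewrite ltr_wpDr.
  have ii := integrable_powR_expR Bm l0.
  split; first exact: integrableZl_real.
  rewrite RintegralZl// Rintegral_powR_expR//; congr (_ * _).
  rewrite addrAC Gamma_prod ?addr_gt0// opprD powRD; last by rewrite (gt_eqF l0) implybT.
  rewrite (powRN l (_%:R)) powR_mulrn ?ltW// exprVn; ring.
have e x : D x -> x `^ B * expR (- (l * x)) * box_sum (fun m => x ^+ (\sum_i m i) * r m) N =
   \sum_(m : {ffun 'I_n -> 'I_N}) r (fun i => m i : nat) * (x `^ (B + (\sum_i m i)%:R) * expR (- (l * x))).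
  rewrite /= in_itv/= andbT => x0.
  rewrite /box_sum mulr_sumr; apply: eq_bigr => m _.
  rewrite powRD; last first.
    by apply/implyP => /eqP h; have : 0 < B + (\sum_i m i)%:R; [rewrite ltr_wpDr|rewrite h ltxx].
  rewrite powR_mulrn//; ring.
have [h1 h2] := @Rintegral_sum _ _ R mu D (measurable_itv _) _ (index_enum {ffun 'I_n -> 'I_N}) _
  (fun m => (mono (fun i => m i : nat)).1).
split; last first.
  transitivity (\int[mu]_(x in D) \sum_(m : {ffun 'I_n -> 'I_N})
      r (fun i => m i : nat) * (x `^ (B + (\sum_i m i)%:R) * expR (- (l * x)))).
    by apply: eq_Rintegral => x; rewrite inE; exact: e.
  rewrite h2 /box_sum; apply: eq_bigr => m _; exact: (mono (fun i => m i : nat)).2.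
apply: eq_integrable h1 => //.
by move=> x; rewrite inE => Dx; rewrite /= e.
Qed.


(** [P] stands for the real or the imaginary part. Real linearity, the bound by the modulus and
    compatibility with limits are what both share, so one argument serves for the two components. *)
Variables (P : R[i] -> R) (kappa : R[i]).
Hypothesis PD : forall z w, P (z + w) = P z + P w.
Hypothesis PZ : forall x z, P (x%:C * z) = x * P z.
Hypothesis P_le : forall z, `|P z| <= cmod z.
Hypothesis P_cvg : forall u l, ccvg u l -> (fun N => P (u N)) @ \oo --> P l.

Lemma P_box (t : ('I_n -> nat) -> R[i]) N : P (box_partial t N) = box_sum (fun m => P (t m)) N.
Proof. by apply: (big_morph P PD); have := PZ 0 0; rewrite mul0r mul0r. Qed.

Lemma P_box_Phi2 x N :
  P (kappa * box_partial (Phi2_term b (1 + B)%:C (fun i => - a i * x%:C)) N) =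
  box_sum (fun m => x ^+ (\sum_i m i) * P (kappa * tau m)) N.
Proof.
have -> : kappa * box_partial (Phi2_term b (1 + B)%:C (fun i => - a i * x%:C)) N =
    box_partial (fun m => (x ^+ (\sum_i m i))%:C * (kappa * tau m)) N.
  rewrite /box_partial mulr_sumr; apply: eq_bigr => m _.
  by rewrite Phi2_termZ mulrCA.
by rewrite P_box /box_sum; apply: eq_bigr => m _; rewrite PZ.
Qed.

(** The only factor of the series that couples the indices is (1 + B)_|m|. It cancels against the
    Gamma quotient of the integral, so the terms become products over i. *)
Lemma tau_poch (l : R) m : 0 < l ->
  tau m * ((\prod_(k < \sum_i m i) (B + 1 + k%:R)) * (l^-1) ^+ (\sum_i m i))%:C =
  \prod_i (poch (b i) (m i) * ((- a i * (l^-1)%:C) ^+ m i / (m i)`!%:R)).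
Proof.
move=> l0; rewrite real_complexM -poch_real (addrC B) /Phi2_term.
have : poch (1 + B)%:C (\sum_i m i) != 0.
  by rewrite -cmod_gt0 (lt_le_trans _ (fact_le_poch _ (ltW B0)))// ltr0n fact_gt0.
move: (poch (1 + B)%:C _) => c c0.
rewrite -prodrXr rmorph_prod/=.
transitivity (\prod_(i < n) poch (b i) (m i) * (\prod_(i < n) ((- a i) ^+ m i / (m i)`!%:R) *
    \prod_(i < n) (l^-1 ^+ m i)%:C)); first by field.
rewrite -big_split -big_split/=; apply: eq_bigr => i _; congr (_ * _).
by rewrite exprMn rmorphXn/=; ring.
Qed.

Lemma laplace_Phi2 (l : R) : 2 * (\sum_i cmod (a i)) + 1 <= l ->
  mu.-integrable D (EFin \o (fun x => x `^ B * expR (- (l * x)) * P (kappa * Phi x))) /\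
  \int[mu]_(x in D) (x `^ B * expR (- (l * x)) * P (kappa * Phi x)) =
  P (kappa * ((l `^ (- (B + 1)) * Gamma (B + 1))%:C *
     \prod_i cpow (1 - (- a i * (l^-1)%:C)) (- b i))).
Proof.
set A := \sum_i _ => lA.
have A0 : 0 <= A by apply: sumr_ge0 => i _; exact: cmod_ge0.
have l0 : 0 < l by lra.
have [C C0 CP] := Phi2_box_le b (ltW B0).
pose f N x := x `^ B * expR (- (l * x)) *
  P (kappa * box_partial (Phi2_term b (1 + B)%:C (fun i => - a i * x%:C)) N).
have fE N : f N = (fun x => x `^ B * expR (- (l * x)) *
    box_sum (fun m => x ^+ (\sum_i m i) * P (kappa * tau m)) N).
  by apply/funext => x; rewrite /f P_box_Phi2.
have fI N := integral_box_real (fun m => P (kappa * tau m)) N l0.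
have gi := integrable_powR_expR B0 (ltr01 : 0 < (1 : R)).
(* The partial sums grow at most like exp(2 A x), with A the sum of the |a_i|. Since l >= 2 A + 1,
   the product with exp(-l x) is at most a multiple of exp(-x), whatever N. *)
have [||||hi hl] := @Rintegral_dominated_cvg _ _ R mu D f
  (fun x => x `^ B * expR (- (l * x)) * P (kappa * Phi x))
  (fun x => cmod kappa * C * (x `^ B * expR (- (1 * x)))) (measurable_itv _).
- by move=> N; rewrite fE; exact: measurable_integrable (fI N).1.
- move=> x _; apply: cvgMl_tmp; apply: P_cvg; apply: ccvgZ.
  exact: Phi2_cvg (ltW B0).
- exact: integrableZl_real.
- move=> N x; rewrite /= in_itv/= andbT => x0.
  rewrite /f normrM ger0_norm ?mulr_ge0 ?powR_ge0 ?expR_ge0//.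
  rewrite (_ : _ * C * _ = x `^ B * (expR (- (1 * x)) * (cmod kappa * C))); last by ring.
  rewrite -mulrA ler_wpM2l ?powR_ge0//.
  have h1 : `|P (kappa * box_partial (Phi2_term b (1 + B)%:C (fun i => - a i * x%:C)) N)| <=
      cmod kappa * (C * expR (2 * (A * x))).
    rewrite (le_trans (P_le _))// cmodM ler_wpM2l ?cmod_ge0//.
    rewrite (le_trans (cmod_box_le _ _))// (le_trans (CP _ _))//.
    rewrite ler_wpM2l// ler_expR ler_wpM2l// /A mulr_suml.
    by apply: ler_sum => i _; rewrite cmodM cmodN cmodr ger0_norm.
  apply: (@le_trans _ _ (expR (- (l * x)) * (cmod kappa * (C * expR (2 * (A * x)))))).
    by rewrite ler_wpM2l ?expR_ge0.
  rewrite (_ : expR (- (l * x)) * _ = expR (- (l * x) + 2 * (A * x)) * (cmod kappa * C)); last first.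
    by rewrite expRD; ring.
  rewrite ler_wpM2r ?mulr_ge0 ?cmod_ge0// ler_expR; nra.
split=> //; apply: (cvg_unique (@Rhausdorff R) hl).
have -> : (fun N => \int[mu]_(x in D) f N x) = (fun N =>
    P (kappa * ((l `^ (- (B + 1)) * Gamma (B + 1))%:C *
      \prod_i bin_sum (b i) (- a i * (l^-1)%:C) N))).
  apply/funext => N; rewrite fE (fI N).2.
  have -> : kappa * ((l `^ (- (B + 1)) * Gamma (B + 1))%:C *
      \prod_i bin_sum (b i) (- a i * (l^-1)%:C) N) =
    box_partial (fun m => (l `^ (- (B + 1)) * Gamma (B + 1) * ((\prod_(k < \sum_i m i) (B + 1 + k%:R)) * (l^-1) ^+ (\sum_i m i)))%:C * (kappa * tau m)) N.
    rewrite /bin_sum -(box_prod (fun i k =>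
      poch (b i) k * ((- a i * (l^-1)%:C) ^+ k / k`!%:R)) N) /box_partial !mulr_sumr; apply: eq_bigr => m _.
    by rewrite -(tau_poch _ l0) real_complexM; ring.
  by rewrite P_box /box_sum; apply: eq_bigr => m _; rewrite PZ mulrC.
apply: P_cvg; apply: ccvgZ; apply: ccvgZ; apply: cvgC_ccvg; apply: cvgC_prod => i.
apply: bin_sum_cvg; rewrite cmodM cmodN cmodr ger0_norm ?invr_ge0 ?ltW//.
rewrite ltr_pdivrMr// mul1r.
have : cmod (a i) <= A by rewrite /A (bigD1 i)//= lerDl sumr_ge0// => j _; exact: cmod_ge0.
lra.
Qed.

End LaplacePhi2.

(** * Identification of the cumulative distribution function *)

Section CdfFormula.
Variables (R : realType) (n : nat) (a b : 'I_n -> R[i]).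
Local Notation mu := (@lebesgue_measure R).
Local Notation D := (`[0%R, +oo[%classic : set R).
Local Notation B := (Re (\sum_(i < n) b i)).
Local Notation K := (\prod_(i < n) cpow (a i) (b i)).
Local Notation kappa := (K / (Gamma (1 + B))%:C).
Local Notation Phi x := (Phi2 b (1 + B)%:C (fun i => - a i * x%:C)).
Local Notation F x := (kappa * (x `^ B)%:C * Phi x).
Local Notation mgf s := (\prod_(i < n) cpow (1 - s%:C / a i) (- b i)).
Local Notation Lam := (2 * (\sum_i cmod (a i)) + 1).
Hypotheses (a_gt0 : forall i, 0 < Re (a i)) (b_real : Im (\sum_(i < n) b i) = 0).
Hypothesis (B_gt0 : 0 < B).

Lemma Lam_gt0 : 0 < Lam.
Proof.
have : 0 <= \sum_i cmod (a i) by apply: sumr_ge0 => i _; exact: cmod_ge0.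
lra.
Qed.

Lemma cmodM_le_succ (k z w : R[i]) : cmod (k * (z - w)) <= cmod (w - z) * (cmod k + 1).
Proof. by rewrite cmodM cmodBC mulrC ler_wpM2l ?cmod_ge0// lerDl. Qed.

Section Component.
Variable P : R[i] -> R.
Hypothesis PD : forall z w, P (z + w) = P z + P w.
Hypothesis PZ : forall x z, P (x%:C * z) = x * P z.
Hypothesis P_le : forall z, `|P z| <= cmod z.
Hypothesis P_cvg : forall u l, ccvg u l -> (fun N => P (u N)) @ \oo --> P l.

Lemma P_F x : P (F x) = x `^ B * P (kappa * Phi x).
Proof. by rewrite mulrAC mulrC PZ. Qed.

Lemma laplace_F (l : R) : Lam <= l ->
  mu.-integrable D (EFin \o (fun x => expR (- (l * x)) * P (F x))) /\
  \int[mu]_(x in D) (expR (- (l * x)) * P (F x)) = l^-1 * P (mgf (- l)).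
Proof.
move=> lL; have l0 : 0 < l by have := Lam_gt0; lra.
have e : (fun x => expR (- (l * x)) * P (F x)) =
    (fun x => x `^ B * expR (- (l * x)) * P (kappa * Phi x)).
  by apply/funext => x; rewrite P_F; ring.
rewrite e; have [h1 h2] := @laplace_Phi2 R n a b B B_gt0 P kappa PD PZ P_le P_cvg l lL.
split; first exact: h1.
rewrite h2 -PZ; congr P; rewrite (mgf_factor a_gt0 b_real l0).
have G0 : (Gamma (1 + B))%:C != 0 :> R[i].
  by rewrite real_complex_eq0 gt_eqF// Gamma_gt0// addr_gt0.
have -> : l `^ (- (B + 1)) = l^-1 * l `^ (- B).
  by rewrite opprD powRD ?(gt_eqF l0) ?implybT// powR_inv1 ?ltW// mulrC.
rewrite (addrC B 1) !real_complexM; field.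
have lC : l%:C != 0 :> R[i] by rewrite real_complex_eq0 gt_eqF.
by rewrite lC G0.
Qed.

(** Continuity from the right is all that a cdf offers at each point and all that uniqueness asks
    for; it also covers the power x^B at x0 = 0. *)
Lemma right_continuous_F x0 : 0 <= x0 -> P (F x) @[x --> x0^'+] --> P (F x0).
Proof.
move=> x00.
have eF : (fun x => P (F x)) = (fun x => x `^ B * P (kappa * Phi x)).
  by apply/funext => x; exact: P_F.
rewrite -[X in _ --> X]/((fun x => P (F x)) x0) eF; apply: cvgM.
  move: x00; rewrite le_eqVlt => /predU1P[<-|x00].
    by rewrite powR0 ?gt_eqF//; exact: powR_cvg0.
  apply: cvg_at_right_filter.
  suff : {for x0, continuous (@powR R ^~ B)} by [].
  apply: differentiable_continuous; apply/derivable1_diffP.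
  by apply: derivable_powR; rewrite in_itv/= andbT.
have PB z w : P (z - w) = P z - P w.
  by rewrite PD; congr (_ + _); rewrite -mulN1r -(rmorphN1 (real_complex R)) PZ mulN1r.
apply/cvgrPdist_lt => e e0.
have k1 : 0 < cmod kappa + 1 by rewrite ltr_wpDl ?cmod_ge0.
have [d d0 dP] := @Phi2_continuous R n b (fun i => - a i) B (ltW B_gt0) x0 x00 (e / (cmod kappa + 1)) (divr_gt0 e0 k1).
near=> x; rewrite -PB -mulrBr.
have xx0 : x0 < x by near: x; exact: nbhs_right_gt.
have xd : x < x0 + d.
  by near: x; apply: nbhs_right_lt; rewrite ltrDl.
have := dP x (ltW (le_lt_trans x00 xx0)); rewrite ger0_norm ?subr_ge0 ?ltW// ltrBlDl.
move=> /(_ xd); rewrite ltr_pdivlMr// => h.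
apply: le_lt_trans (P_le _) _; apply: le_lt_trans h.
exact: cmodM_le_succ.
Unshelve. all: by end_near. Qed.

End Component.

Lemma integrable_expR (l : R) : 0 < l ->
  mu.-integrable D (EFin \o (fun x => expR (- (l * x)))).
Proof.
move=> l0; apply/integrableP; split.
  by apply/measurable_EFinP; exact: measurable_expRN.
under eq_integral do rewrite /= ger0_norm ?expR_ge0//.
by rewrite integral_expR_tail// ltry.
Qed.

(** Uniqueness is applied twice: to Im F, whose transform is a multiple of the vanishing imaginary
    part of the product formula, and to the difference of Re F and the cdf. The progression of
    arguments starts at [Lam], where [laplace_F] becomes valid. *)
Lemma cdf_formula d (T : measurableType d) (Pr : probability T R)
    (X : {RV Pr >-> R}) : (forall w, 0 <= X w) ->
  (forall s : R, s <= 0 -> 'M_Pr X s = (Re (mgf s))%:E /\ Im (mgf s) = 0) ->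
  forall x : R, 0 <= x -> cdf X x = (Re (F x))%:E /\ Im (F x) = 0.
Proof.
move=> X0 mgfE x0 x00.
pose fc x := fine (cdf X x).
have fcE x : cdf X x = (fc x)%:E by rewrite /fc fineK// fin_num_measure.
have fc01 x : `|fc x| <= 1.
  have := cdf_ge0 X x; have := cdf_le1 X x; rewrite fcE !lee_fin => ? ?.
  by rewrite ger0_norm.
have mfc : measurable_fun setT fc.
  apply/measurable_EFinP; apply: (eq_measurable_fun (cdf X)); last exact: cdf_measurable.
  by move=> x _; rewrite fcE.
have L0 := Lam_gt0.
have fcI (l : R) : Lam <= l ->
  mu.-integrable D (EFin \o (fun x => expR (- (l * x)) * fc x)) /\
  \int[mu]_(x in D) (expR (- (l * x)) * fc x) = l^-1 * Re (mgf (- l)).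
  move=> lL; have l0 : 0 < l by lra.
  have fi : mu.-integrable D (EFin \o (fun x => expR (- (l * x)) * fc x)).
    apply: (@integrable_mul_bounded _ _ R mu D (measurable_itv _) _ _ 1 (integrable_expR l0)) => //.
    exact: measurable_funTS.
  split=> //; apply: EFin_inj.
  have ln : - l <= 0 by rewrite oppr_le0 ltW.
  rewrite EFinM -(mgfE (- l) ln).1 -integral_expR_cdf//.
  rewrite /Rintegral fineK; last exact: integrable_fin_num.
  by apply: eq_integral => x _; rewrite fcE.
have [ReI ImI] : (Re (F x0) = fc x0) /\ Im (F x0) = 0.
  have ReP := laplace_F (@cReD R) (@cReZ R) (@norm_Re_le R) (fun u l (h : ccvg u l) => h.1).
  have ImP := laplace_F (@cImD R) (@cImZ R) (@norm_Im_le R) (fun u l (h : ccvg u l) => h.2).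
  have ReC := right_continuous_F (@cReD R) (@cReZ R) (@norm_Re_le R) x00.
  have ImC := right_continuous_F (@cImD R) (@cImZ R) (@norm_Im_le R) x00.
  split; last first.
    apply: (laplace_uniqueness (l0 := Lam) (f := fun x => Im (F x)) (ImP Lam (lexx _)).1) => //.
    move=> k; have lL : Lam <= Lam + k%:R by rewrite lerDl.
    by rewrite (ImP _ lL).2 (mgfE _ _).2 ?mulr0// oppr_le0 (le_trans (ltW L0)).
  have eR l : (fun x => expR (- (l * x)) * (Re (F x) - fc x)) =
      (fun x => expR (- (l * x)) * Re (F x) - expR (- (l * x)) * fc x).
    by apply/funext => x; exact: mulrBr.
  apply/eqP; rewrite -subr_eq0; apply/eqP.
  apply: (laplace_uniqueness (l0 := Lam) (f := fun x => Re (F x) - fc x)) => //.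
  - rewrite eR; exact: integrableB_real (ReP Lam (lexx _)).1 (fcI Lam (lexx _)).1.
  - move=> k; have lL : Lam <= Lam + k%:R by rewrite lerDl.
    rewrite eR.
    by rewrite RintegralB//; [rewrite (ReP _ lL).2 (fcI _ lL).2 subrr|exact: (ReP _ lL).1|exact: (fcI _ lL).1].
  - apply: cvgB => //; apply: fine_cvg; rewrite -fcE; exact: cdf_right_continuous.
by rewrite ReI fcE.
Qed.

End CdfFormula.

(** * Analytic continuation of F_D by an Euler integral *)

Section SlitPlanePerturbation.
Variable R : realType.
Implicit Types (z w h b : R[i]) (u t : R).

Lemma slit1B z : slit (1 - z) <-> ~ (Im z = 0 /\ 1 <= Re z).
Proof.
rewrite /slit cReB cImB/= sub0r oppr_eq0 subr_gt0; split.
  by move=> /orP[z1 [_]|/eqP z0 [/z0]//]; rewrite leNgt z1.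
move=> h; apply/orP; have [z0|z0] := eqVneq (Im z) 0; last by right.
by left; rewrite ltNge; apply/negP => z1; exact: h.
Qed.

Lemma slit_cexp z : `|Im z| < pi -> slit (cexp z).
Proof.
rewrite cexpE /slit/= mulf_eq0 gt_eqF ?expR_gt0//= pmulr_rgt0 ?expR_gt0//.
move=> zpi; apply/orP; have [s0|] := eqVneq (sin (Im z)) 0; last by right.
left; have [|z0|z0] := ltgtP (Im z) 0; last by rewrite z0 cos0.
  move=> z0; have : 0 < sin (- Im z).
    by apply: sin_gt0_pi; move: zpi; rewrite ltr_norml; lra.
  by rewrite sinN s0 oppr0 ltxx.
have : 0 < sin (Im z) by apply: sin_gt0_pi; move: zpi; rewrite ltr_norml; lra.
by rewrite s0 ltxx.
Qed.

Lemma slitM z w : slit z -> slit w -> `|carg z + carg w| < pi -> slit (z * w).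
Proof.
move=> sz sw h; rewrite -(cexp_clog sz) -(cexp_clog sw) -cexpD; apply: slit_cexp.
by rewrite cImD !clogE.
Qed.

Lemma norm_atan t : `|atan t| = atan `|t|.
Proof.
have [t0|t0] := leP 0 t.
  by have := le_atan t0; rewrite atan0 => a0; rewrite !ger0_norm.
by have := lt_atan t0; rewrite atan0 => a0; rewrite !ltr0_norm// atanN.
Qed.

Lemma norm_atan_le t : `|atan t| <= `|t|.
Proof.
rewrite norm_atan; have := normr_ge0 t; move: `|t| => {}t; rewrite le_eqVlt => /predU1P[<-|t0].
  by rewrite atan0.
have datan (x : R) : is_derive x 1 (@atan R) (1 + x ^+ 2)^-1.
  by apply: DeriveDef; rewrite ?derivable_atan// -derive1E derive1_atan.
have [|x xt] := @MVT _ (@atan R) (fun x => (1 + x ^+ 2)^-1) 0 t t0 (fun x _ => datan x).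
  by apply: continuous_subspaceT; exact: continuous_atan.
rewrite atan0 !subr0 => ->; rewrite ler_piMl ?(ltW t0)// invf_le1 ?oneDsqr_gt0'//.
by rewrite lerDl sqr_ge0.
Qed.

Lemma slit_segment u z : 0 <= u <= 1 -> slit (1 - z) -> slit (1 - u%:C * z).
Proof.
move=> /andP[u0 u1]; rewrite /slit !cReB !cImB cReZ cImZ/= !sub0r !oppr_eq0 mulf_eq0 => /orP[z0|z0].
  apply/orP; left; move: u1; rewrite le_eqVlt => /predU1P[->|u1]; first by rewrite mul1r.
  by have := mulr_ge0 u0 (ltW z0); lra.
have [->|un] := eqVneq u 0; first by rewrite mul0r subr0 ltr01.
by rewrite z0 orbT.
Qed.

(** |w| + Re w is the denominator in the half-angle formula for the argument of w. With 1 - u z = u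
    (1 - z) + (1 - u), the loss 1 - u in the triangle inequality is exactly the gain in the real
    part. *)
Lemma segment_polar_ge u z : 0 <= u <= 1 ->
  u * (cmod (1 - z) + Re (1 - z)) <= cmod (1 - u%:C * z) + Re (1 - u%:C * z).
Proof.
move=> /andP[u0 u1]; have : cmod (u%:C * (1 - z)) <= cmod (1 - u%:C * z) + (1 - u).
  rewrite (_ : u%:C * (1 - z) = (1 - u%:C * z) - (1 - u)%:C); last by rewrite rmorphB; ring.
  by rewrite (le_trans (cmodB _ _))// cmodr lerD2l ger0_norm ?subr_ge0.
by rewrite cmodM cmodr ger0_norm// !cReB cReZ/=; lra.
Qed.

(** In the half-angle formula the numerator scales by u while the denominator shrinks by at most u.
    The arguments along the segment are thus bounded away from pi uniformly in u. *)
Lemma carg_segment_le u z : 0 <= u <= 1 -> slit (1 - z) ->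
  `|carg (1 - u%:C * z)| <= `|carg (1 - z)|.
Proof.
move=> u01 sz; have su := slit_segment u01 sz; have /andP[u0 u1] := u01.
rewrite !carg_slit// !normrM ler_wpM2l// !norm_atan le_atan//.
have r1 := slit_gt0 sz; have ru := slit_gt0 su; have h := segment_polar_ge z u01.
rewrite !normrM !normfV (gtr0_norm r1) (gtr0_norm ru) ler_pdivrMr// mulrAC ler_pdivlMr//.
have -> : `|Im (1 - u%:C * z)| = u * `|Im (1 - z)|.
  by rewrite !cImB cImZ/= !sub0r !normrN normrM ger0_norm.
by rewrite mulrAC [leRHS]mulrC ler_wpM2r.
Qed.

(** An explicit bound instead of compactness: if u |z| <= 1/2 the modulus is at least 1/2; otherwise
    u is bounded below and [segment_polar_ge] gives u k <= 2 |1 - u z|. *)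
Lemma segment_cmod_ge z : slit (1 - z) -> exists2 d : R, 0 < d &
  forall u, 0 <= u <= 1 -> d <= cmod (1 - u%:C * z).
Proof.
move=> sz; have k0 := slit_gt0 sz; set k := _ + _ in k0.
have z1 : 0 < 4 * (1 + cmod z) by rewrite mulr_gt0// ltr_pwDl ?cmod_ge0.
exists (Num.min 2^-1 (k / (4 * (1 + cmod z)))); first by rewrite lt_min invr_gt0 ltr0n divr_gt0.
move=> u u01; have /andP[u0 u1] := u01; rewrite ge_min; have h := segment_polar_ge z u01.
have [uz|uz] := leP (u * cmod z) 2^-1.
  apply/orP; left; have := cmodD (1 - u%:C * z) (u%:C * z).
  by rewrite subrK cmod1 cmodM cmodr ger0_norm//; lra.
apply/orP; right; rewrite ler_pdivrMr//.
have hr := le_trans (ler_norm _) (norm_Re_le (1 - u%:C * z)).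
have h2 : u * k <= 2 * cmod (1 - u%:C * z) by rewrite -/k in h; lra.
have := cmod_ge0 z; have := cmod_ge0 (1 - u%:C * z); nra.
Qed.

(** One factor of the Euler integrand; [dpsi] is its derivative in z. *)
Definition psi b u z := cpow (1 - u%:C * z) (- b).
Definition dpsi b u z := b * u%:C * cpow (1 - u%:C * z) (- (b + 1)).

Lemma psi_le b z : slit (1 - z) -> exists2 M : R, 0 <= M &
  forall u, 0 <= u <= 1 -> cmod (psi b u z) <= M.
Proof.
move=> sz; have [d d0 dP] := segment_cmod_ge sz.
exists (expR (cmod (- b) * (`|ln d| + `|ln (1 + cmod z)| + pi))); first exact: expR_ge0.
move=> u u01; apply: cmod_cpow_le => //; first exact: slit_segment.
rewrite dP//=; have /andP[u0 u1] := u01.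
rewrite (le_trans (cmodB _ _))// cmod1 lerD2l cmodM cmodr ger0_norm//.
by rewrite ler_piMl ?cmod_ge0.
Qed.

(* Writing 1 - u (z + h) = (1 - u z) (1 - e) with small e reduces a perturbation of z to one of 1. *)
Lemma psi_split z : slit (1 - z) -> exists2 d : R, 0 < d <= 1 &
  exists2 C : R, 0 <= C & forall u h, 0 <= u <= 1 -> cmod h < d ->
    let e := u%:C * h / (1 - u%:C * z) in
    [/\ cmod e <= 2^-1, cmod e <= C * cmod h, slit (1 - u%:C * (z + h)) &
     forall b, psi b u (z + h) = psi b u z * cpow (1 - e) (- b)].
Proof.
move=> sz; have [d d0 dP] := segment_cmod_ge sz.
have A0 := carg_slit_lt sz; set A := `|carg (1 - z)| in A0.
(* With |e| < q the point 1 - e stays in the right half-plane and its argument is at most 2 |e| <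
   (pi - A) / 2, so adding it to an argument of size at most A does not reach pi. *)
pose q := Num.min 2^-1 ((pi - A) / 4).
have q0 : 0 < q by rewrite lt_min invr_gt0 ltr0n divr_gt0// subr_gt0.
exists (Num.min 1 (d * q)); first by rewrite lt_min ltr01 mulr_gt0//= ge_min lexx.
exists (d^-1); first by rewrite invr_ge0 ltW.
move=> u h u01; have /andP[u0 u1] := u01; rewrite lt_min => /andP[_ hd] e.
have su := slit_segment u01 sz.
have ed : cmod e <= d^-1 * cmod h.
  rewrite /e cmod_div cmodM cmodr ger0_norm// mulrC ler_pM ?invr_ge0 ?mulr_ge0 ?cmod_ge0//.
    by rewrite lef_pV2 ?posrE ?dP// (lt_le_trans d0)// dP.
  by rewrite ler_piMl ?cmod_ge0.
have eq : cmod e < q by rewrite (le_lt_trans ed)// mulrC ltr_pdivrMr// mulrC.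
have [e1 e2] : cmod e < 2^-1 /\ cmod e < (pi - A) / 4 by move: eq; rewrite lt_min => /andP.
have Re1 : 2^-1 <= Re (1 - e).
  rewrite cReB/=; have := le_trans (ler_norm _) (norm_Re_le e); lra.
have Re0 : 0 < Re (1 - e) by rewrite (lt_le_trans _ Re1)// invr_gt0.
have arge : `|carg (1 - e)| <= 2 * cmod e.
  rewrite carg_Re_gt0// (le_trans (norm_atan_le _))// normrM normfV (gtr0_norm Re0).
  rewrite ler_pdivrMr//; have : `|Im (1 - e)| <= cmod e.
    by rewrite cImB sub0r normrN norm_Im_le.
  have := cmod_ge0 e; nra.
have args : `|carg (1 - u%:C * z) + carg (1 - e)| < pi.
  rewrite (le_lt_trans (ler_normD _ _))//.
  by have := carg_segment_le u01 sz; rewrite -/A; have := cmod_ge0 e; lra.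
have fact : 1 - u%:C * (z + h) = (1 - u%:C * z) * (1 - e).
  rewrite /e; field; exact: slit_neq0.
split=> //; first exact: ltW.
  by rewrite fact; apply: slitM => //; exact: slit_Re.
by move=> b; rewrite /psi fact cpowM//; exact: slit_Re.
Qed.

(** The remainder estimate of the binomial series with two terms, 1 + b e. *)
Lemma cpow1B_expand b : exists2 c : R, 0 <= c & forall e, cmod e <= 2^-1 ->
  cmod (cpow (1 - e) (- b) - 1 - b * e) <= c * cmod e ^+ 2.
Proof.
have [c c0 cP] := @bin_sum_rem R b 2^-1 ltac:(lra).
exists (c * (cmod (poch b 2) / 1`!%:R)); first by rewrite !mulr_ge0 ?cmod_ge0.
move=> e e2; have := cP 1%N e e2.
have -> : bin_sum b e 2 = 1 + b * e.
  rewrite /bin_sum !big_ord_recl big_ord0 /= /bump/= !addn0 (pochS b 0) poch0 expr0 expr1.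
  by rewrite [1`!]factS fact0 muln1 !addr0 !divr1; ring.
by rewrite cmodBC opprD addrA.
Qed.

(** The constants do not depend on u, which is what allows these local estimates to be integrated
    over the Euler variable. *)
Lemma psi_expand b z : slit (1 - z) -> exists2 d : R, 0 < d <= 1 &
  exists2 C : R, 0 <= C & forall u h, 0 <= u <= 1 -> cmod h < d ->
    [/\ cmod (psi b u z) <= C, cmod (psi b u (z + h)) <= C,
        cmod (psi b u (z + h) - psi b u z) <= C * cmod h &
        cmod (psi b u (z + h) - psi b u z - h * dpsi b u z) <= C * cmod h ^+ 2].
Proof.
move=> sz; have [d d01 [C C0 dP]] := psi_split sz.
have [M M0 MP] := psi_le b sz; have [c c0 cP] := cpow1B_expand b.
pose C1 := M * (c * C ^+ 2) + M * cmod b * C + M.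
have t1 : 0 <= M * (c * C ^+ 2) by rewrite !mulr_ge0// sqr_ge0.
have t2 : 0 <= M * cmod b * C by rewrite !mulr_ge0 ?cmod_ge0.
exists d => //; exists C1; first by rewrite /C1; lra.
move=> u h u01 hd; have [e1 e2 sl spl] := dP u h u01 hd; set e := _ / _ in e1 e2 spl.
have su := slit_segment u01 sz; have z0 := slit_neq0 su.
have h0 := cmod_ge0 h; have h1 : cmod h <= 1 by have /andP[_ ?] := d01; lra.
have dE : h * dpsi b u z = psi b u z * (b * e).
  rewrite /dpsi /psi /e !cpowE// opprD mulrDl mulN1r cexpD [cexp (- clog _)]cexpN cexp_clog//.
  by field.
have R2 : cmod (psi b u (z + h) - psi b u z - h * dpsi b u z) <= M * (c * C ^+ 2) * cmod h ^+ 2.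
  rewrite dE spl (_ : _ - _ - _ = psi b u z * (cpow (1 - e) (- b) - 1 - b * e)); last by ring.
  rewrite cmodM -mulrA ler_pM ?cmod_ge0 ?MP// (le_trans (cP _ e1))//.
  by rewrite -mulrA -exprMn ler_wpM2l// lerXn2r ?nnegrE ?cmod_ge0// mulr_ge0.
have R1 : cmod (psi b u (z + h) - psi b u z) <= (M * (c * C ^+ 2) + M * cmod b * C) * cmod h.
  have := cmodD (psi b u (z + h) - psi b u z - h * dpsi b u z) (h * dpsi b u z).
  rewrite subrK => /le_trans; apply; rewrite mulrDl lerD//.
    rewrite (le_trans R2)// ler_wpM2l// expr2 ler_piMl//.
  rewrite dE (cmodM (psi b u z) (b * e)) (cmodM b e) -!mulrA.
  by rewrite ler_pM ?mulr_ge0 ?cmod_ge0 ?MP// ler_wpM2l ?cmod_ge0.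
split.
- by rewrite (le_trans (MP _ u01))// /C1; lra.
- have := cmodD (psi b u (z + h) - psi b u z) (psi b u z); rewrite subrK => /le_trans; apply.
  rewrite /C1 lerD ?MP// (le_trans R1)// ler_piMr//; lra.
- by rewrite (le_trans R1)// ler_wpM2r// /C1; lra.
- by rewrite (le_trans R2)// ler_wpM2r ?sqr_ge0// /C1; lra.
Qed.

Lemma slit1B_open z : slit (1 - z) -> exists2 d : R, 0 < d &
  forall h, cmod h < d -> slit (1 - (z + h)).
Proof.
move=> sz; have [d /andP[d0 _] [C _ dP]] := psi_split sz; exists d => // h hd.
have h01 : 0 <= (1 : R) <= 1 by rewrite ler01 lexx.
by have [_ _ + _] := dP 1 h h01 hd; rewrite mul1r.
Qed.

End SlitPlanePerturbation.

(** * Complex integration against a beta weight *)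

Section BetaIntegral.
Variables (R : realType) (B : R).
Hypothesis (B0 : 0 < B).
Local Notation mu := (@lebesgue_measure R).
Local Notation D := (`[0%R, +oo[%classic : set R).
Implicit Types (f g : R -> R[i]) (s : R).

(* With u = 1 / (1 + s^2), the measure bweight s ds on [0, +oo[ is, up to a factor 2, the
   Euler beta weight u^(B - 1/2) (1 - u)^(-1/2) du on ]0, 1[. *)
Definition bvar s : R := (1 + s ^+ 2) `^ (- 1).
Definition bweight s : R := (1 + s ^+ 2) `^ (- (B + 1)).
Definition bmass : R := Num.sqrt pi / 2 * Gamma (B + 2^-1) / Gamma (B + 1).

Lemma bvar01 s : 0 <= bvar s <= 1.
Proof.
rewrite /bvar powR_ge0/= powR_inv1 ?(ltW (oneDsqr_gt0' s))// invf_le1 ?oneDsqr_gt0'//.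
by rewrite lerDl sqr_ge0.
Qed.

Lemma bweight_ge0 s : 0 <= bweight s. Proof. exact: powR_ge0. Qed.

Lemma bmass_gt0 : 0 < bmass.
Proof.
by rewrite divr_gt0 ?mulr_gt0 ?Gamma_gt0 ?invr_gt0 ?sqrtr_gt0 ?pi_gt0 ?addr_gt0.
Qed.

Lemma measurable_bvar (A : set R) : measurable_fun A bvar.
Proof. exact: measurable_oneDsqr_powR. Qed.

Lemma integrable_bweight : mu.-integrable D (EFin \o bweight).
Proof.
apply/integrableP; split; first by apply/measurable_EFinP; exact: measurable_oneDsqr_powR.
under eq_integral do rewrite /= ger0_norm ?bweight_ge0//.
by rewrite integral_oneDsqr_powR// ltry.
Qed.

Lemma Rintegral_bweight : \int[mu]_(s in D) bweight s = bmass.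
Proof. by rewrite /Rintegral integral_oneDsqr_powR. Qed.

(** The m-th moment is the same integral with B replaced by B + m. The Gamma recursion turns the
    quotient into (1/2 + B)_m / (1 + B)_m, the coupled coefficients of F_D. *)
Lemma Rintegral_bweight_bvarX (m : nat) :
  \int[mu]_(s in D) (bweight s * bvar s ^+ m) =
  bmass * (\prod_(k < m) (2^-1 + B + k%:R) / \prod_(k < m) (1 + B + k%:R)).
Proof.
have Bm : 0 < B + m%:R by rewrite ltr_wpDr.
have -> : \int[mu]_(s in D) (bweight s * bvar s ^+ m) =
    \int[mu]_(s in D) ((1 + s ^+ 2) `^ (- (B + m%:R + 1))).
  apply: eq_Rintegral => s _; have s0 := oneDsqr_gt0' s.
  rewrite /bweight /bvar -[(_ `^ _) ^+ m]powR_mulrn ?powR_ge0// -powRrM -powRD; last by rewrite (gt_eqF s0) implybT.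
  by congr (_ `^ _); ring.
rewrite /Rintegral integral_oneDsqr_powR//=.
have -> : B + m%:R + 2^-1 = (2^-1 + B) + m%:R by ring.
have -> : B + m%:R + 1 = (1 + B) + m%:R by ring.
rewrite !Gamma_prod ?addr_gt0// /bmass (addrC B 2^-1) (addrC B 1); field.
have p0 : 0 < \prod_(k < m) (1 + B + k%:R).
  by apply: prodr_gt0 => k _; rewrite ltr_wpDr// addr_gt0.
by rewrite !gt_eqF ?Gamma_gt0 ?addr_gt0.
Qed.

(** Measurable with bounded modulus on the half-line: a class closed under sums and products and
    integrable against the finite beta weight, so integrability is settled by structure alone. *)
Definition bmeas f := [/\ measurable_fun D (fun s => Re (f s)),
  measurable_fun D (fun s => Im (f s)) &
  exists M, forall s, D s -> cmod (f s) <= M].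

Lemma bmeas_cst (c : R[i]) : bmeas (fun=> c).
Proof. by split=> //; exists (cmod c). Qed.

Lemma bmeasD f g : bmeas f -> bmeas g -> bmeas (fun s => f s + g s).
Proof.
move=> [f1 f2 [M fM]] [g1 g2 [N gN]]; split.
- by apply: eq_measurable_fun (measurable_funD f1 g1) => s _; rewrite cReD.
- by apply: eq_measurable_fun (measurable_funD f2 g2) => s _; rewrite cImD.
- by exists (M + N) => s Ds; rewrite (le_trans (cmodD _ _))// lerD ?fM ?gN.
Qed.

Lemma bmeasM f g : bmeas f -> bmeas g -> bmeas (fun s => f s * g s).
Proof.
move=> [f1 f2 [M fM]] [g1 g2 [N gN]]; split.
- have := measurable_funB (measurable_funM f1 g1) (measurable_funM f2 g2).
  by apply: eq_measurable_fun => s _; rewrite cReM.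
- have := measurable_funD (measurable_funM f1 g2) (measurable_funM f2 g1).
  by apply: eq_measurable_fun => s _; rewrite cImM.
- by exists (M * N) => s Ds; rewrite cmodM ler_pM ?cmod_ge0 ?fM ?gN.
Qed.

Lemma eq_bmeas f g : f =1 g -> bmeas f -> bmeas g.
Proof. by move=> /funext ->. Qed.

Lemma bmeasB f g : bmeas f -> bmeas g -> bmeas (fun s => f s - g s).
Proof.
move=> bf bg; apply: eq_bmeas (bmeasD bf (bmeasM (bmeas_cst (- 1)) bg)) => s.
by rewrite mulN1r.
Qed.

Lemma bmeas_prod (I : Type) (r : seq I) (P : pred I) (F : I -> R -> R[i]) :
  (forall i, bmeas (F i)) -> bmeas (fun s => \prod_(i <- r | P i) F i s).
Proof.
move=> bF; elim: r => [|i r IH].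
  by apply: eq_bmeas (bmeas_cst 1) => s; rewrite big_nil.
have [Pi|Pi] := boolP (P i).
  by apply: eq_bmeas (bmeasM (bF i) IH) => s; rewrite big_cons Pi.
by apply: eq_bmeas IH => s; rewrite big_cons (negPf Pi).
Qed.

Lemma bmeas_sum (I : Type) (r : seq I) (F : I -> R -> R[i]) :
  (forall i, bmeas (F i)) -> bmeas (fun s => \sum_(i <- r) F i s).
Proof.
move=> bF; elim: r => [|i r IH].
  by apply: eq_bmeas (bmeas_cst 0) => s; rewrite big_nil.
by apply: eq_bmeas (bmeasD (bF i) IH) => s; rewrite big_cons.
Qed.

Lemma bmeas_bvar : bmeas (fun s => (bvar s)%:C).
Proof.
split=> /=; [exact: measurable_bvar|exact: measurable_cst|].
by exists 1 => s _; have /andP[? ?] := bvar01 s; rewrite cmodr ger0_norm.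
Qed.

Lemma bmeasX f (m : nat) : bmeas f -> bmeas (fun s => f s ^+ m).
Proof.
move=> bf; elim: m => [|m IH]; first exact: eq_bmeas (bmeas_cst 1).
by apply: eq_bmeas (bmeasM bf IH) => s; rewrite exprS.
Qed.

Lemma bmeas_bin_sum (b z : R[i]) N : bmeas (fun s => bin_sum b ((bvar s)%:C * z) N).
Proof.
apply: bmeas_sum => i; apply: bmeasM; first exact: bmeas_cst.
apply: bmeasM; last exact: bmeas_cst.
by apply: bmeasX; apply: bmeasM; [exact: bmeas_bvar|exact: bmeas_cst].
Qed.

(** The half-angle formula expresses the logarithm by real functions without cases. Root and inverse
    are written as [powR], so that measurability of powers covers them. *)
Lemma bmeas_psi (b z : R[i]) : slit (1 - z) -> bmeas (fun s => psi b (bvar s) z).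
Proof.
move=> sz.
pose x s := 1 - bvar s * Re z; pose y s := - (bvar s * Im z).
pose r s := (x s ^+ 2 + y s ^+ 2) `^ 2^-1.
pose A s := 2 * atan (y s * (r s + x s) `^ (- 1)).
have mx : measurable_fun D x.
  by apply: measurable_funB => //; apply: measurable_funM => //; exact: measurable_bvar.
have my : measurable_fun D y.
  by apply: measurable_funN => //; apply: measurable_funM => //; exact: measurable_bvar.
have mr : measurable_fun D r.
  apply: (measurableT_comp (measurable_powR _)).
  by apply: measurable_funD; exact: measurable_funX.
have mA : measurable_fun D A.
  apply: measurable_funM => //; apply: measurableT_comp.
    by apply: continuous_measurable_fun; exact: continuous_atan.
  apply: measurable_funM => //; apply: (measurableT_comp (measurable_powR _)).
  exact: measurable_funD.
have rE s : r s = cmod (1 - (bvar s)%:C * z).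
  rewrite /cmod cReB cImB cReZ cImZ/= sub0r -/(x s) -/(y s) /r powR12_sqrt//.
  by rewrite addr_ge0 ?sqr_ge0.
have lE s : clog (1 - (bvar s)%:C * z) = (ln (r s)) +i* A s.
  have ss := slit_segment (bvar01 s) sz.
  rewrite clogE -rE carg_slit// -rE cReB cImB cReZ cImZ/= sub0r -/(x s) -/(y s) /A.
  by rewrite powR_inv1//; have := slit_gt0 ss; rewrite -rE cReB cReZ/= => /ltW.
have ml : measurable_fun D (fun s => ln (r s)) by exact: measurableT_comp.
pose p s := Re (- b) * ln (r s) - Im (- b) * A s.
pose t s := Re (- b) * A s + Im (- b) * ln (r s).
have mp : measurable_fun D p by apply: measurable_funB; exact: measurable_funM.
have mt : measurable_fun D t by apply: measurable_funD; exact: measurable_funM.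
have pE s : psi b (bvar s) z = (expR (p s) * cos (t s)) +i* (expR (p s) * sin (t s)).
  rewrite /psi cpowE; last by rewrite slit_neq0// slit_segment// bvar01.
  by rewrite cexpE lE cReM cImM.
split.
- apply: (eq_measurable_fun (fun s => expR (p s) * cos (t s))) => [s _|]; first by rewrite pE.
  apply: measurable_funM; first exact: measurableT_comp.
  by apply: measurableT_comp => //; apply: continuous_measurable_fun; exact: continuous_cos.
- apply: (eq_measurable_fun (fun s => expR (p s) * sin (t s))) => [s _|]; first by rewrite pE.
  apply: measurable_funM; first exact: measurableT_comp.
  by apply: measurableT_comp => //; apply: continuous_measurable_fun; exact: continuous_sin.
- by have [M _ MP] := psi_le b sz; exists M => s _; apply: MP; exact: bvar01.
Qed.

Lemma bmeas_dpsi (b z : R[i]) : slit (1 - z) -> bmeas (fun s => dpsi b (bvar s) z).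
Proof.
move=> sz; apply: bmeasM; last exact: bmeas_psi.
by apply: bmeasM; [exact: bmeas_cst|exact: bmeas_bvar].
Qed.

Definition cint f : R[i] :=
  (\int[mu]_(s in D) (bweight s * Re (f s))) +i* (\int[mu]_(s in D) (bweight s * Im (f s))).

Lemma bmeas_integrable f : bmeas f ->
  mu.-integrable D (EFin \o (fun s => bweight s * Re (f s))) /\
  mu.-integrable D (EFin \o (fun s => bweight s * Im (f s))).
Proof.
move=> [f1 f2 [M fM]]; split.
  apply: (@integrable_mul_bounded _ _ R mu D (measurable_itv _) _ _ M integrable_bweight f1).
  by move=> s Ds; rewrite (le_trans (norm_Re_le _))// fM.
apply: (@integrable_mul_bounded _ _ R mu D (measurable_itv _) _ _ M integrable_bweight f2).
by move=> s Ds; rewrite (le_trans (norm_Im_le _))// fM.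
Qed.

Lemma cintD f g : bmeas f -> bmeas g -> cint (fun s => f s + g s) = cint f + cint g.
Proof.
move=> /bmeas_integrable[f1 f2] /bmeas_integrable[g1 g2]; apply: complex_ext.
  rewrite cReD/= -RintegralD//; apply: eq_Rintegral => s _; rewrite cReD; ring.
rewrite cImD/= -RintegralD//; apply: eq_Rintegral => s _; rewrite cImD; ring.
Qed.

Lemma cintZ (k : R[i]) f : bmeas f -> cint (fun s => k * f s) = k * cint f.
Proof.
move=> /bmeas_integrable[f1 f2]; apply: complex_ext.
  rewrite cReM/= -!RintegralZl// -RintegralB//; try exact: integrableZl_real.
  by apply: eq_Rintegral => s _; rewrite cReM; ring.
rewrite cImM/= -!RintegralZl// -RintegralD//; try exact: integrableZl_real.
by apply: eq_Rintegral => s _; rewrite cImM; ring.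
Qed.

Lemma cintB f g : bmeas f -> bmeas g -> cint (fun s => f s - g s) = cint f - cint g.
Proof.
move=> bf bg; have -> : (fun s => f s - g s) = (fun s => f s + (- 1) * g s).
  by apply/funext => s; rewrite mulN1r.
by rewrite cintD ?cintZ ?mulN1r//; apply: bmeasM => //; exact: bmeas_cst.
Qed.

Lemma cint_sum (I : Type) (r : seq I) (F : I -> R -> R[i]) :
  (forall i, bmeas (F i)) ->
  cint (fun s => \sum_(i <- r) F i s) = \sum_(i <- r) cint (F i).
Proof.
move=> bF; elim: r => [|i r IH].
  rewrite big_nil; have -> : (fun s => \sum_(i <- [::]) F i s) = (fun=> 0).
    by apply/funext => s; rewrite big_nil.
  have := cintD (bmeas_cst 0) (bmeas_cst 0).
  by under eq_fun do rewrite addr0; move=> /eqP; rewrite -subr_eq0 opprD addNKr oppr_eq0 => /eqP.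
rewrite big_cons -IH -cintD//; last exact: bmeas_sum.
by congr cint; apply/funext => s; rewrite big_cons.
Qed.

(** Bounding the two components separately costs the factor 2, harmless for continuity and
    differentiability. *)
Lemma cint_le f (M : R) : bmeas f -> (forall s, D s -> cmod (f s) <= M) ->
  cmod (cint f) <= 2 * (bmass * M).
Proof.
move=> bf fM; have [i1 i2] := bmeas_integrable bf.
have h (q : R -> R) : mu.-integrable D (EFin \o (fun s => bweight s * q s)) ->
    (forall s, D s -> `|q s| <= M) -> `|\int[mu]_(s in D) (bweight s * q s)| <= bmass * M.
  move=> qi qM; rewrite (le_trans (le_normr_Rintegral _ qi))//.
  rewrite -Rintegral_bweight -RintegralZr//; last exact: integrable_bweight.
  apply: le_Rintegral => //.
  - exact: integrable_norm.
  - have /= := @integrableZl_real _ _ R mu D (measurable_itv _) _ M integrable_bweight.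
    by apply: eq_integrable => // s _; rewrite /= mulrC.
  - by move=> s Ds; rewrite normrM (ger0_norm (bweight_ge0 s)) ler_wpM2l ?bweight_ge0 ?qM.
rewrite (le_trans (cmod_leD _))// mulr_natl mulr2n lerD//.
  by apply: h => // s Ds; rewrite (le_trans (norm_Re_le _))// fM.
by apply: h => // s Ds; rewrite (le_trans (norm_Im_le _))// fM.
Qed.

Lemma cint_cvg (f_ : nat -> R -> R[i]) f (M : R) : (forall N, bmeas (f_ N)) ->
  (forall s, D s -> cvgC (f_ ^~ s) (f s)) -> (forall N s, D s -> cmod (f_ N s) <= M) ->
  ccvg (fun N => cint (f_ N)) (cint f).
Proof.
move=> bf_ ff fM.
have iM : mu.-integrable D (EFin \o (fun s => M * bweight s)).
  by apply: integrableZl_real => //; exact: integrable_bweight.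
have h (P : R[i] -> R) : (forall N, measurable_fun D (fun s => bweight s * P (f_ N s))) ->
    (forall u l, ccvg u l -> P (u N) @[N --> \oo] --> P l) -> (forall z, `|P z| <= cmod z) ->
    \int[mu]_(s in D) (bweight s * P (f_ N s)) @[N --> \oo] --> \int[mu]_(s in D) (bweight s * P (f s)).
  move=> mP Pc Pn.
  have [||//] := @Rintegral_dominated_cvg _ _ R mu D (fun N s => bweight s * P (f_ N s))
    (fun s => bweight s * P (f s)) (fun s => M * bweight s) (measurable_itv _) mP _ iM.
  - by move=> s Ds; apply: cvgMl_tmp; apply: Pc; apply: cvgC_ccvg; exact: ff.
  - move=> N s Ds; rewrite normrM (ger0_norm (bweight_ge0 s)) mulrC ler_wpM2r ?bweight_ge0//.
    by rewrite (le_trans (Pn _))// fM.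
split.
  apply: (h (@complex.Re R)) => [N|u l []//|z]; last exact: norm_Re_le.
  exact: measurable_integrable (bmeas_integrable (bf_ N)).1.
apply: (h (@complex.Im R)) => [N|u l []//|z]; last exact: norm_Im_le.
exact: measurable_integrable (bmeas_integrable (bf_ N)).2.
Qed.

End BetaIntegral.

(** * The Euler integral as a holomorphic extension *)

Section FDIntegral.
Variables (R : realType) (n : nat) (b : 'I_n -> R[i]) (B : R).
Hypothesis (B0 : 0 < B).
Local Notation mu := (@lebesgue_measure R).
Local Notation D := (`[0%R, +oo[%classic : set R).
Local Notation mass := (bmass B).
Local Notation integrand x := (fun s => \prod_(i < n) psi (b i) (bvar s) (x i)).
Implicit Types (x y : 'I_n -> R[i]).

(** Dividing by the total mass makes the value at x = 0 equal to 1, the constant term of the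
    series. *)
Definition FD_int x : R[i] := (mass^-1)%:C * cint B (integrand x).

Lemma mass_neq0 : mass%:C != 0 :> R[i].
Proof. by rewrite real_complex_eq0 gt_eqF// bmass_gt0. Qed.

Lemma FD_domain_slit x : FD_domain x <-> forall i, slit (1 - x i).
Proof. by split=> h i; [apply/slit1B; exact: h|apply/slit1B; exact: h]. Qed.

Lemma bmeas_integrand x : (forall i, slit (1 - x i)) -> bmeas (integrand x).
Proof. by move=> sx; apply: bmeas_prod => i; exact: bmeas_psi. Qed.

Lemma cint_bvarX (m : nat) : cint B (fun s => (bvar s ^+ m)%:C) =
  (mass * (\prod_(k < m) (2^-1 + B + k%:R) / \prod_(k < m) (1 + B + k%:R)))%:C.
Proof.
apply: complex_ext => /=; first exact: Rintegral_bweight_bvarX.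
under eq_Rintegral do rewrite mulr0; by rewrite /Rintegral integral0.
Qed.

(** Exact for each N: expanding the product of binomial partial sums over the box leaves powers
    u^|m|, whose normalised moments supply the coefficients. *)
Lemma FD_box x N :
  box_partial (FD_term (2^-1 + B)%:C b (1 + B)%:C x) N =
  (mass^-1)%:C * cint B (fun s => \prod_i bin_sum (b i) ((bvar s)%:C * x i) N).
Proof.
pose z (m : 'I_n -> nat) := \prod_i (poch (b i) (m i) * (x i ^+ m i / (m i)`!%:R)).
have -> : (fun s => \prod_i bin_sum (b i) ((bvar s)%:C * x i) N) =
   (fun s => \sum_(m : {ffun 'I_n -> 'I_N}) z (fun i => m i : nat) * (bvar s ^+ (\sum_i m i))%:C).
  apply/funext => s; rewrite /bin_sum -(box_prod (fun i k =>
    poch (b i) k * (((bvar s)%:C * x i) ^+ k / k`!%:R)) N).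
  apply: eq_bigr => m _; rewrite /z -prodrXr rmorph_prod -big_split/=.
  by apply: eq_bigr => i _; rewrite exprMn rmorphXn/=; ring.
have bb m : bmeas (fun s => (bvar s ^+ m)%:C : R[i]).
  by apply: eq_bmeas (bmeasX m (@bmeas_bvar R)) => s; rewrite rmorphXn.
rewrite cint_sum//; last by move=> m; apply: bmeasM => //; exact: bmeas_cst.
rewrite mulr_sumr /box_partial; apply: eq_bigr => m _.
rewrite cintZ// cint_bvarX /FD_term !poch_real.
have -> : z (fun i => m i : nat) =
    \prod_i poch (b i) (m i) * \prod_i (x i ^+ m i / (m i)`!%:R) by rewrite /z big_split.
have c0 : (\prod_(k < \sum_i m i) (1 + B + k%:R))%:C != 0 :> R[i].
  rewrite real_complex_eq0 gt_eqF//; apply: prodr_gt0 => k _.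
  by rewrite ltr_wpDr// addr_gt0.
move: (bmass B) mass_neq0 (\prod_i poch _ _) (\prod_i (_ / _)) => M M0 p q.
move: (\prod_(k < _) (2^-1 + _ + _)) (\prod_(k < _) _) c0 => u v c0.
by rewrite !real_complexM !real_complexV; field; rewrite M0 c0.
Qed.

Lemma FD_int_series x : (forall i, cmod (x i) < 1) ->
  ccvg (box_partial (FD_term (2^-1 + B)%:C b (1 + B)%:C x)) (FD_int x).
Proof.
move=> x1.
have sx s i : cmod ((bvar s)%:C * x i) <= cmod (x i).
  have /andP[u0 u1] := bvar01 s.
  by rewrite cmodM cmodr ger0_norm// ler_piMl ?cmod_ge0.
have /choice[c cP] : forall i, exists c, 0 <= c /\
    forall N z, cmod z <= cmod (x i) -> cmod (bin_sum (b i) z N) <= c.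
  move=> i; have [|c c0 cP] := @bin_sum_le R (b i) (cmod (x i)); last by exists c.
  by rewrite cmod_ge0 x1.
have -> : box_partial (FD_term (2^-1 + B)%:C b (1 + B)%:C x) = (fun N =>
    (mass^-1)%:C * cint B (fun s => \prod_i bin_sum (b i) ((bvar s)%:C * x i) N)).
  by apply/funext => N; exact: FD_box.
apply: ccvgZ; apply: (@cint_cvg R B B0 _ _ (\prod_i c i)).
- by move=> N; apply: bmeas_prod => i; exact: bmeas_bin_sum.
- move=> s _; apply: cvgC_prod => i; apply: bin_sum_cvg.
  exact: le_lt_trans (sx s i) (x1 i).
- move=> N s _; rewrite cmod_prod; apply: ler_prod => i _.
  by rewrite cmod_ge0/=; apply: (cP i).2; exact: sx.
Qed.

(** Telescoping: the factors are exchanged one at a time, each exchange costing e times a product of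
    the others. *)
Lemma prod_dist_le (I : Type) (r : seq I) (p q : I -> R[i]) (C e : R) : 1 <= C -> 0 <= e ->
  (forall i, cmod (p i) <= C) -> (forall i, cmod (q i) <= C) ->
  (forall i, cmod (p i - q i) <= e) ->
  cmod (\prod_(i <- r) p i - \prod_(i <- r) q i) <= (size r)%:R * C ^+ size r * e.
Proof.
move=> C1 e0 pC qC pq; have C0 : 0 <= C by lra.
elim: r => [|i r IH]; first by rewrite !big_nil subrr cmod0 !mul0r.
rewrite !big_cons /=.
rewrite (_ : _ - _ = (p i - q i) * \prod_(j <- r) p j +
   q i * (\prod_(j <- r) p j - \prod_(j <- r) q j)); last by ring.
have h1 : cmod (\prod_(j <- r) p j) <= C ^+ size r.
  rewrite cmod_prod; elim: (r) => [|j s IHs]; first by rewrite big_nil.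
  by rewrite big_cons /= exprS ler_pM ?cmod_ge0// prodr_ge0// => k _; exact: cmod_ge0.
rewrite (le_trans (cmodD _ _))// !cmodM -natr1 exprS.
rewrite (_ : _ * _ * e = C * ((size r)%:R * C ^+ size r * e) + e * (C * C ^+ size r)); last by ring.
by rewrite addrC lerD// ler_pM ?cmod_ge0// (le_trans h1)// ler_peMl// exprn_ge0.
Qed.

Lemma fin_lower_bound (d : 'I_n -> R) : (forall i, 0 < d i) ->
  exists2 e : R, 0 < e & forall i, e <= d i.
Proof.
move=> d0; have s0 : 0 < 1 + \sum_i (d i)^-1.
  by rewrite ltr_pwDl// sumr_ge0// => i _; rewrite invr_ge0 ltW.
(* The inverse of a sum of inverses lies below every d_i, and the 1 keeps it defined when n = 0. *)
exists (1 + \sum_i (d i)^-1)^-1; first by rewrite invr_gt0.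
move=> i; rewrite -[leRHS]invrK lef_pV2 ?posrE ?invr_gt0//.
rewrite (bigD1 i)//= addrCA lerDl addr_ge0// sumr_ge0// => j _.
by rewrite invr_ge0 ltW.
Qed.

Lemma FD_int_continuous x : (forall i, slit (1 - x i)) -> forall e : R, 0 < e ->
  exists2 d : R, 0 < d & forall y, (forall i, slit (1 - y i)) ->
    (forall i, cmod (y i - x i) < d) -> cmod (FD_int y - FD_int x) < e.
Proof.
move=> sx e e0.
have /choice[dC dCP] : forall i, exists dC : R * R, [/\ 0 < dC.1, 0 <= dC.2 &
    forall u h, 0 <= u <= 1 -> cmod h < dC.1 ->
    [/\ cmod (psi (b i) u (x i)) <= dC.2, cmod (psi (b i) u (x i + h)) <= dC.2 &
        cmod (psi (b i) u (x i + h) - psi (b i) u (x i)) <= dC.2 * cmod h]].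
  move=> i; have [d /andP[d0 _] [C C0 P]] := psi_expand (b i) (sx i).
  by exists (d, C); split=> // u h u01 hd; have [? ? ? _] := P u h u01 hd.
have /fin_lower_bound[d d0 dP] : forall i, 0 < (dC i).1 by move=> i; case: (dCP i).
pose C := 1 + \sum_i (dC i).2.
have CP i : (dC i).2 <= C.
  rewrite /C (bigD1 i)//= addrCA lerDl addr_ge0// sumr_ge0// => j _.
  by have [_ ? _] := dCP j.
have C1 : 1 <= C by rewrite lerDl sumr_ge0// => j _; have [_ ? _] := dCP j.
pose M := 2 * (n%:R * C ^+ n * C).
have M0 : 0 <= M by rewrite !mulr_ge0 ?exprn_ge0//; lra.
have M1 : 0 < M + 1 by lra.
exists (Num.min d (e / (M + 1))); first by rewrite lt_min d0 divr_gt0.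
move=> y sy xy; pose r := e / (M + 1).
have r0 : 0 < r by rewrite divr_gt0.
have yxd i : cmod (y i - x i) < d by have := xy i; rewrite lt_min => /andP[].
have yxr i : cmod (y i - x i) < r by have := xy i; rewrite lt_min => /andP[].
have bx := bmeas_integrand sx; have by_ := bmeas_integrand sy.
rewrite /FD_int -mulrBr -cintB// cmodM cmodr gtr0_norm ?invr_gt0 ?bmass_gt0//.
have h s : D s -> cmod (\prod_i psi (b i) (bvar s) (y i) - \prod_i psi (b i) (bvar s) (x i)) <=
    n%:R * C ^+ n * (C * r).
  move=> _; have u01 := bvar01 s.
  have szn : size (index_enum 'I_n) = n by rewrite -sum1_size sum1_card card_ord.
  have C0 : 0 <= C by lra.
  rewrite -[X in X%:R * _ ^+ X]szn; apply: prod_dist_le => //.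
  - by rewrite mulr_ge0 ?(ltW r0).
  - move=> i; have [_ _ P] := dCP i.
    have [_ + _] := P (bvar s) (y i - x i) u01 (lt_le_trans (yxd i) (dP i)).
    by rewrite addrC subrK => /le_trans; apply.
  - move=> i; have [_ _ P] := dCP i.
    have [+ _ _] := P (bvar s) (y i - x i) u01 (lt_le_trans (yxd i) (dP i)).
    by move=> /le_trans; apply.
  - move=> i; have [_ c0 P] := dCP i.
    have [_ _ +] := P (bvar s) (y i - x i) u01 (lt_le_trans (yxd i) (dP i)).
    rewrite [x i + _]addrC subrK => /le_trans; apply.
    by rewrite ler_pM ?cmod_ge0 ?(ltW (yxr i)).
have hb := cint_le B0 (bmeasB by_ bx) h.
have m0 := bmass_gt0 B0.
rewrite mulrC ltr_pdivrMr// (le_lt_trans hb)//.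
rewrite (_ : 2 * _ = (M * r) * mass); last by rewrite /M; ring.
rewrite ltr_pM2r// /r mulrCA gtr_pMr// ltr_pdivrMr//; lra.
Qed.

(** Differentiation under the integral sign. Only the i-th factor changes, its Taylor remainder is
    quadratic in h uniformly in s, and the other factors are bounded. *)
Lemma FD_int_derivable x (i : 'I_n) : (forall i, slit (1 - x i)) ->
  exists dv : R[i], forall e : R, 0 < e -> exists2 d : R, 0 < d &
    forall h : R[i], h != 0 -> cmod h < d ->
      cmod ((FD_int (upd x i h) - FD_int x) / h - dv) < e.
Proof.
move=> sx; pose rest s := \prod_(j < n | j != i) psi (b j) (bvar s) (x j).
have br : bmeas rest by apply: bmeas_prod => j; exact: bmeas_psi.
have [_ _ [M0 M0P]] := br; pose M := `|M0|.
have MP s : D s -> cmod (rest s) <= M.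
  by move=> Ds; rewrite (le_trans (M0P s Ds))// ler_norm.
have [d /andP[d0 _] [C C0 dP]] := psi_expand (b i) (sx i).
have [d' d'0 d'P] := slit1B_open (sx i).
exists ((mass^-1)%:C * cint B (fun s => dpsi (b i) (bvar s) (x i) * rest s)) => e e0.
have CM0 : 0 <= 2 * (C * M) by rewrite !mulr_ge0// /M normr_ge0.
have CM1 : 0 < 2 * (C * M) + 1 by lra.
exists (Num.min (Num.min d d') (e / (2 * (C * M) + 1))).
  by rewrite !lt_min d0 d'0 divr_gt0.
move=> h h0; rewrite !lt_min => /andP[/andP[hd hd'] he].
have hu : slit (1 - (x i + h)) by exact: d'P.
have updE s : \prod_j psi (b j) (bvar s) (upd x i h j) = psi (b i) (bvar s) (x i + h) * rest s.
  rewrite (bigD1 i)//= /upd eqxx; congr (_ * _); apply: eq_bigr => j ji.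
  by rewrite (negPf ji).
have xE s : \prod_j psi (b j) (bvar s) (x j) = psi (b i) (bvar s) (x i) * rest s.
  by rewrite (bigD1 i).
have b1 : bmeas (fun s => psi (b i) (bvar s) (x i + h) * rest s).
  by apply: bmeasM => //; exact: bmeas_psi.
have b2 : bmeas (fun s => psi (b i) (bvar s) (x i) * rest s).
  by apply: bmeasM => //; exact: bmeas_psi.
have b3 : bmeas (fun s => dpsi (b i) (bvar s) (x i) * rest s).
  by apply: bmeasM => //; exact: bmeas_dpsi.
have b4 : bmeas (fun s => h * (dpsi (b i) (bvar s) (x i) * rest s)).
  by apply: bmeasM => //; exact: bmeas_cst.
rewrite /FD_int (funext updE) (funext xE).
set I1 := cint B _; set I2 := cint B _; set I3 := cint B _.
have m0 := bmass_gt0 B0.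
have quotE (k u v w : R[i]) : (k * u - k * v) / h - k * w = k * h^-1 * (u - v - h * w).
  by field.
rewrite quotE.
have hb : cmod (I1 - I2 - h * I3) <= 2 * (mass * (C * cmod h ^+ 2 * M)).
  rewrite /I1 /I2 /I3 -(cintB B0 b1 b2) -(cintZ B0 h b3) -(cintB B0 (bmeasB b1 b2) b4).
  apply: (cint_le B0 (bmeasB (bmeasB b1 b2) b4)) => s Ds.
  have [_ _ _ P] := dP (bvar s) h (bvar01 s) hd.
  rewrite (_ : _ - _ - _ = (psi (b i) (bvar s) (x i + h) - psi (b i) (bvar s) (x i) -
     h * dpsi (b i) (bvar s) (x i)) * rest s); last by ring.
  by rewrite (cmodM (_ - _) (rest s)) ler_pM ?cmod_ge0 ?MP.
have h1 : 0 < cmod h by rewrite cmod_gt0.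
rewrite (cmodM (_ * _) (_ - _)) (cmodM _ h^-1) cmodV cmodr gtr0_norm ?invr_gt0//.
apply: (@le_lt_trans _ _ (mass^-1 * (cmod h)^-1 * (2 * (mass * (C * cmod h ^+ 2 * M))))).
  by rewrite ler_wpM2l// mulr_ge0 ?invr_ge0 ?cmod_ge0 ?ltW.
have redE (m u k v : R) : m != 0 -> u != 0 ->
    m^-1 * u^-1 * (2 * (m * (k * u ^+ 2 * v))) = 2 * (k * v) * u.
  by move=> *; field; apply/andP.
rewrite redE ?gt_eqF//.
move: he; rewrite ltr_pdivlMr// => he; nra.
Qed.

Lemma FD_int_continuation : FD_continuation (2^-1 + B)%:C b (1 + B)%:C FD_int.
Proof.
split; last exact: FD_int_series.
split=> x /FD_domain_slit sx.
  move=> e e0; have [d d0 dP] := FD_int_continuous sx e0.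
  by exists d => // y /FD_domain_slit sy; exact: dP.
by move=> i; exact: FD_int_derivable.
Qed.

End FDIntegral.

(** * Mean of the Gaussian Q-function *)

Section GaussianQMean.
Variables (R : realType) (n : nat) (a b : 'I_n -> R[i]).
Local Notation mu := (@lebesgue_measure R).
Local Notation D := (`[0%R, +oo[%classic : set R).
Local Notation B := (Re (\sum_(i < n) b i)).
Local Notation K := (\prod_(i < n) cpow (a i) (b i)).
Local Notation mgf s := (\prod_(i < n) cpow (1 - s%:C / a i) (- b i)).
Hypotheses (a_gt0 : forall i, 0 < Re (a i)) (b_real : Im (\sum_(i < n) b i) = 0).
Hypothesis (B_gt0 : 0 < B).
Variable p : R.
Hypothesis p_gt0 : 0 < p.
Local Notation x := (fun i => - (2%:C * a i) / p%:C).
Local Notation rate s := (p * ((1 + s ^+ 2) / 2)).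
Local Notation kappa := ((pi^-1)%:C * K * ((2 / p) `^ B)%:C).
Local Notation integrand s := (\prod_(i < n) psi (b i) (bvar s) (x i)).

Lemma rate_gt0 s : 0 < rate s.
Proof. by rewrite mulr_gt0// divr_gt0// oneDsqr_gt0'. Qed.

Lemma expectation_Qfun d (T : measurableType d) (P : probability T R)
    (X : {RV P >-> R}) : (forall w, 0 <= X w) ->
  ('E_P[fun w => Qfun (Num.sqrt (p * X w))])%E =
  (\int[mu]_(s in D) ((pi^-1 * bvar s)%:E * 'M_P X (- rate s)))%E.
Proof.
move=> X0.
pose f (z : T * R) := pi^-1 * (bvar z.2 * expR (- (rate z.2 * X z.1))).
have mf : measurable_fun setT f.
  apply: measurable_funM => //; apply: measurable_funM.
    by apply: measurableT_comp => //; exact: measurable_bvar.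
  apply: measurableT_comp => //; apply: measurableT_comp => //.
  apply: measurable_funM; last exact: measurableT_comp.
  apply: measurable_funM => //; apply: measurable_funM => //.
  by apply: measurable_funD => //; exact: measurable_funX.
have f0 w s : [set: T] w -> D s -> 0 <= f (w, s).
  by move=> _ _; rewrite !mulr_ge0 ?invr_ge0 ?pi_ge0 ?expR_ge0// powR_ge0.
have tonelli := @tonelli_on _ _ _ _ R P mu _ _ f measurableT (measurable_itv _) mf f0.
rewrite unlock; transitivity (\int[P]_(w in setT) \int[mu]_(s in D) (f (w, s))%:E)%E.
  apply: eq_integral => w _.
  have pX : 0 <= p * X w by rewrite mulr_ge0// ltW.
  have craig := Qfun_craig (sqrtr_ge0 (p * X w)).
  have pi0 : pi != 0 :> R by rewrite gt_eqF// pi_gt0.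
  rewrite -[Qfun (Num.sqrt (p * X w))](mulKf pi0) EFinM -craig -ge0_integralZl_real//.
  - apply: eq_integral => s _; rewrite sqr_sqrtr// /f /bvar/=.
    by congr (_ * (_ * expR _))%:E; ring.
  - apply: measurable_funM; first exact: measurable_oneDsqr_powR.
    apply: measurable_funTS; apply: measurableT_comp => //; apply: measurableT_comp => //.
    by apply: measurable_funM => //; apply: measurable_funM => //; exact: measurable_funD.
  - by move=> s _; rewrite mulr_ge0 ?powR_ge0 ?expR_ge0.
  - by rewrite invr_ge0 pi_ge0.
rewrite tonelli; apply: eq_integral => s _.
rewrite /mmt_gen_fun unlock -ge0_integralZl//=.
- by apply: eq_integral => w _; rewrite -EFinM /f/=; rewrite [X w * _]mulrC mulNr; congr EFin; apply: mulrA.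
- by apply/measurable_EFinP; apply: measurableT_comp => //; exact: measurable_funM.
- by rewrite lee_fin mulr_ge0 ?invr_ge0 ?pi_ge0// powR_ge0.
Qed.

(** The transform is evaluated at l = p (1 + s^2) / 2, so 1 / l = (2 / p) u and -a_i / l = u x_i. As
    [mgf_factor] holds for all l > 0, the size of x_i is irrelevant. *)
Lemma mgf_rate s :
  (pi^-1 * bvar s)%:C * mgf (- rate s) = (bweight B s)%:C * (kappa * integrand s).
Proof.
have r0 := rate_gt0 s; have s0 := oneDsqr_gt0' s.
rewrite (mgf_factor a_gt0 b_real r0).
have p2 : 0 < 2 / p by rewrite divr_gt0.
have rV : (rate s)^-1 = 2 / p * bvar s.
  by rewrite /bvar powR_inv1 ?ltW//; field; rewrite !gt_eqF.
have -> : \prod_i cpow (1 - (- a i * ((rate s)^-1)%:C)) (- b i) = integrand s.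
  apply: eq_bigr => i _; rewrite /psi rV; congr (cpow (1 - _) _).
  rewrite !real_complexM real_complexV; ring.
have -> : rate s `^ (- B) = (2 / p) `^ B * (1 + s ^+ 2) `^ (- B).
  have e : (2 / p) `^ B * rate s `^ B = (1 + s ^+ 2) `^ B.
    by rewrite -powRM ?ltW//; congr (_ `^ _); field; rewrite gt_eqF.
  by rewrite !powRN -e invfM mulVKf// gt_eqF// powR_gt0.
have -> : bweight B s = bvar s * (1 + s ^+ 2) `^ (- B).
  rewrite /bweight /bvar -powRD; last by rewrite (gt_eqF s0) implybT.
  by congr (_ `^ _); ring.
by rewrite !real_complexM; ring.
Qed.

(** Re x_i is negative because Re a_i and p are positive, so the point of evaluation lies in the
    domain of the continuation. *)
Lemma slit_FD_argument i : slit (1 - x i).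
Proof.
apply: slit_Re; rewrite cReB [X in _ - Re X](_ : _ = (- (2 / p))%:C * a i).
  by rewrite cReZ mulNr opprK addr_gt0// mulr_gt0// divr_gt0.
rewrite -(mulNr 2 p^-1) real_complexM real_complexV (rmorphN (real_complex R)); ring.
Qed.

Lemma expectation_Qfun_formula d (T : measurableType d) (P : probability T R)
    (X : {RV P >-> R}) : (forall w, 0 <= X w) ->
  (forall s : R, s <= 0 -> 'M_P X s = (Re (mgf s))%:E /\ Im (mgf s) = 0) ->
  let V := ((2 * Num.sqrt pi)^-1)%:C * K *
    (Gamma (2^-1 + B) / Gamma (1 + B))%:C * ((2 / p) `^ B)%:C * FD_int b B x in
  ('E_P[fun w => Qfun (Num.sqrt (p * X w))])%E = (Re V)%:E /\ Im V = 0.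
Proof.
move=> X0 mgfE V.
have bf : bmeas (fun s => integrand s).
  by apply: bmeas_prod => i; apply: bmeas_psi; exact: slit_FD_argument.
have bkf : bmeas (fun s => kappa * integrand s) by apply: bmeasM => //; exact: bmeas_cst.
have VE : V = cint B (fun s => kappa * integrand s).
  rewrite (cintZ B_gt0 _ bf) /V /FD_int.
  (* The normalising mass of [FD_int] cancels the Gamma quotient of the claim, and the powers of
     sqrt(pi) combine to the 1 / pi of Craig's formula. *)
  have c : (2 * Num.sqrt pi)^-1 * (Gamma (2^-1 + B) / Gamma (1 + B)) * (bmass B)^-1 = pi^-1.
    rewrite /bmass (addrC B) (addrC B 1) -[in RHS](sqr_sqrtr (pi_ge0 R)).
    have massE (s g h : R) : s != 0 -> g != 0 -> h != 0 ->
        (2 * s)^-1 * (g / h) * (s / 2 * g / h)^-1 = (s ^+ 2)^-1.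
      by move=> s0 g0 h0; field; rewrite s0 g0 h0.
    by apply: massE; rewrite gt_eqF ?Gamma_gt0 ?addr_gt0 ?sqrtr_gt0 ?pi_gt0.
  by rewrite -c !(real_complexM _ (bmass B)^-1) (real_complexM (2 * _)^-1 _); ring.
have rN s : - rate s <= 0 by rewrite oppr_le0 ltW// rate_gt0.
have [i1 i2] := bmeas_integrable B_gt0 bkf.
rewrite VE; split.
  rewrite expectation_Qfun// /cint/= /Rintegral fineK; last exact: integrable_fin_num.
  apply: eq_integral => s _; rewrite (mgfE _ (rN s)).1 -EFinM.
  by rewrite -!cReZ mgf_rate.
rewrite /cint/=; transitivity (\int[mu]_(s in D) (0 : R)).
  apply: eq_Rintegral => s _.
  by rewrite -cImZ -mgf_rate cImZ (mgfE _ (rN s)).2 mulr0.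
by rewrite /Rintegral integral0.
Qed.

End GaussianQMean.

Theorem theorem1 (R : realType) (d : measure_display) (T : measurableType d)
  (P : probability T R) (X : {RV P >-> R}) (n : nat) (a b : 'I_n -> R[i]) :
  (forall w, 0 <= X w) ->
  (forall i, 0 < complex.Re (a i)) ->
  complex.Im (\sum_(i < n) b i) = 0 ->
  0 < complex.Re (\sum_(i < n) b i) ->
  (forall s : R, s <= 0 ->
     let M := \prod_(i < n) cpow (1 - s%:C / a i) (- b i) in
     'M_P X s = (complex.Re M)%:E /\ complex.Im M = 0) ->
  let B : R := complex.Re (\sum_(i < n) b i) in
  let K : R[i] := \prod_(i < n) cpow (a i) (b i) in
  (* (i) the cdf *)
  (forall x : R, 0 <= x ->
     let F := K / (Gamma (1 + B))%:C * (x `^ B)%:C *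
              Phi2 (fun i => b i) (1 + B)%:C (fun i => - a i * x%:C) in
     cdf X x = (complex.Re F)%:E /\ complex.Im F = 0)
  /\
  (* (ii) the average of Q(sqrt(p gamma)); F_D evaluated through its
     analytic continuation g *)
  (forall p : R, 0 < p ->
     exists g, FD_continuation (2^-1 + B)%:C (fun i => b i) (1 + B)%:C g /\
     let V := ((2 * Num.sqrt pi)^-1)%:C * K *
              (Gamma (2^-1 + B) / Gamma (1 + B))%:C * ((2 / p) `^ B)%:C *
              g (fun i => - (2%:C * a i) / p%:C) in
     ('E_P[fun w => Qfun (Num.sqrt (p * X w))])%E = (complex.Re V)%:E /\
     complex.Im V = 0).
Proof.
move=> X0 a0 bI B0 mgfE B K; split.
  move=> x x0 F; exact: (cdf_formula a0 bI B0 X0 mgfE x0).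
move=> p p0; exists (FD_int b B); split; first exact: FD_int_continuation.
exact: (expectation_Qfun_formula a0 bI B0 p0 X0 mgfE).
Qed.
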